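(* Let $\mathcal G<E(d)$ be a discrete group in normal form, $x_0\in\mathbb R^d$ with $\mathcal G\cdot x_0\ne\{x_0\}$, $V$ an interaction potential with finite interaction range, $E$ its configurational energy, and $\mathcal R\subset\mathcal G$ an admissible neighborhood range of $id$. Suppose that $E'(\chi_{\mathcal G}x_0)=0$ and that $E''(\chi_{\mathcal G}x_0)$ is positive semidefinite. Then $E''(\chi_{\mathcal G}x_0)$ is bounded with respect to $\|\cdot\|_{\mathcal R,0,0}$. In particular, $\lambda_{\mathrm a,0,0}\in\mathbb R$.
   Context: Group setting. $\mathbb N=\{1,2,\dots\}$. $E(d)=O(d)\ltimes\mathbb R^d$ is the Euclidean group with product $(A_1,b_1)(A_2,b_2)=(A_1A_2,b_1+A_1b_2)$, acting on $\mathbb R^d$ by $(A,b)\cdot x=Ax+b$; $L((A,b))=A$, $\tau((A,b))=b$, and $id$ is the identity element. A subgroup of $E(d)$ is discrete if all its orbits in $\mathbb R^d$ are discrete. A $d_2$-dimensional space group is a discrete subgroup of $E(d_2)$ containing $d_2$ translations with linearly independent translation components. Normal form: $d=d_1+d_2$ with $d_1,d_2\in\mathbb N_0$, $\mathcal S$ is a $d_2$-dimensional space group, and $\mathcal G<E(d)$ is a discrete group all of whose elements are of the form $A\oplus s:=\left(\begin{pmatrix}A&0\\0&L(s)\end{pmatrix},\begin{pmatrix}0\\ \tau(s)\end{pmatrix}\right)$ with $A\in O(d_1)$, $s\in\mathcal S$, such that $\pi:\mathcal G\to\mathcal S$, $A\oplus s\mapsto s$, is surjective (every discrete group has this form up to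 conjugation in $E(d)$). $\mathcal T\subset\mathcal G$ is a fixed set mapped bijectively by $\pi$ onto the subgroup $\mathcal T_{\mathcal S}$ of translations of $\mathcal S$. For $N\in\mathbb N$, $\mathcal T^N:=\{t^N: t\in\mathcal T\}$, and $M_0:=\{N\in\mathbb N:\mathcal T^N\text{ is a normal subgroup of }\mathcal G\}$; it is known that $M_0=m_0\mathbb N$ for some $m_0\in\mathbb N$ and that $\mathcal T^N$ is isomorphic to $\mathbb Z^{d_2}$ and has finite index in $\mathcal G$ for $N\in M_0$. $\mathcal C_N$ is a fixed set of representatives of $\mathcal G/\mathcal T^N$. A function $u$ on $\mathcal G$ is $\mathcal T^N$-periodic if $u(gt)=u(g)$ for all $g\in\mathcal G,t\in\mathcal T^N$, and periodic if it is $\mathcal T^N$-periodic for some $N\in M_0$. $U_{\mathrm{per}}$ is the space of periodic functions $\mathcal G\to\mathbb R^d$. Structure. $x_0\in\mathbb R^d$, $\mathcal G_{x_0}$ is the (finite) stabilizer of $x_0$ in $\mathcal G$, $d_{\mathrm{aff}}$ is the dimension of the affine hull $\mathrm{aff}(\mathcal G\cdot x_0)$. Coordinates are normalized so that $\mathrm{aff}(\mathcal G\cdot x_0)=\{0_{d-d_{\mathrm{aff}}}\}\times\mathbb R^{d_{\mathrm{aff}}}$ and every $g\in\mathcal G$ acts trivially on the first $d-d_{\mathrm{aff}}$ coordinates. $\mathcal G_\sim:=\mathcal G/\mathcal G_{x_0}$ (left cosets), $\mathcal G_\sim^*:=\mathcal G_\sim\setminus\{\mathcal G_{x_0}\}$.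 For $\mathcal R\subset\mathcal G$ with $\mathcal R\mathcal G_{x_0}=\mathcal R$ and $u:\mathcal R\to\mathbb R^d$ put $\bar u(g):=\frac1{|\mathcal G_{x_0}|}\sum_{h'\in\mathcal G_{x_0}}L(h')u(gh')$. Seminorm. $\mathcal R\subset\mathcal G$ is an admissible neighborhood range of $id$ if $\mathcal R$ is finite, $\mathcal R\mathcal G_{x_0}=\mathcal R$ and there are $\mathcal R',\mathcal R''\subset\mathcal G$ with $\mathcal R'\mathcal R''\subset\mathcal R$, $id\in\mathcal R'\cap\mathcal R''$, $\mathcal R'$ generating $\mathcal G$, and $\mathrm{aff}(\mathcal R''\cdot x_0)=\mathrm{aff}(\mathcal G\cdot x_0)$. $\mathrm{Skew}_{0,0}(d)$ is the space of real skew-symmetric $d\times d$ matrices whose entries outside the upper left $d_1\times d_1$ block vanish. $U_{\mathrm{iso},0,0}(\mathcal R)$ is the space of $u:\mathcal R\to\mathbb R^d$ for which there are $a\in\mathbb R^d$, $S\in\mathrm{Skew}_{0,0}(d)$ with $L(g)\bar u(g)=a+S(g\cdot x_0-x_0)$ for all $g\in\mathcal R$. With $\|v\|^2=\sum_{h\in\mathcal R}\|v(h)\|^2$ on $(\mathbb R^d)^{\mathcal R}$ and $\pi_U$ the orthogonal projection of $(\mathbb R^d)^{\mathcal R}$ with kernel $U$, for $\mathcal T^N$-periodic $u\in U_{\mathrm{per}}$: $\|u\|_{\mathcal R,0,0}^2=\frac1{|\mathcal C_N|}\sum_{g\in\mathcal C_N}\|\pi_{U_{\mathrm{iso},0,0}(\mathcal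 R)}(u(g\,\cdot)|_{\mathcal R})\|^2$. Energy. An interaction potential is a function $V:(\mathbb R^d)^{\mathcal G_\sim^*}\to\mathbb R$ such that (H1) $V(Ry)=V(y)$ for all $R\in O(d)$ and all $y$; (H2) for every $y:\mathcal G_\sim^*\to\mathbb R^d$ the map $L^\infty(\mathcal G_\sim^*,\mathbb R^d)\to\mathbb R$, $z\mapsto V(y+z)$, is twice continuously Fréchet differentiable (sup norm), with derivatives denoted $V'(y),V''(y)$; (H3) with $(\partial_gV(y))_i=V'(y)(\delta_ge_i)$ (row vector) and $(\partial_g\partial_hV(y))_{ij}=V''(y)(\delta_ge_i,\delta_he_j)$, where $\delta_g$ is the indicator function of $\{g\}$ on $\mathcal G_\sim^*$, one has $\sum_g\|\partial_gV(y)\|<\infty$ and $\sum_{g,h}\|\partial_g\partial_hV(y)\|<\infty$. $V$ has finite interaction range if there is a finite $\tilde{\mathcal R}_V\subset\mathcal G_\sim^*$ with $V(y)=V(\chi_{\tilde{\mathcal R}_V}y)$ for all $y$ ($\chi$ = indicator function); then (H3) is automatic. The configurational energy $E:U_{\mathrm{per}}\to\mathbb R$ is $$E(w)=\frac1{|\mathcal C_N|}\sum_{g\in\mathcal C_N}V\Big(\Big(\tfrac1{|\mathcal G_{x_0}|}\sum_{h'\in h}(gh')\cdot w(gh')-\tfrac1{|\mathcal G_{x_0}|}\sum_{h'\in\mathcal G_{x_0}}(gh')\cdot w(gh')\Big)_{h\in\mathcal G_\sim^*}\Big)$$ for $\mathcal T^N$-periodic $w$; it is twice continuously Fréchet differentiable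 for $\|\cdot\|_\infty$. $\chi_{\mathcal G}x_0$ is the constant function with value $x_0$. Stability constant. $\lambda_{\mathrm a,0,0}:=\sup\{c\in\mathbb R: c\|u\|_{\mathcal R,0,0}^2\le E''(\chi_{\mathcal G}x_0)(u,u)\ \forall u\in U_{\mathrm{per}}\}$ ($\sup\emptyset=-\infty$). A bilinear form $B$ on a real vector space $W$ is bounded with respect to a seminorm $\|\cdot\|$ if there is $C>0$ with $|B(v,w)|\le C\|v\|\|w\|$ for all $v,w\in W$. *)

(* Defs.v *)
From HB Require Import structures.
From mathcomp Require Import all_boot all_order all_algebra finmap.
From mathcomp Require Import mathcomp_extra boolp classical_sets functions.
From mathcomp Require Import cardinality fsbigop reals ereal topology normedtype.
From mathcomp Require Import esum numfun.

Set Implicit Arguments.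
Unset Strict Implicit.
Unset Printing Implicit Defensive.

Import Order.TTheory GRing.Theory Num.Theory.
Import numFieldNormedType.Exports.

Local Open Scope classical_set_scope.
Local Open Scope ring_scope.

(** * The orthogonal group and the Euclidean group *)

Record orth (R : realType) (n : nat) :=
  Orth { orth_val :> 'M[R]_n ; _ : orth_val^T *m orth_val == 1%:M }.

Section Orth.
Context (R : realType) (n : nat).
Implicit Types A B C : orth R n.

HB.instance Definition _ := [isSub of orth R n for @orth_val R n].
HB.instance Definition _ := [Choice of orth R n by <:].

Fact orth1_subproof : (1%:M : 'M[R]_n)^T *m 1%:M == 1%:M.
Proof. by rewrite trmx1 mulmx1. Qed.

Fact orthM_subproof A B : (A *m B)^T *m (A *m B) == 1%:M.
Proof.
case: A B => [A /= /eqP AP] [B /= /eqP BP].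
by rewrite trmx_mul mulmxA -(mulmxA B^T) AP mulmx1 BP.
Qed.

Fact orthV_subproof A : (A^T)^T *m A^T == 1%:M.
Proof. by case: A => [A /= /eqP AP]; rewrite trmxK; apply/eqP/mulmx1C. Qed.

Definition orth1 : orth R n := Orth orth1_subproof.
Definition orthM A B : orth R n := Orth (orthM_subproof A B).
Definition orthV A : orth R n := Orth (orthV_subproof A).

Fact orthA : associative orthM.
Proof. by move=> A B C; apply: val_inj; rewrite /= mulmxA. Qed.
Fact orth1l : left_id orth1 orthM.
Proof. by move=> A; apply: val_inj; rewrite /= mul1mx. Qed.
Fact orth1r : right_id orth1 orthM.
Proof. by move=> A; apply: val_inj; rewrite /= mulmx1. Qed.
Fact orthVl : left_inverse orth1 orthV orthM.
Proof. by case=> A AP; apply: val_inj => /=; apply/eqP. Qed.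
Fact orthVr : right_inverse orth1 orthV orthM.
Proof. by case=> A AP; apply: val_inj => /=; apply/mulmx1C/eqP. Qed.

HB.instance Definition _ :=
  isGroup.Build (orth R n) orthA orth1l orth1r orthVl orthVr.

End Orth.

(** [Euclid A b] is the isometry [x |-> A x + b]. *)
Record euclid (R : realType) (n : nat) :=
  Euclid { linpart : orth R n ; trans : 'cV[R]_n }.

Section Euclid.
Context (R : realType) (n : nat).
Implicit Types g h : euclid R n.

Definition pair_of_euclid g := (linpart g, trans g).
Definition euclid_of_pair (p : orth R n * 'cV[R]_n) := Euclid p.1 p.2.

Fact pair_of_euclidK : cancel pair_of_euclid euclid_of_pair.
Proof. by case. Qed.

HB.instance Definition _ := Choice.copy (euclid R n) (can_type pair_of_euclidK).

Definition lin g : 'M[R]_n := linpart g.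
Definition act g (x : 'cV[R]_n) : 'cV[R]_n := lin g *m x + trans g.

Definition euclid1 : euclid R n := Euclid 1%g 0.
Definition euclidM g h : euclid R n :=
  Euclid (linpart g * linpart h)%g (trans g + linpart g *m trans h).
Definition euclidV g : euclid R n :=
  Euclid (linpart g)^-1%g (- ((linpart g)^-1%g *m trans g)).

Fact euclidA : associative euclidM.
Proof.
move=> g h k; congr Euclid; rewrite /= ?mulgA//.
by rewrite mulmxDr addrA mulmxA.
Qed.
Fact euclid1l : left_id euclid1 euclidM.
Proof. by case=> A b; congr Euclid; rewrite /= ?mul1g// add0r mul1mx. Qed.
Fact euclid1r : right_id euclid1 euclidM.
Proof. by case=> A b; congr Euclid; rewrite /= ?mulg1// mulmx0 addr0. Qed.
Fact euclidVl : left_inverse euclid1 euclidV euclidM.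
Proof. by case=> A b; congr Euclid; rewrite /= ?mulVg// addNr. Qed.
Fact euclidVr : right_inverse euclid1 euclidV euclidM.
Proof.
case=> -[A AP] b; congr Euclid; rewrite /= ?mulgV//.
by rewrite mulmxN mulmxA (mulmx1C (eqP AP)) mul1mx subrr.
Qed.

HB.instance Definition _ :=
  isGroup.Build (euclid R n) euclidA euclid1l euclid1r euclidVl euclidVr.

Lemma actM g h x : act (g * h)%g x = act g (act h x).
Proof. by rewrite /act /= mulmxDr mulmxA -addrA (addrC (trans g)). Qed.

End Euclid.

(** The elements of a subgroup, as a group in its own right. *)
Record elt (gT : groupType) (G : groupClosed gT) :=
  Elt { elt_val : gT ; _ : elt_val \in G }.

Section Elt.
Context (gT : groupType) (G : groupClosed gT).

HB.instance Definition _ := [isSub of elt G for @elt_val gT G].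
HB.instance Definition _ := [Choice of elt G by <:].

Fact elt_subproof : group_closed (fun g : gT => g \in G).
Proof. by split=> [|x y xG yG]; [exact: gpred1 | exact: gpredF]. Qed.

HB.instance Definition _ :=
  SubChoice_isSubGroup.Build gT (fun g => g \in G) (elt G) elt_subproof.

End Elt.

(** * Discrete groups, space groups and the normal form *)

Section Discrete.
Context (R : realType) (n : nat).
Implicit Types G S : groupClosed (euclid R n).

Definition gorbit G (x : 'cV[R]_n) : set 'cV[R]_n :=
  [set act (val g) x | g in [set: elt G]].

Definition discrete_group G : Prop := forall x, gorbit G x `<=` isolated (gorbit G x).

Definition translations S : set (euclid R n) :=
  [set s | s \in S /\ lin s = 1%:M].

Definition space_group S : Prop :=
  discrete_group S /\
  exists s : 'I_n -> euclid R n,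
    (forall i, translations S (s i)) /\ row_free (\matrix_i (trans (s i))^T).

Definition aff (X : set 'cV[R]_n) : set 'cV[R]_n :=
  [set x | exists (m : nat) (c : 'I_m -> R) (p : 'I_m -> 'cV[R]_n),
     [/\ forall i, X (p i), \sum_i c i = 1 & x = \sum_i c i *: p i]].

End Discrete.

Section NormalForm.
Context (R : realType) (d1 d2 : nat).

Fact dsum_subproof (A : orth R d1) (B : orth R d2) :
  (block_mx A 0 0 B)^T *m block_mx A 0 0 B == 1%:M.
Proof.
case: A B => [A /= /eqP AP] [B /= /eqP BP].
rewrite tr_block_mx !trmx0 mulmx_block !mulmx0 !mul0mx !addr0 !add0r AP BP.
by rewrite -scalar_mx_block.
Qed.

Definition dsum (A : orth R d1) (s : euclid R d2) : euclid R (d1 + d2) :=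
  Euclid (Orth (dsum_subproof A (linpart s))) (col_mx 0 (trans s)).

(** The map [dsum A s |-> s]; the default value of [insubd] is only reached
    when the lower right block is not orthogonal, see [dsum_projE]. *)
Definition dsum_proj (g : euclid R (d1 + d2)) : euclid R d2 :=
  Euclid (insubd (1%g : orth R d2) (drsubmx (lin g))) (dsubmx (trans g)).

Lemma dsum_projE A s : dsum_proj (dsum A s) = s.
Proof.
case: s => B b; congr Euclid; last by rewrite /= col_mxKd.
by apply: val_inj; rewrite /lin /= block_mxKdr insubdK// unfold_in; case: B.
Qed.

Definition normal_form (S : groupClosed (euclid R d2))
    (G : groupClosed (euclid R (d1 + d2))) : Prop :=
  [/\ space_group S, discrete_group G,
      forall g, g \in G -> exists2 s, s \in S & exists A, g = dsum A s
    & dsum_proj @` [set` G] = [set` S]].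

(** [aff (G . x0) = {0} x R^daff] and [G] fixes the first [d - daff]
    coordinates of every vector. *)
Definition normalized_coordinates (G : groupClosed (euclid R (d1 + d2)))
    (x0 : 'cV[R]_(d1 + d2)) (daff : nat) : Prop :=
  [/\ (daff <= d1 + d2)%N,
      aff (gorbit G x0) =
        [set x | forall i : 'I_(d1 + d2), (i < d1 + d2 - daff)%N -> x i 0 = 0]
    & forall g, g \in G -> forall (x : 'cV[R]_(d1 + d2)) (i : 'I_(d1 + d2)),
        (i < d1 + d2 - daff)%N -> act g x i 0 = x i 0].

End NormalForm.

(** * Subgroups of an abstract group *)

Section GroupSets.
Context (gT : groupType).
Implicit Types (H K T : set gT) (g h : gT).

Definition subgroup H : Prop :=
  [/\ H 1%g, forall g h, H g -> H h -> H (g * h)%g & forall g, H g -> H (g^-1)%g].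

Definition normal_subgroup H : Prop :=
  subgroup H /\ forall g h, H h -> H (g * h * g^-1)%g.

Definition generates H : Prop := smallest subgroup H = [set: gT].

Definition mulset H K : set gT := [set (h * k)%g | h in H & k in K].

Definition lcoset_of H g : set gT := [set (g * h)%g | h in H].

Definition powers T (N : nat) : set gT := [set (t ^+ N)%g | t in T].

Definition M0 T : set nat := [set N | (0 < N)%N /\ normal_subgroup (powers T N)].

(** Exactly one element of [C] in every left coset of [H]. *)
Definition representatives (C : {fset gT}) H : Prop :=
  forall g, exists! c, c \in C /\ lcoset_of H c g.

Definition periodic (X : Type) T (N : nat) (u : gT -> X) : Prop :=
  forall g t, powers T N t -> u (g * t)%g = u g.

Definition Uper (X : Type) T : set (gT -> X) :=
  [set u | exists2 N, M0 T N & periodic T N u].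

(** Some [N] in [M0 T] for which [u] is periodic. *)
Definition period (X : Type) T (u : gT -> X) : nat :=
  xget 1%N [set N | M0 T N /\ periodic T N u].

End GroupSets.

(** * Norms and Frechet derivatives *)

Definition fnorm (R : realType) (m n : nat) (A : 'M[R]_(m, n)) : R :=
  Num.sqrt (\sum_i \sum_j A i j ^+ 2).

Section SupNorm.
Context (R : realType) (n : nat) (I : Type).
Implicit Types z : I -> 'cV[R]_n.

Definition Linfty : set (I -> 'cV[R]_n) :=
  [set z | exists M, forall i, fnorm (z i) <= M].

Definition supnorm z : R := sup [set fnorm (z i) | i in [set: I]].

End SupNorm.

(** Derivatives of [F] along the subspace [W] of [X], normed by [nrm]. They are
    only determined on [W], and operator norms are spelled out since [W] is a
    set rather than a type. *)
Section Frechet.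
Context (R : realType) (X : lmodType R) (nrm : X -> R) (W : set X).
Implicit Types (F A : X -> R) (B : X -> X -> R).

Definition linear_on A : Prop :=
  forall (a : R) u v, W u -> W v -> A (a *: u + v) = a * A u + A v.

Definition bounded_linear A : Prop :=
  linear_on A /\ exists C, forall u, W u -> `|A u| <= C * nrm u.

Definition bounded_wrt B : Prop :=
  exists2 C, 0 < C & forall u v, W u -> W v -> `|B u v| <= C * nrm u * nrm v.

Definition bounded_bilinear B : Prop :=
  [/\ forall u, W u -> linear_on (B u), forall v, W v -> linear_on (B^~ v)
    & bounded_wrt B].

Definition is_derivative1 F (x : X) A : Prop :=
  bounded_linear A /\
  forall eps, 0 < eps -> exists2 del, 0 < del &
    forall h, W h -> nrm h < del -> `|F (x + h) - F x - A h| <= eps * nrm h.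

(** [F'(x)] *)
Definition derivative1 F (x : X) : X -> R :=
  xget (fun=> 0) [set A | is_derivative1 F x A].

Definition is_derivative2 F (x : X) B : Prop :=
  bounded_bilinear B /\
  forall eps, 0 < eps -> exists2 del, 0 < del &
    forall h, W h -> nrm h < del -> forall k, W k ->
      `|derivative1 F (x + h) k - derivative1 F x k - B h k|
        <= eps * nrm h * nrm k.

(** [F''(x)] *)
Definition derivative2 F (x : X) : X -> X -> R :=
  xget (fun _ _ => 0) [set B | is_derivative2 F x B].

Definition C2_on F : Prop :=
  forall x, W x ->
  [/\ exists A, is_derivative1 F x A, exists B, is_derivative2 F x B
    & forall eps, 0 < eps -> exists2 del, 0 < del &
        forall h, W h -> nrm h < del -> forall k l, W k -> W l ->
          `|derivative2 F (x + h) k l - derivative2 F x k l|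
            <= eps * nrm k * nrm l].

End Frechet.

(** * Interaction potentials, the energy and the seminorm *)

Section Structure.
Context (R : realType) (d1 d2 : nat).
Local Notation d := (d1 + d2)%N.
Context (G : groupClosed (euclid R d)) (x0 : 'cV[R]_d).
Implicit Types (g h : elt G) (w u : elt G -> 'cV[R]_d).

Definition stab : set (elt G) := [set g | act (val g) x0 = x0].

(** [1 / |G_x0|] *)
Definition stab_weight : R := (#|` fset_set stab |)%:R^-1.

(** [G_sim^*]: the left cosets_star of the stabilizer other than the stabilizer itself. *)
Definition cosets_star : set (set (elt G)) :=
  [set lcoset_of stab g | g in [set: elt G]] `\ stab.

Local Notation config := (cosets_star -> 'cV[R]_d).

Definition delta (g : cosets_star) (i : 'I_d) : config :=
  fun h : cosets_star => \1_[set g] h *: delta_mx i 0.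

Definition dV (V : config -> R) (y : config) : config -> R :=
  derivative1 (@supnorm R d cosets_star) (@Linfty R d cosets_star) (fun z => V (y + z)) 0.

Definition d2V (V : config -> R) (y : config) : config -> config -> R :=
  derivative2 (@supnorm R d cosets_star) (@Linfty R d cosets_star) (fun z => V (y + z)) 0.

Definition pdV V y (g : cosets_star) : 'rV[R]_d := \row_i dV V y (delta g i).

Definition pd2V V y (g h : cosets_star) : 'M[R]_d :=
  \matrix_(i, j) d2V V y (delta g i) (delta h j).

Record interaction_potential (V : config -> R) : Prop := InteractionPotential {
  potential_invariant :
    forall (A : orth R d) y, V (fun h : cosets_star => A *m y h) = V y ;
  potential_C2 : forall y : config,
    C2_on (@supnorm R d cosets_star) (@Linfty R d cosets_star) (fun z => V (y + z)) ;
  potential_summable1 : forall y,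
    (\esum_(g in [set: cosets_star]) (fnorm (pdV V y g))%:E < +oo)%E ;
  potential_summable2 : forall y,
    (\esum_(p in [set: cosets_star * cosets_star])
       (fnorm (pd2V V y p.1 p.2))%:E < +oo)%E }.

Definition finite_range (V : config -> R) : Prop :=
  exists2 A : set cosets_star, finite_set A &
    forall y, V y = V (fun h : cosets_star => \1_A h *: y h).

Section Periodic.
Context (T : set (elt G)) (C : nat -> {fset elt G}).

(** The argument of [V] in the summand of [E w] with index [g]. *)
Definition local_config w g : config := fun h : cosets_star =>
  stab_weight *: (\sum_(h' \in sval h) act (val (g * h')%g) (w (g * h')%g)) -
  stab_weight *: (\sum_(h' \in stab) act (val (g * h')%g) (w (g * h')%g)).

Definition energy (V : config -> R) w : R :=
  let CN := C (period T w) in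
  (#|` CN|)%:R^-1 * \sum_(g <- CN) V (local_config w g).

Definition UperG : set (elt G -> 'cV[R]_d) := Uper T.

Definition dE (V : config -> R) w :=
  derivative1 (@supnorm R d (elt G)) UperG (energy V) w.

Definition d2E (V : config -> R) w :=
  derivative2 (@supnorm R d (elt G)) UperG (energy V) w.

Section Seminorm.
Context (Rg : {fset elt G}).
Implicit Types v : Rg -> 'cV[R]_d.

(** Extension by zero; only used at points [g * h'] with [g] in the range and
    [h'] in the stabilizer, which lie in the range again. *)
Definition ext v g : 'cV[R]_d := oapp v 0 (insub g).

(** [\bar u] *)
Definition bar v g : 'cV[R]_d :=
  stab_weight *: \sum_(h' \in stab) lin (val h') *m ext v (g * h')%g.

Definition dotr v v' : R := \sum_(h : Rg) \sum_i v h i 0 * v' h i 0.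

(** [Skew_{0,0}(d)] *)
Definition skew00 : set 'M[R]_d :=
  [set S | S^T = - S /\
     forall i j : 'I_d, ~~ ((i < d1)%N && (j < d1)%N) -> S i j = 0].

(** [U_{iso,0,0}] *)
Definition Uiso00 : set (Rg -> 'cV[R]_d) :=
  [set v | exists (a : 'cV[R]_d) (S : 'M[R]_d), skew00 S /\
     forall g : Rg, lin (val (fsval g)) *m bar v (fsval g) =
       a + S *m (act (val (fsval g)) x0 - x0)].

(** The orthogonal projection with kernel [U]. *)
Definition proj_ker (U : set (Rg -> 'cV[R]_d)) v : Rg -> 'cV[R]_d :=
  xget (fun=> 0) [set p | U (v - p) /\ forall v', U v' -> dotr p v' = 0].

Definition seminorm00 u : R :=
  let CN := C (period T u) in
  Num.sqrt ((#|` CN|)%:R^-1 * \sum_(g <- CN)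
    let p := proj_ker Uiso00 (fun h : Rg => u (g * fsval h)%g) in dotr p p).

Definition admissible_range : Prop :=
  mulset [set` Rg] stab = [set` Rg] /\
  exists R' R'' : set (elt G),
    [/\ mulset R' R'' `<=` [set` Rg], R' 1%g /\ R'' 1%g, generates R'
      & aff [set act (val g) x0 | g in R''] = aff (gorbit G x0)].

Definition lambda_a00 (V : config -> R) : \bar R :=
  ereal_sup [set c%:E | c in [set c : R | forall u, UperG u ->
    c * seminorm00 u ^+ 2 <= d2E V (cst x0) u u]].

End Seminorm.
End Periodic.
End Structure.

Arguments stab {R d1 d2} G x0.
Arguments stab_weight {R d1 d2} G x0.
Arguments cosets_star {R d1 d2} G x0.
Arguments interaction_potential {R d1 d2} G x0 V.
Arguments finite_range {R d1 d2} G x0 V.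
Arguments UperG {R d1 d2} G T.
Arguments dE {R d1 d2} G x0 T C V w.
Arguments d2E {R d1 d2} G x0 T C V w.
Arguments seminorm00 {R d1 d2} G x0 T C Rg u.
Arguments admissible_range {R d1 d2} G x0 Rg.
Arguments lambda_a00 {R d1 d2} G x0 T C Rg V.

(* Main.v *)
(** The Hessian is the mean over the group of the second derivative of [V], at a
    finitely supported truncation of the reference configuration, evaluated on the
    discrete gradients [Dq u g].  The local fits [u(g .)|_R = p_g + (a_g, S_g)] give a
    field [S] of skew matrices whose defect [S_(gk) - L(k)^T S_g L(k)] is bounded by
    the seminorm for every [k], because the admissible range generates the group.
    The field [v(g) = S_g x0] has the same gradients as [u] up to the seminorm, so by
    positive semidefiniteness it suffices to bound [E''(v, v)] by the squared defect.

    Rotation invariance of [V] together with [E' = 0] gives the mixed bound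
    [|E''(v, w)| <= C (defect(S)^2 + |w|^2)].  On the translation lattice [E''(v, v)]
    becomes a quadratic form in [S] that is translation invariant up to a
    representation [rho].  For such nonnegative forms on an abelian group the mixed
    bound alone yields [B(S, S) <= C defect(S)^2]: modulo forms of that size the
    coefficients may be taken [rho]-invariant; testing with cut-offs on Folner boxes
    makes the form vanish on constant fields, and testing nonnegativity with cut-off
    reflections of [S] bounds the remaining second-order terms.  Boundedness is then
    the Cauchy-Schwarz inequality. *)

Require Import Defs.
From mathcomp Require Import all_boot all_order all_algebra finmap.
From mathcomp Require Import boolp classical_sets functions.
From mathcomp Require Import cardinality fsbigop reals ereal topology normedtype.
From mathcomp Require Import derive numfun.
From mathcomp Require Import ring lra.

Set Implicit Arguments.
Unset Strict Implicit.
Unset Printing Implicit Defensive.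

Import Order.TTheory GRing.Theory Num.Theory.
Import numFieldNormedType.Exports.

Local Open Scope classical_set_scope.
Local Open Scope ring_scope.

(** * Squared Frobenius norm, bilinear forms and orthogonal projections *)

(** The seminorm controls how the fitted skew matrices vary from point to point but not their size,
    so the mixed bound with w = v still leaves a term |S|^2. The mechanism that removes it is
    visible in Fourier variables: a translation-invariant form on lattice fields has a symbol q(xi),
    and the mixed bound says that q is of first order at xi = 0. A nonnegative symbol that vanishes
    at 0 has no linear term, hence is of second order, which is the size of the squared defect. No
    Fourier transform is taken: the passage from q(xi) to q(-xi) is the reflection of fields, and
    q(xi) + q(-xi) is of second order.

    Three obstacles shape the rest. The group is not abelian, so the fitted field is replaced by one
    determined by its values on a normal lattice of finite index. All fields are periodic, so a
    cut-off test field has to be repeated along a period so sparse that its copies do not interact.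
    The fits see only directions within the affine hull of the orbit, so the skew matrices are
    normalized to vanish on the remaining block. *)

Section SquareNorm.
Context {R : realType}.

Definition nsq (m n : nat) (A : 'M[R]_(m, n)) : R := \sum_i \sum_j A i j ^+ 2.

Lemma nsq_ge0 m n (A : 'M[R]_(m, n)) : 0 <= nsq A.
Proof. by apply: sumr_ge0 => i _; apply: sumr_ge0 => j _; apply: sqr_ge0. Qed.

Lemma nsq0 m n : nsq (0 : 'M[R]_(m, n)) = 0.
Proof. by apply: big1 => i _; apply: big1 => j _; rewrite mxE expr0n. Qed.

Lemma nsq_eq0 m n (A : 'M[R]_(m, n)) : nsq A = 0 -> A = 0.
Proof.
move=> A0; apply/matrixP => i j; rewrite mxE; apply/eqP; rewrite -sqrf_eq0; apply/eqP.
have rowz k : \sum_l A k l ^+ 2 = 0.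
  by apply: (psumr_eq0P _ A0) => // l _; apply: sumr_ge0 => q _; apply: sqr_ge0.
by apply: (psumr_eq0P _ (rowz i)) => // l _; apply: sqr_ge0.
Qed.

Lemma nsqZ m n c (A : 'M[R]_(m, n)) : nsq (c *: A) = c ^+ 2 * nsq A.
Proof.
rewrite /nsq mulr_sumr; apply: eq_bigr => i _; rewrite mulr_sumr.
by apply: eq_bigr => j _; rewrite mxE exprMn.
Qed.

Lemma nsqN m n (A : 'M[R]_(m, n)) : nsq (- A) = nsq A.
Proof. by rewrite -scaleN1r nsqZ sqrrN expr1n mul1r. Qed.

Lemma entry_le_nsq m n (A : 'M[R]_(m, n)) i j : A i j ^+ 2 <= nsq A.
Proof.
rewrite /nsq (bigD1 i)//= (bigD1 j)//= -addrA lerDl.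
by rewrite addr_ge0// sumr_ge0// => k _; rewrite ?sumr_ge0// => *; rewrite sqr_ge0.
Qed.

Lemma nsqD_le m n (A B : 'M[R]_(m, n)) : nsq (A + B) <= 2 * nsq A + 2 * nsq B.
Proof.
rewrite /nsq !mulr_sumr -big_split ler_sum// => i _.
rewrite !mulr_sumr -big_split ler_sum// => j _; rewrite mxE.
have := sqr_ge0 (A i j - B i j); rewrite /=; nra.
Qed.

Lemma nsqB_le m n (A B : 'M[R]_(m, n)) : nsq (A - B) <= 2 * nsq A + 2 * nsq B.
Proof. by rewrite -(nsqN B); exact: nsqD_le. Qed.

(** Iterating [nsqD_le] costs a factor 2 per summand; later estimates only use that the factor does
    not depend on the summands. *)
Lemma nsq_sum_le (I : Type) m n (r : seq I) (A : I -> 'M[R]_(m, n)) :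
  nsq (\sum_(i <- r) A i) <= (2 ^ size r)%:R * \sum_(i <- r) nsq (A i).
Proof.
elim: r => [|i r IH]; first by rewrite !big_nil nsq0 mulr0.
rewrite !big_cons /= (le_trans (nsqD_le _ _))// expnS natrM -mulrA mulrDr mulrDr.
rewrite lerD ?ler_pM2l// ler_peMl ?nsq_ge0// (ler_nat _ 1).
by rewrite expn_gt0.
Qed.

Lemma nsq_tr m n (A : 'M[R]_(m, n)) : nsq A^T = nsq A.
Proof.
by rewrite /nsq exchange_big; apply: eq_bigr => i _; apply: eq_bigr => j _; rewrite mxE.
Qed.

Lemma nsqE m n (A : 'M[R]_(m, n)) : nsq A = \tr (A^T *m A).
Proof.
rewrite /nsq exchange_big; apply: eq_bigr => j _; rewrite mxE.
by apply: eq_bigr => i _; rewrite mxE expr2.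
Qed.

Lemma cauchy_sum (I : finType) (x y : I -> R) :
  (\sum_i x i * y i) ^+ 2 <= (\sum_i x i ^+ 2) * (\sum_i y i ^+ 2).
Proof.
set a := \sum_i x i ^+ 2; set b := \sum_i x i * y i; set c := \sum_i y i ^+ 2.
have a0 : 0 <= a by apply: sumr_ge0 => i _; apply: sqr_ge0.
have H t : 0 <= t ^+ 2 * a + 2 * t * b + c.
  rewrite /a /b /c !mulr_sumr -!big_split sumr_ge0// => i _ /=.
  by have := sqr_ge0 (t * x i + y i); lra.
case: (ltrP 0 a) => [a1|a1].
  (* The quadratic in [t] is smallest at [- b / a], where its value is [(a * c - b ^+ 2) / a]. *)
  have := H (- b / a).
  have -> : (- b / a) ^+ 2 * a + 2 * (- b / a) * b + c = (a * c - b ^+ 2) / a.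
    by field; rewrite gt_eqF.
  by rewrite pmulr_lge0 ?invr_gt0// subr_ge0.
have a2 : a = 0 by apply/eqP; rewrite eq_le a1 a0.
have x0 i : x i = 0.
  apply/eqP; rewrite -sqrf_eq0; apply/eqP.
  by move/psumr_eq0P: a2 => -> // j _; apply: sqr_ge0.
by rewrite /b big1 ?expr0n ?a2 ?mul0r// => i _; rewrite x0 mul0r.
Qed.

Lemma nsqM_le m n p (A : 'M[R]_(m, n)) (B : 'M[R]_(n, p)) :
  nsq (A *m B) <= nsq A * nsq B.
Proof.
rewrite /nsq mulr_suml ler_sum// => i _.
rewrite [X in _ <= _ * X]exchange_big mulr_sumr ler_sum// => j _.
by rewrite mxE; apply: cauchy_sum.
Qed.

Lemma nsq_orthl m n (O : 'M[R]_m) (A : 'M[R]_(m, n)) :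
  O^T *m O = 1%:M -> nsq (O *m A) = nsq A.
Proof. by move=> OO; rewrite !nsqE trmx_mul mulmxA -(mulmxA _ O^T) OO mulmx1. Qed.

Lemma nsq_orthr m n (O : 'M[R]_n) (A : 'M[R]_(m, n)) :
  O *m O^T = 1%:M -> nsq (A *m O) = nsq A.
Proof. by move=> OO; rewrite -nsq_tr trmx_mul nsq_orthl ?nsq_tr// trmxK. Qed.

Definition bil (m n : nat) (Y : 'M[R]_(m, n)) (x : 'rV[R]_m) (z : 'rV[R]_n) : R :=
  (x *m Y *m z^T) 0 0.

(** Cauchy-Schwarz bounds the square by [nsq x * nsq Y * nsq z]. The factors [1 + nsq Y] and
    [nsq x + nsq z] dominate the corresponding square roots and keep later estimates free of
    roots. *)
Lemma bil_le m n (Y : 'M[R]_(m, n)) x z :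
  `|bil Y x z| <= (1 + nsq Y) * (nsq x + nsq z).
Proof.
have nsq1 (A : 'M[R]_1) : nsq A = A 0 0 ^+ 2 by rewrite /nsq !big_ord1.
have H : bil Y x z ^+ 2 <= nsq x * nsq Y * nsq z.
  rewrite -nsq1 (le_trans (nsqM_le _ _))// nsq_tr ler_wpM2r ?nsq_ge0//.
  exact: nsqM_le.
have x0 := nsq_ge0 x; have z0 := nsq_ge0 z; have y0 := nsq_ge0 Y.
rewrite -(ler_pXn2r (_ : 0 < 2)%N) ?nnegrE ?normr_ge0//; last nra.
rewrite real_normK ?num_real// (le_trans H)// exprMn.
set X := nsq x in x0 *; set Z := nsq z in z0 *; set W := nsq Y in y0 *.
have h1 : X * Z <= (X + Z) ^+ 2 by nra.
have h2 : W <= (1 + W) ^+ 2 by nra.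
rewrite mulrAC mulrC; apply: ler_pM => //; exact: mulr_ge0.
Qed.

Lemma bilDl m n (Y : 'M[R]_(m, n)) x x' z : bil Y (x + x') z = bil Y x z + bil Y x' z.
Proof. by rewrite /bil !mulmxDl mxE. Qed.
Lemma bilDr m n (Y : 'M[R]_(m, n)) x z z' : bil Y x (z + z') = bil Y x z + bil Y x z'.
Proof. by rewrite /bil linearD mulmxDr mxE. Qed.
Lemma bilZl m n (Y : 'M[R]_(m, n)) c x z : bil Y (c *: x) z = c * bil Y x z.
Proof. by rewrite /bil -!scalemxAl mxE. Qed.
Lemma bilZr m n (Y : 'M[R]_(m, n)) c x z : bil Y x (c *: z) = c * bil Y x z.
Proof. by rewrite /bil linearZ -scalemxAr mxE. Qed.
Lemma bilNl m n (Y : 'M[R]_(m, n)) x z : bil Y (- x) z = - bil Y x z.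
Proof. by rewrite -scaleN1r bilZl mulN1r. Qed.
Lemma bilNr m n (Y : 'M[R]_(m, n)) x z : bil Y x (- z) = - bil Y x z.
Proof. by rewrite -scaleN1r bilZr mulN1r. Qed.
Lemma bilDm m n c (Y Y' : 'M[R]_(m, n)) x z :
  bil (c *: Y + Y') x z = c * bil Y x z + bil Y' x z.
Proof. by rewrite /bil mulmxDr mulmxDl -scalemxAr -scalemxAl !mxE. Qed.
Lemma bilM m n p q (Y : 'M[R]_(m, n)) x z (A : 'M_(p, m)) (B : 'M_(q, n)) :
  bil Y (x *m A) (z *m B) = bil (A *m Y *m B^T) x z.
Proof. by rewrite /bil trmx_mul !mulmxA. Qed.
Lemma bil0l m n (Y : 'M[R]_(m, n)) z : bil Y 0 z = 0.
Proof. by rewrite /bil !mul0mx mxE. Qed.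
Lemma bil0r m n (Y : 'M[R]_(m, n)) x : bil Y x 0 = 0.
Proof. by rewrite /bil trmx0 mulmx0 mxE. Qed.

Lemma bil1 n (x : 'rV[R]_n) : bil 1%:M x x = nsq x.
Proof.
rewrite /bil mulmx1 mxE /nsq big_ord1; apply: eq_bigr => i _.
by rewrite mxE expr2.
Qed.

Lemma bil1C n (x z : 'rV[R]_n) : bil 1%:M x z = bil 1%:M z x.
Proof.
by rewrite /bil !mulmx1 !mxE; apply: eq_bigr => i _; rewrite !mxE mulrC.
Qed.

Lemma nsqB n (x z : 'rV[R]_n) : nsq (x - z) = nsq x + nsq z - 2 * bil 1%:M x z.
Proof.
rewrite -!bil1 bilDl !bilDr !bilNl !bilNr (bil1C z x); lra.
Qed.

End SquareNorm.

Section Projection.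
Context {R : realType} (V : lmodType R) (J : finType) (c : J -> V -> R).
Hypothesis clin : forall j a x y, c j (a *: x + y) = a * c j x + c j y.

(** Induction on a list of coordinates off which [X] vanishes, replacing [X] by its part in the
    kernel of one coordinate. The subspace is a mere predicate and the inner product comes from the
    coordinates [c], so the same lemma projects coefficient families and windows of
    displacements. *)
Lemma orthogonal_projection (X : set V) :
  X 0 -> (forall a x y, X x -> X y -> X (a *: x + y)) ->
  forall z, exists2 p, X p & forall x, X x -> \sum_j c j (z - p) * c j x = 0.
Proof.
have c0 j : c j 0 = 0.
  by have := clin j 1 0 0; rewrite scaler0 addr0 mul1r => /eqP;
    rewrite addrC -subr_eq subrr => /eqP.
have cB j x y : c j (x - y) = c j x - c j y.
  by rewrite -scaleN1r addrC clin mulN1r addrC.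
pose dot x y := \sum_j c j x * c j y.
have dotC x y : dot x y = dot y x by apply: eq_bigr => j _; rewrite mulrC.
have dotl a x y w : dot (a *: x + y) w = a * dot x w + dot y w.
  by rewrite /dot mulr_sumr -big_split; apply: eq_bigr => j _; rewrite clin mulrDl mulrA.
have dotB x y w : dot (x - y) w = dot x w - dot y w.
  by rewrite -scaleN1r addrC dotl mulN1r addrC.
have main : forall (l : seq J) (X : set V), X 0 ->
    (forall a x y, X x -> X y -> X (a *: x + y)) ->
    (forall x j, X x -> j \notin l -> c j x = 0) ->
    forall z, exists2 p, X p & forall x, X x -> dot (z - p) x = 0.
  elim=> [|j l IH] {}X X0 XZ Xl z.
    by exists 0 => // x Xx; apply: big1 => j _; rewrite (Xl x)// mulr0.
  pose X' := [set x | X x /\ c j x = 0].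
  have [||x i [Xx xj] il|p [Xp pj] pP] := IH X' _ _ _ z.
  - by split.
  - by move=> a x y [Xx xj] [Xy yj]; split; [exact: XZ | rewrite clin xj yj mulr0 addr0].
  - have [->//|ij] := eqVneq i j; apply: Xl => //; by rewrite inE negb_or ij.
  have [XX'|nXX'] := pselect (X `<=` X').
    by exists p => // x Xx; apply: pP; exact: XX'.
  have [x1 [Xx1 x1j]] : exists x1, X x1 /\ c j x1 <> 0.
    apply: contrapT => H; apply: nXX' => x Xx; split => //; apply: contrapT => xj.
    by apply: H; exists x.
  have [||x i [Xx xj] il|q [Xq qj] qP] := IH X' _ _ _ x1.
  - by split.
  - by move=> a x y [Xx xj] [Xy yj]; split; [exact: XZ | rewrite clin xj yj mulr0 addr0].
  - have [->//|ij] := eqVneq i j; apply: Xl => //; by rewrite inE negb_or ij.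
  (* [w] is orthogonal to [X'], and every element of [X] differs from a multiple of [w] by an
     element of [X']. The projection onto [X] is therefore the one onto [X'] plus the component
     along [w]. *)
  pose w := x1 - q.
  have Xw : X w by rewrite /w -scaleN1r addrC; exact: XZ.
  have wj : c j w != 0 by rewrite cB qj subr0; apply/eqP.
  have ww : 0 < dot w w.
    rewrite /dot (bigD1 j)//= ltr_pwDl//; first by rewrite -expr2 exprn_even_gt0.
    by apply: sumr_ge0 => i _; rewrite -expr2 sqr_ge0.
  exists ((dot (z - p) w / dot w w) *: w + p); first exact: XZ.
  move=> x Xx; pose b := c j x / c j w.
  have Xr : X' (x - b *: w).
    split; first by rewrite addrC -scaleNr; exact: XZ.
    by rewrite cB -[b *: w]addr0 clin c0 addr0 /b divfK// subrr.
  have -> : x = b *: w + (x - b *: w) by rewrite addrCA subrr addr0.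
  move: (x - b *: w) Xr => r Xr.
  have qr : dot w r = 0 by apply: qP.
  have pr : dot (z - p) r = 0 by exact: pP.
  have -> : z - (dot (z - p) w / dot w w *: w + p) = z - p - (dot (z - p) w / dot w w) *: w.
    by rewrite opprD addrA addrAC.
  move: (z - p) pr => u pr.
  have d0 y : dot 0 y = 0 by rewrite /dot big1// => i _; rewrite c0 mul0r.
  have dB a y : dot y (u - a *: w) = dot u y - a * dot w y.
    by rewrite dotC dotB -[a *: w]addr0 dotl d0 addr0.
  by rewrite -/(dot _ _) dotC dotl !dB pr qr mulr0 subr0 addr0 divfK ?gt_eqF// subrr mulr0.
move=> X0 XZ z; apply: (main (enum J)) => // x j _.
by rewrite mem_enum.
Qed.

End Projection.

(** * Folner boxes *)

Section Folner.
Context {R : realType} {gT : groupType}.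

(** Bernoulli gives [k%:R * eps <= (1 + eps) ^+ k]; raised to the power [p.+1] it beats a polynomial
    of degree [p]. The constant [q] is the quotient that [k] has to exceed once [k ^ p * eps ^ p.+1]
    is divided out, with [l = k * p.+1]. *)
Lemma exp_gt_poly (eps : R) (p : nat) : 0 < eps ->
  exists l : nat, (l.+1 ^ p)%:R < (1 + eps) ^+ l.
Proof.
move=> e0; pose q : R := (p.+2 ^ p)%:R / eps ^+ p.+1.
have q0 : 0 <= q by rewrite divr_ge0// exprn_ge0// ltW.
pose k := (Num.bound q).+1; exists (k * p.+1)%N.
have qk : q < k%:R.
  by rewrite (lt_trans (archi_boundP q0))// ltr_nat.
have bern j : j%:R * eps <= (1 + eps) ^+ j.
  elim: j => [|j IH]; first by rewrite mul0r.
  rewrite exprS -natr1 mulrDl mul1r mulrDl mul1r.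
  have h1 : 1 <= (1 + eps) ^+ j by rewrite exprn_ege1// lerDl ltW.
  by rewrite lerD// ler_peMr// ltW.
have h1 : (k%:R * eps) ^+ p.+1 <= (1 + eps) ^+ (k * p.+1).
  rewrite exprM; apply: lerXn2r; rewrite ?nnegrE ?bern//.
    by rewrite mulr_ge0// ltW.
  by rewrite exprn_ge0// addr_ge0// ltW.
apply: lt_le_trans h1; rewrite exprMn (@le_lt_trans _ _ (k%:R ^+ p * (q * eps ^+ p.+1)))//.
  have lexp a b e : (a <= b)%N -> (a ^ e <= b ^ e)%N.
    by move=> ab; elim: e => // e IH; rewrite !expnS leq_mul.
  rewrite /q divfK ?gt_eqF ?exprn_gt0// -natrX -natrM ler_nat -expnMn lexp//.
  by rewrite [(k * p.+2)%N]mulnS -add1n leq_add2r.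
by rewrite mulrA ltr_pM2r ?exprn_gt0// exprSr ltr_pM2l// exprn_gt0// ltr0n.
Qed.

(** The list may repeat group elements, hence [undup] below. Its length is polynomial in [l], which
    is all the growth information used. *)
Fixpoint box (l : nat) (A : seq gT) : seq gT :=
  if A is a :: A' then [seq (a ^+ k * x)%g | k <- iota 0 l, x <- box l A'] else [:: 1%g].

Lemma size_box l A : size (box l A) = (l ^ size A)%N.
Proof. by elim: A => //= a A IH; rewrite size_allpairs size_iota IH expnS. Qed.

Lemma mem_box l a A x :
  reflect (exists k y, [/\ (k < l)%N, y \in box l A & x = a ^+ k * y]%g)
    (x \in box l (a :: A)).
Proof.
apply: (iffP allpairsP) => [[[k y] /= [kl yA ->]]|[k [y [kl yA ->]]]].
  by exists k, y; split => //; move: kl; rewrite mem_iota.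
by exists (k, y); split => //=; rewrite mem_iota.
Qed.

Lemma box_sub l A : {subset box l A <= box l.+1 A}.
Proof.
elim: A => [//|a A IH] x /mem_box[k [y [kl yA ->]]].
by apply/mem_box; exists k, y; split => //; [exact: ltnW | exact: IH].
Qed.

Lemma box1 l A : 1%g \in box l.+1 A.
Proof.
elim: A => [|a A IH]; first by rewrite inE.
by apply/mem_box; exists 0%N, 1%g; split => //; rewrite mul1g.
Qed.

Context (L : set gT).
Hypothesis Lsub : subgroup L.
Hypothesis Lab : forall a b, L a -> L b -> (a * b = b * a)%g.

Lemma subgroupX a k : L a -> L (a ^+ k)%g.
Proof.
case: Lsub => L1 LM _ La; elim: k => [|k IH]; first by rewrite expg0.
by rewrite expgS; exact: LM.
Qed.

Lemma box_in l A : (forall a, a \in A -> L a) -> forall x, x \in box l A -> L x.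
Proof.
case: (Lsub) => L1 LM _; elim: A => [|a A IH] AL x; first by rewrite inE => /eqP ->.
move=> /mem_box[k [y [_ yA ->]]]; apply: LM.
  by apply: subgroupX; apply: AL; rewrite inE eqxx.
by apply: IH yA => b bA; apply: AL; rewrite inE bA orbT.
Qed.

Lemma box_mul l A a x : (forall a, a \in A -> L a) -> a \in A ->
  x \in box l A -> (x * a)%g \in box l.+1 A.
Proof.
elim: A x => [//|b A IH] x AL; rewrite inE => aA /mem_box[k [y [kl yA ->]]].
have AL' c : c \in A -> L c by move=> cA; apply: AL; rewrite inE cA orbT.
have yL : L y by exact: box_in yA.
apply/mem_box; have [ab|ab] := eqVneq a b.
  exists k.+1, y; split => //; first exact: box_sub.
  rewrite ab -mulgA (Lab yL); last by apply: AL; rewrite inE eqxx.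
  by rewrite mulgA -expgSr.
exists k, (y * a)%g; split; [exact: ltnW | | by rewrite mulgA].
by apply: IH => //; move: aA; rewrite (negPf ab).
Qed.

(* Boxes grow polynomially, so at some scale they grow by a factor of at most
   [1 + eps]. *)
Lemma folner (A : seq gT) (eps : R) : (forall a, a \in A -> L a) -> 0 < eps ->
  exists F : seq gT, [/\ uniq F, (0 < size F)%N, forall x, x \in F -> L x &
    forall a, a \in A ->
      (1 - eps) * (size F)%:R <= (count (fun y => (y * a)%g \in F) F)%:R].
Proof.
move=> AL e0; pose s l := size (undup (box l.+1 A)).
have [l sl] : exists l, (s l.+1)%:R <= (1 + eps) * (s l)%:R.
  apply: contrapT => H.
  have gr l : (1 + eps) ^+ l <= (s l)%:R.
    elim: l => [|l IH].
      rewrite expr0 (ler_nat _ 1) /s -has_predT; apply/hasP; exists 1%g => //.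
      by rewrite mem_undup box1.
    rewrite exprS (le_trans (_ : _ <= (1 + eps) * (s l)%:R))//.
      by rewrite ler_pM2l// ltr_wpDl.
    by rewrite leNgt; apply/negP => /ltW h; apply: H; exists l.
  have [l hl] := exp_gt_poly (size A) e0.
  have := gr l; rewrite leNgt => /negP; apply; apply: le_lt_trans hl.
  by rewrite ler_nat -size_box /s size_undup.
pose F := undup (box l.+1 A); exists F; split.
- exact: undup_uniq.
- by rewrite -has_predT; apply/hasP; exists 1%g => //; rewrite mem_undup box1.
- by move=> x; rewrite mem_undup; exact: box_in.
(* [G] collects the points that leave [F] under [a]. Their images are disjoint from [F] and lie in
   the next box, so the growth bound leaves at most a fraction [eps] of [F]. *)
move=> a aA; pose G := [seq y <- F | (y * a)%g \notin F].
have FG : (size F + size G <= s l.+1)%N.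
  rewrite -(size_map (fun y => y * a)%g G) -size_cat uniq_leq_size//.
    rewrite cat_uniq undup_uniq /= map_inj_uniq ?filter_uniq ?undup_uniq ?andbT//.
      by apply/hasPn => _ /mapP[y + ->]; rewrite mem_filter => /andP[].
    exact: mulIg.
  move=> x; rewrite mem_cat mem_undup => /orP[|/mapP[y + ->]].
    by rewrite mem_undup; exact: box_sub.
  rewrite mem_filter => /andP[_]; rewrite mem_undup => ?.
  exact: box_mul.
have := count_predC (fun y => (y * a)%g \in F) F.
rewrite -[X in (_ + X)%N]size_filter -/G => cE.
have {}FG : (size F)%:R + (size G)%:R <= (1 + eps) * (size F)%:R :> R.
  by apply: le_trans sl; rewrite -natrD ler_nat.
have -> : (count (fun y => (y * a)%g \in F) F)%:R = (size F)%:R - (size G)%:R :> R.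
  by rewrite -cE natrD addrK.
lra.
Qed.

End Folner.

(** * Nonnegative forms on fields over an abelian group *)

Lemma sum_le_const (R : realType) (I : eqType) (r : seq I) (F : I -> R) c :
  (forall i, i \in r -> F i <= c) -> \sum_(i <- r) F i <= (size r)%:R * c.
Proof.
elim: r => [|i r IH] H; first by rewrite big_nil mul0r.
rewrite big_cons /= -natr1 mulrDl mul1r addrC lerD ?H ?inE ?eqxx//.
by apply: IH => j jr; apply: H; rewrite inE jr orbT.
Qed.

(** Axioms for averaging periodic functions on an abelian lattice: [L] is the lattice, [M] the set
    of admissible periods, [P K] a period subgroup, [m K] the mean over that period. The positive
    density of [P K] and its avoidance of any finite set of nontrivial elements make periodized test
    fields possible. *)
Record mean_system (R : realType) (gT : groupType) (L : set gT) (M : set nat)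
    (P : nat -> set gT) (m : nat -> (gT -> R) -> R) : Prop := MeanSystem {
  mean_subgroup : subgroup L ;
  mean_abelian : forall a b, L a -> L b -> (a * b = b * a)%g ;
  mean_periods : forall K, M K -> subgroup (P K) /\ P K `<=` L ;
  mean_linear : forall K c F F',
    m K (fun t => c * F t + F' t) = c * m K F + m K F' ;
  mean_ge0 : forall K F, M K -> (forall t, L t -> 0 <= F t) -> 0 <= m K F ;
  mean_shift : forall K F a, M K -> L a ->
    (forall t k, L t -> P K k -> F (t * k)%g = F t) ->
    m K (fun t => F (t * a)%g) = m K F ;
  mean_cell : forall K, M K -> 0 < m K (fun t => (`[< P K t >])%:R) ;
  mean_separated : forall s : seq gT,
    exists2 K, M K & forall a, a \in s -> P K a -> a = 1%g }.

Section AbelianForms.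
Context {R : realType} {gT : groupType} {L : set gT} {M : set nat}.
Context {P : nat -> set gT} {m : nat -> (gT -> R) -> R} (ms : mean_system L M P m).
Context {n : nat} (rho : gT -> 'M[R]_n).
Hypothesis rhoM : forall a b, L a -> L b -> rho (a * b)%g = rho a *m rho b.
Hypothesis rhoO : forall a, L a -> rho a *m (rho a)^T = 1%:M.

Let L1 : L 1%g. Proof. by case: (mean_subgroup ms). Qed.
Let LM a b : L a -> L b -> L (a * b)%g.
Proof. by case: (mean_subgroup ms) => _ h _; exact: h. Qed.
Let LV a : L a -> L a^-1%g.
Proof. by case: (mean_subgroup ms) => _ _ h; exact: h. Qed.
Let LC a b : L a -> L b -> (a * b = b * a)%g.
Proof. exact: (mean_abelian ms). Qed.

Let mean_lin := mean_linear ms.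

Let rhoO' a : L a -> (rho a)^T *m rho a = 1%:M.
Proof. by move=> La; apply: mulmx1C; exact: rhoO. Qed.

Let rhoC a b : L a -> L b -> rho a *m rho b = rho b *m rho a.
Proof. by move=> La Lb; rewrite -!rhoM// LC. Qed.

Let rhoTC a b : L a -> L b -> (rho a)^T *m rho b = rho b *m (rho a)^T.
Proof.
move=> La Lb; rewrite -[LHS]mulmx1 -(rhoO La) mulmxA -(mulmxA _ _ (rho a)).
by rewrite -(rhoC La Lb) mulmxA rhoO'// mul1mx.
Qed.

(** Positivity looks at [L] only, so applying it to both differences shows that [m K] ignores values
    off the lattice. *)
Lemma mean_ext K F F' : M K -> (forall t, L t -> F t = F' t) -> m K F = m K F'.
Proof.
move=> MK FF'; apply/eqP; rewrite -subr_eq0; apply/eqP.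
have -> : m K F - m K F' = m K (fun t => -1 * F' t + F t).
  by rewrite mean_lin mulN1r addrC.
apply/eqP; rewrite eq_le; apply/andP; split; last first.
  by apply: (mean_ge0 ms) => // t Lt; rewrite FF'// mulN1r addNr.
rewrite -oppr_ge0.
have -> : - m K (fun t => -1 * F' t + F t) = m K (fun t => -1 * F t + F' t).
  by rewrite !mean_lin; lra.
by apply: (mean_ge0 ms) => // t Lt; rewrite FF'// mulN1r addNr.
Qed.

Lemma mean_zero K : m K (fun=> 0) = 0.
Proof.
have := mean_lin K 1 (fun=> 0) (fun=> 0).
by rewrite mul1r addr0 mul1r => /eqP; rewrite -subr_eq subrr eq_sym => /eqP.
Qed.

Lemma meanD K F F' : m K (fun t => F t + F' t) = m K F + m K F'.
Proof.
rewrite -[m K F]mul1r -mean_lin; congr (m K _).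
by apply/funext => t; rewrite mul1r.
Qed.

Lemma meanZ K c F : m K (fun t => c * F t) = c * m K F.
Proof.
rewrite -[RHS]addr0 -[X in _ = _ + X](mean_zero K) -mean_lin; congr (m K _).
by apply/funext => t; rewrite addr0.
Qed.

Lemma meanN K F : m K (fun t => - F t) = - m K F.
Proof.
rewrite -mulN1r -meanZ; congr (m K _); apply/funext => t; by rewrite mulN1r.
Qed.

Lemma meanB K F F' : m K (fun t => F t - F' t) = m K F - m K F'.
Proof. by rewrite meanD meanN. Qed.

Lemma mean_sum (I : Type) (r : seq I) K (F : I -> gT -> R) :
  m K (fun t => \sum_(i <- r) F i t) = \sum_(i <- r) m K (F i).
Proof.
elim: r => [|i r IH].
  rewrite big_nil -[RHS](mean_zero K); congr (m K _).
  by apply/funext => t; rewrite big_nil.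
rewrite big_cons -IH -meanD; congr (m K _).
by apply/funext => t; rewrite big_cons.
Qed.

Lemma mean_le K F F' : M K -> (forall t, L t -> F t <= F' t) -> m K F <= m K F'.
Proof.
move=> MK FF'; rewrite -subr_ge0 -meanB; apply: (mean_ge0 ms) => // t Lt.
by rewrite subr_ge0 FF'.
Qed.

Implicit Types (s f : gT -> 'rV[R]_n) (A : seq gT).

Definition pfield K s := forall t k, L t -> P K k -> s (t * k)%g = s t.

(** With [rho] as parallel transport this is the squared covariant difference along [A], and [Dl]
    below is the corresponding Dirichlet energy. *)
Definition defect A s t : R := \sum_(a <- A) nsq (s (t * a)%g - s t *m rho a).

Definition Dl K A s : R := m K (defect A s).
Definition N2 K s : R := m K (fun t => nsq (s t)).

Lemma Dl_ge0 K A s : M K -> 0 <= Dl K A s.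
Proof.
move=> MK; apply: (mean_ge0 ms) => // t _; apply: sumr_ge0 => a _; exact: nsq_ge0.
Qed.

Lemma N2_ge0 K s : M K -> 0 <= N2 K s.
Proof. by move=> MK; apply: (mean_ge0 ms) => // t _; exact: nsq_ge0. Qed.

Lemma Dl_cat K A B s : Dl K (A ++ B) s = Dl K A s + Dl K B s.
Proof.
by rewrite /Dl -meanD; congr (m K _); apply/funext => t; rewrite /defect big_cat.
Qed.

Lemma Dl_sum K A s :
  Dl K A s = \sum_(a <- A) m K (fun t => nsq (s (t * a)%g - s t *m rho a)).
Proof. exact: mean_sum. Qed.

Context {p : nat} (a_ : 'I_p -> gT).
Hypothesis aL : forall i, L (a_ i).
Implicit Types Y : 'I_p -> 'M[R]_n.

(** The factor [(rho (a_ i))^T] transports the value at [t * a_ i] back to [t], so that rotating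
    both fields acts on the coefficients by simultaneous conjugation, see [form_twist]. *)
Definition form K Y s f : R :=
  m K (fun t => \sum_i bil (Y i) (s (t * a_ i)%g *m (rho (a_ i))^T) (f t)).

Lemma form_sum K Y s f :
  form K Y s f = \sum_i m K (fun t => bil (Y i) (s (t * a_ i)%g *m (rho (a_ i))^T) (f t)).
Proof. exact: mean_sum. Qed.

Lemma formDl K Y s s' f : form K Y (s \+ s') f = form K Y s f + form K Y s' f.
Proof.
rewrite -meanD; congr (m K _); apply/funext => t; rewrite -big_split.
by apply: eq_bigr => i _; rewrite /= mulmxDl bilDl.
Qed.

Lemma formDr K Y s f f' : form K Y s (f \+ f') = form K Y s f + form K Y s f'.
Proof.
rewrite -meanD; congr (m K _); apply/funext => t; rewrite -big_split.
by apply: eq_bigr => i _; rewrite /= bilDr.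
Qed.

Lemma formZl K Y c s f : form K Y (fun t => c *: s t) f = c * form K Y s f.
Proof.
rewrite -meanZ; congr (m K _); apply/funext => t; rewrite mulr_sumr.
by apply: eq_bigr => i _; rewrite /= -scalemxAl bilZl.
Qed.

Lemma form_lin K c Y Y' s f :
  form K (c *: Y + Y') s f = c * form K Y s f + form K Y' s f.
Proof.
rewrite -mean_lin; congr (m K _); apply/funext => t.
rewrite mulr_sumr -big_split; apply: eq_bigr => i _ /=.
exact: bilDm.
Qed.

Lemma form0 K s f : form K 0 s f = 0.
Proof.
rewrite -[RHS](mean_zero K); congr (m K _); apply/funext => t.
by apply: big1 => i _; rewrite /bil mulmx0 mul0mx mxE.
Qed.

Lemma shift_mean K F a : M K -> L a ->
    (forall t k, L t -> P K k -> F (t * k)%g = F t) ->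
  m K (fun t => F (t * a)%g) = m K F.
Proof. exact: (mean_shift ms). Qed.

Lemma pfield_shift K s a : M K -> L a -> pfield K s -> pfield K (fun t => s (t * a)%g).
Proof.
move=> MK La sK t k Lt Pk; have [_ PL] := mean_periods ms MK.
have -> : (t * k * a = t * a * k)%g by rewrite -mulgA (LC (PL _ Pk) La) mulgA.
by rewrite sK//; exact: LM.
Qed.

Lemma form_shift K Y s f a : M K -> L a -> pfield K s -> pfield K f ->
  form K Y (fun t => s (t * a)%g) (fun t => f (t * a)%g) = form K Y s f.
Proof.
move=> MK La sK fK.
rewrite -[RHS](shift_mean (F := fun t =>
  \sum_i bil (Y i) (s (t * a_ i)%g *m (rho (a_ i))^T) (f t)) MK La).
  apply: mean_ext => // t Lt; apply: eq_bigr => i _.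
  by rewrite -!mulgA (LC La (aL i)).
move=> t k Lt Pk; apply: eq_bigr => i _; rewrite fK//.
by rewrite (pfield_shift MK (aL i) sK).
Qed.

(* Fields [s t = w *m rho t], and their translates of nearby orientation, are
   the fields of zero defect; a kernel form annihilates them. *)
Definition kernel_form Y := exists C A, [/\ 0 <= C, forall a, a \in A -> L a &
  forall K s f, M K -> pfield K s -> pfield K f ->
    `|form K Y s f| <= C * (Dl K A s + N2 K f) /\
    `|form K Y f s| <= C * (Dl K A s + N2 K f)].

(** Forms that already satisfy the bound aimed at; the argument works modulo these. *)
Definition small_form Y := exists C A, [/\ 0 <= C, forall a, a \in A -> L a &
  forall K s, M K -> pfield K s -> `|form K Y s s| <= C * Dl K A s].

Lemma cat_in A B : (forall a, a \in A -> L a) -> (forall a, a \in B -> L a) ->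
  forall a, a \in A ++ B -> L a.
Proof. by move=> hA hB a; rewrite mem_cat => /orP[/hA|/hB]. Qed.

Lemma kernel_form_lin c Y Y' : kernel_form Y -> kernel_form Y' -> kernel_form (c *: Y + Y').
Proof.
move=> [C [A [C0 AL H]]] [C' [A' [C'0 AL' H']]].
exists (`|c| * C + C'), (A ++ A'); split.
- by rewrite addr_ge0// mulr_ge0.
- exact: cat_in.
move=> K s f MK sK fK; rewrite !form_lin Dl_cat.
have [h1 h2] := H K s f MK sK fK; have [h3 h4] := H' K s f MK sK fK.
have d1 := Dl_ge0 A s MK; have d2 := Dl_ge0 A' s MK; have n2 := N2_ge0 f MK.
have key x y : `|x| <= C * (Dl K A s + N2 K f) -> `|y| <= C' * (Dl K A' s + N2 K f) ->
    `|c * x + y| <= (`|c| * C + C') * (Dl K A s + Dl K A' s + N2 K f).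
  move=> hx hy; rewrite (le_trans (ler_normD _ _))// mulrDl lerD//.
    rewrite normrM -mulrA ler_wpM2l// (le_trans hx)// ler_wpM2l//.
    by rewrite lerD2r lerDl.
  by rewrite (le_trans hy)// ler_wpM2l// lerD2r lerDr.
by split; exact: key.
Qed.

Lemma small_form_lin c Y Y' : small_form Y -> small_form Y' -> small_form (c *: Y + Y').
Proof.
move=> [C [A [C0 AL H]]] [C' [A' [C'0 AL' H']]].
exists (`|c| * C + C'), (A ++ A'); split.
- by rewrite addr_ge0// mulr_ge0.
- exact: cat_in.
move=> K s MK sK; rewrite form_lin Dl_cat.
have d1 := Dl_ge0 A s MK; have d2 := Dl_ge0 A' s MK.
rewrite (le_trans (ler_normD _ _))// mulrDl lerD//.
  rewrite normrM -mulrA ler_wpM2l// (le_trans (H _ _ MK sK))// ler_wpM2l//.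
  by rewrite lerDl.
by rewrite (le_trans (H' _ _ MK sK))// ler_wpM2l// lerDr.
Qed.

Lemma kernel_form0 : kernel_form 0.
Proof.
exists 0, [::]; split => // K s f MK _ _.
by rewrite !form0 normr0 mul0r.
Qed.

Lemma small_form0 : small_form 0.
Proof.
exists 0, [::]; split => // K s MK _.
by rewrite form0 normr0 mul0r.
Qed.

Definition twist b Y : 'I_p -> 'M[R]_n := fun i => rho b *m Y i *m (rho b)^T.

Lemma form_twist K b Y s f : L b ->
  form K (twist b Y) s f = form K Y (fun t => s t *m rho b) (fun t => f t *m rho b).
Proof.
move=> Lb; congr (m K _); apply/funext => t; apply: eq_bigr => i _.
by rewrite -bilM -!mulmxA rhoTC.
Qed.

Lemma Dl_rot K A b s : M K -> L b -> (forall a, a \in A -> L a) ->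
  Dl K A (fun t => s t *m rho b) = Dl K A s.
Proof.
move=> MK Lb AL; apply: mean_ext => // t Lt; rewrite /defect !big_seq.
apply: eq_bigr => a /AL La.
by rewrite -mulmxA (rhoC Lb La) mulmxA -mulmxBl nsq_orthr// rhoO.
Qed.

Lemma N2_rot K b s : L b -> N2 K (fun t => s t *m rho b) = N2 K s.
Proof.
move=> Lb; congr (m K _); apply/funext => t; by rewrite nsq_orthr// rhoO.
Qed.

Lemma pfield_rot K b s : pfield K s -> pfield K (fun t => s t *m rho b).
Proof. by move=> sK t k Lt Pk; rewrite sK. Qed.

Lemma kernel_form_twist b Y : L b -> kernel_form Y -> kernel_form (twist b Y).
Proof.
move=> Lb [C [A [C0 AL H]]]; exists C, A; split => // K s f MK sK fK.
have := H K _ _ MK (pfield_rot b sK) (pfield_rot b fK).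
by rewrite !form_twist// Dl_rot// N2_rot.
Qed.

Lemma N2_shift K s a : M K -> L a -> pfield K s -> N2 K (fun t => s (t * a)%g) = N2 K s.
Proof.
move=> MK La sK; rewrite /N2 (shift_mean (F := fun t => nsq (s t)))//.
by move=> t k Lt Pk; rewrite sK.
Qed.

Lemma Dl_le_N2 K A s : M K -> (forall a, a \in A -> L a) -> pfield K s ->
  Dl K A s <= (4 * size A)%:R * N2 K s.
Proof.
move=> MK AL sK; rewrite Dl_sum mulnC natrM -mulrA.
apply: sum_le_const => a aA; have La := AL a aA.
rewrite (_ : 4 * N2 K s = 2 * N2 K (fun t => s (t * a)%g) + 2 * N2 K s); last first.
  by rewrite N2_shift//; lra.
rewrite -!meanZ -meanD; apply: mean_le => // t Lt.
by rewrite (le_trans (nsqB_le _ _))// (nsq_orthr _ (rhoO La)).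
Qed.

(* Translating a field by [b] differs from rotating it by [rho b] by its defect. *)
Lemma small_twist b Y : L b -> kernel_form Y -> small_form (twist b Y - Y).
Proof.
move=> Lb [C [A [C0 AL H]]].
exists (C * (4 + (4 * size A)%:R)), (A ++ [:: b]); split.
- by rewrite mulr_ge0// addr_ge0.
- by apply: cat_in => // a; rewrite inE => /eqP ->.
move=> K s MK sK.
pose r t := s t *m rho b; pose d t := s (t * b)%g - s t *m rho b.
have rK : pfield K r by exact: pfield_rot.
have dK : pfield K d.
  by move=> t k Lt Pk; rewrite /d (sK t k)//; congr (_ - _); exact: (pfield_shift MK Lb sK).
(* Shifting both arguments by [b] leaves the form unchanged, and the shifted field is [r \+ d]. The
   leading terms [form K Y r r] cancel, and every remaining term contains [d], whose mean square is
   the defect along [b]. *)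
have -> : form K (twist b Y - Y) s s = - (form K Y r d + form K Y d r + form K Y d d).
  rewrite -scaleN1r addrC form_lin mulN1r form_twist// -/r.
  rewrite -[form K Y s s](form_shift _ MK Lb sK sK).
  have -> : (fun t => s (t * b)%g) = r \+ d.
    by apply/funext => t; rewrite /d /r /= addrC subrK.
  by rewrite formDl !formDr; lra.
have N2d : N2 K d = Dl K [:: b] s.
  by congr (m K _); apply/funext => t; rewrite /defect big_seq1.
have [h1 h2] := H K r d MK rK dK; have [h3 _] := H K d d MK dK dK.
rewrite normrN; have h4 := Dl_le_N2 MK AL dK.
have Dr : Dl K A r = Dl K A s by exact: Dl_rot.
rewrite Dl_cat -N2d; rewrite Dr in h1 h2.
have d1 := Dl_ge0 A s MK; have n2 := N2_ge0 d MK.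
have h5 : `|form K Y r d + form K Y d r + form K Y d d| <=
   C * (Dl K A s + N2 K d) + C * (Dl K A s + N2 K d) + C * (Dl K A d + N2 K d).
  by rewrite (le_trans (ler_normD _ _))// lerD// (le_trans (ler_normD _ _))// lerD.
apply: (le_trans h5); rewrite -!mulrDr -mulrA ler_wpM2l//.
set q := (4 * size A)%:R in h4 *; have q0 : 0 <= q by [].
move: (Dl K A s) (Dl K A d) (N2 K d) h4 d1 n2 => x y z; nra.
Qed.

(** [Y'] is the component of [Y] orthogonal to the coefficients that are both kernel and small. A
    twist moves [Y'] by an element of that subspace, hence orthogonally to [Y']; being an isometry,
    it cannot move [Y'] at all. No averaging over the twists is required. *)
Lemma invariant_part Y : kernel_form Y -> exists Y',
  [/\ kernel_form Y', small_form (Y - Y') & forall b, L b -> twist b Y' = Y'].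
Proof.
move=> KY.
pose c (j : 'I_p * 'I_n * 'I_n) (Z : 'I_p -> 'M[R]_n) : R := Z j.1.1 j.1.2 j.2.
pose X : set ('I_p -> 'M[R]_n) := [set Z | kernel_form Z /\ small_form Z].
have [|||Q [KQ SQ] Qorth] := orthogonal_projection (c := c) (X := X) _ _ _ Y.
- by move=> j a x y; rewrite /c !mxE.
- by split; [exact: kernel_form0 | exact: small_form0].
- by move=> a x y [kx sx] [ky sy]; split; [exact: kernel_form_lin | exact: small_form_lin].
exists (Y - Q); split.
- by rewrite addrC -scaleN1r; exact: kernel_form_lin.
- by rewrite opprB addrCA subrr addr0.
move=> b Lb; set Z := Y - Q.
have KZ : kernel_form Z by rewrite /Z addrC -scaleN1r; exact: kernel_form_lin.
have := Qorth (twist b Z - Z) (conj _ (small_twist Lb KZ)).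
rewrite -/Z => H.
have {}H : \sum_j c j Z * c j (twist b Z - Z) = 0.
  apply: H; rewrite addrC -scaleN1r.
  by apply: kernel_form_lin => //; exact: kernel_form_twist.
have sumE (W : 'I_p -> 'M[R]_n) : \sum_j c j W ^+ 2 = \sum_i nsq (W i).
  rewrite (eq_bigr (fun j => (W j.1.1 j.1.2 j.2) ^+ 2))//.
  rewrite -(pair_bigA _ (fun (ij : 'I_p * 'I_n) k => W ij.1 ij.2 k ^+ 2)).
  by rewrite -(pair_bigA _ (fun i j => \sum_k W i j k ^+ 2)).
have : \sum_i nsq (twist b Z i - Z i) = 0.
  rewrite -(sumE (fun i => twist b Z i - Z i)).
  have : \sum_j c j (twist b Z) ^+ 2 = \sum_j c j Z ^+ 2.
    rewrite !sumE; apply: eq_bigr => i _; rewrite /twist nsq_orthr.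
      by rewrite nsq_orthl// rhoO'.
    by rewrite trmxK rhoO'.
  move=> E; transitivity (\sum_j c j (twist b Z) ^+ 2 - \sum_j c j Z ^+ 2
      - 2 * \sum_j c j Z * c j (twist b Z - Z)).
    rewrite mulr_sumr -!sumrB; apply: eq_bigr => j _.
    by rewrite /c !mxE; ring.
  by rewrite E H mulr0 subr0 subrr.
move=> /psumr_eq0P H0; apply/funext => i; apply/eqP; rewrite -subr_eq0; apply/eqP.
by apply: nsq_eq0; apply: H0 => // j _; exact: nsq_ge0.
Qed.

Definition periodize K (F : seq gT) f t : 'rV[R]_n :=
  \sum_(y <- F) (`[< P K (y^-1 * t)%g >])%:R *: f y.

Definition restr (F : seq gT) f y : 'rV[R]_n := if y \in F then f y else 0.

Definition cell K : R := m K (fun t => (`[< P K t >])%:R).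

Lemma mem_period K x k : M K -> P K k -> P K (x * k)%g <-> P K x.
Proof.
move=> MK Pk; have [[_ PM PV] _] := mean_periods ms MK; split => [h|h]; last exact: PM.
by rewrite -(mulgK k x); apply: PM => //; exact: PV.
Qed.

Lemma periodize_pfield K F f : M K -> pfield K (periodize K F f).
Proof.
move=> MK t k Lt Pk; apply: eq_bigr => y _; congr (_%:R *: _); congr (nat_of_bool _).
by apply: asbool_equiv_eq; rewrite mulgA; exact: mem_period.
Qed.

Lemma mean_translate_cell K y : M K -> L y ->
  m K (fun t => (`[< P K (y^-1 * t)%g >])%:R) = cell K.
Proof.
move=> MK Ly; rewrite /cell -(shift_mean (F := fun t => (`[< P K t >])%:R) MK (LV Ly)); last first.
  move=> t k Lt Pk; congr (_%:R); congr (nat_of_bool _).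
  by apply: asbool_equiv_eq; exact: mem_period.
by apply: mean_ext => // t Lt; rewrite (LC _ (LV Ly)).
Qed.

(** If [t * a] is a period translate of [x] and [t] is one of [y], then [x^-1 * y * a] is a period,
    and separation forces [x = y * a]. Copies of the cut-off field therefore do not interact, and
    the mean is the finite sum for one copy times the density [cell K] of copies. *)
Lemma mean_periodize K F f f' (B : 'M[R]_n) a : M K -> uniq F ->
  (forall x, x \in F -> L x) -> L a ->
  (forall x y, x \in F -> y \in F -> P K (x^-1 * y * a)%g -> (x^-1 * y * a)%g = 1%g) ->
  m K (fun t => bil B (periodize K F f (t * a)%g) (periodize K F f' t)) =
  cell K * \sum_(y <- F) bil B (restr F f (y * a)%g) (f' y).
Proof.
move=> MK uF FL La sep; have [[P1 PM PV] PL] := mean_periods ms MK.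
transitivity (m K (fun t => \sum_(y <- F)
    bil B (restr F f (y * a)%g) (f' y) * (`[< P K (y^-1 * t)%g >])%:R)).
  apply: mean_ext => // t Lt; rewrite /periodize.
  rewrite [LHS](_ : _ = \sum_(y <- F) \sum_(x <- F)
     ((`[< P K (x^-1 * (t * a))%g >])%:R * (`[< P K (y^-1 * t)%g >])%:R) * bil B (f x) (f' y));
       last first.
    have suml (r : seq gT) (c : gT -> R) (g : gT -> 'rV[R]_n) z :
        bil B (\sum_(x <- r) c x *: g x) z = \sum_(x <- r) c x * bil B (g x) z.
      elim: r => [|x r IH]; first by rewrite !big_nil bil0l.
      by rewrite !big_cons bilDl bilZl IH.
    have sumr (r : seq gT) (c : gT -> R) (g : gT -> 'rV[R]_n) z :
        bil B z (\sum_(x <- r) c x *: g x) = \sum_(x <- r) c x * bil B z (g x).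
      elim: r => [|x r IH]; first by rewrite !big_nil bil0r.
      by rewrite !big_cons bilDr bilZr IH.
    rewrite sumr; apply: eq_bigr => y _; rewrite suml mulr_sumr.
    by apply: eq_bigr => x _; rewrite mulrA (mulrC (`[< P K (y^-1 * t)%g >])%:R).
  rewrite !big_seq; apply: eq_bigr => y yF; have Ly := FL y yF.
  have key x : x \in F -> (`[< P K (x^-1 * (t * a))%g >])%:R * (`[< P K (y^-1 * t)%g >])%:R
      = (x == y * a)%g%:R * (`[< P K (y^-1 * t)%g >])%:R :> R.
    move=> xF; have Lx := FL x xF; case: (asboolP (P K (y^-1 * t)%g)) => [yt|_];
      last by rewrite !mulr0.
    rewrite !mulr1; congr (_%:R); congr (nat_of_bool _); apply/asboolP/eqP.
      move=> xt; have : P K (x^-1 * (t * a) * (y^-1 * t)^-1)%g by apply: PM => //; exact: PV.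
      have -> : (x^-1 * (t * a) * (y^-1 * t)^-1 = x^-1 * y * a)%g.
        rewrite invgM invgK -!mulgA; congr (_ * _)%g.
        by rewrite (LC La (LM (LV Lt) Ly)) !mulgA mulgV mul1g.
      move=> /(sep x y xF yF) e.
      have: (x * (x^-1 * y * a) = x * 1)%g by rewrite e.
      by rewrite mulg1 !mulgA mulgV mul1g => ->.
    move=> ->; rewrite invgM -mulgA (LC (LV La)) ?mulgA ?mulgK//.
    by rewrite -mulgA; apply: LM; [exact: LV | exact: LM].
  rewrite big_seq_cond (eq_bigr (fun x => ((x == y * a)%g%:R * (`[< P K (y^-1 * t)%g >])%:R) *
      bil B (f x) (f' y))); last first.
    by move=> x /andP[xF _]; rewrite key.
  rewrite -big_seq_cond /restr; case: ifPn => [yaF|yaF].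
    rewrite (bigD1_seq (y * a)%g)//= eqxx mul1r mulrC big1 ?addr0// => x /negPf ->.
    by rewrite !mul0r.
  rewrite bil0l mul0r big_seq big1// => x xF; rewrite (_ : _ == _ = false) ?mul0r//.
  by apply: contraNF yaF => /eqP <-.
rewrite mean_sum mulr_sumr !big_seq; apply: eq_bigr => y yF.
by rewrite meanZ mean_translate_cell//; [exact: mulrC | exact: FL].
Qed.


Lemma bilMl (B : 'M[R]_n) (A : 'M[R]_n) x z : bil B (x *m A) z = bil (A *m B) x z.
Proof. by rewrite /bil !mulmxA. Qed.

Lemma bilMr (B : 'M[R]_n) (A : 'M[R]_n) x z : bil B x (z *m A) = bil (B *m A^T) x z.
Proof. by rewrite /bil trmx_mul !mulmxA. Qed.

Lemma bil_orth (B : 'M[R]_n) b x z : L b -> rho b *m B *m (rho b)^T = B ->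
  bil B (x *m rho b) (z *m rho b) = bil B x z.
Proof. by move=> Lb BB; rewrite bilM BB. Qed.

Lemma bil1_orth b x z : L b -> bil 1%:M (x *m rho b) (z *m rho b) = bil 1%:M x z.
Proof. by move=> Lb; apply: bil_orth => //; rewrite mulmx1 rhoO. Qed.

Definition shift_defect K a s := m K (fun t => nsq (s (t * a)%g - s t *m rho a)).

Lemma shift_defect_ge0 K a s : M K -> 0 <= shift_defect K a s.
Proof. by move=> MK; apply: (mean_ge0 ms) => // t _; exact: nsq_ge0. Qed.

Lemma shift_defect_le K A a s : M K -> a \in A -> shift_defect K a s <= Dl K A s.
Proof.
move=> MK; rewrite Dl_sum; elim: A => // b A IH; rewrite big_cons inE => /orP[/eqP <-|aA].
  by rewrite lerDl -Dl_sum; exact: Dl_ge0.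
by rewrite (le_trans (IH aA))// lerDr; exact: shift_defect_ge0.
Qed.

Lemma shift_defectE K a s : M K -> L a -> pfield K s ->
  shift_defect K a s =
  2 * N2 K s - 2 * m K (fun t => bil 1%:M (s (t * a)%g) (s t *m rho a)).
Proof.
move=> MK La sK; rewrite mulr_natl mulr2n -{1}(N2_shift MK La sK) -meanD -meanZ -meanB.
by apply: mean_ext => // t Lt; rewrite nsqB (nsq_orthr (s t) (rhoO La)).
Qed.

Definition overlap (F : seq gT) a : R := (count (fun y => (y * a)%g \in F) F)%:R.

(** Including [1%g] covers the mean square of a periodized field besides its correlations along
    [A]. *)
Definition separates K (F A : seq gT) := forall a x y, a \in 1%g :: A ->
  x \in F -> y \in F -> P K (x^-1 * y * a)%g -> (x^-1 * y * a)%g = 1%g.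

(** The Folner set comes first; the period is then taken sparse enough for the finitely many
    quotients that this set produces. *)
Lemma test_set (A : seq gT) eps : (forall a, a \in A -> L a) -> 0 < eps ->
  exists F K, [/\ M K, uniq F, (0 < size F)%N, forall x, x \in F -> L x &
    separates K F A /\ forall a, a \in A ->
    (1 - eps) * (size F)%:R <= overlap F a <= (size F)%:R].
Proof.
move=> AL e0; have [F [uF F0 FL Feps]] := folner (mean_subgroup ms) LC AL e0.
have [K MK sep] := mean_separated ms
  [seq (x * a)%g | x <- [seq (x^-1 * y)%g | x <- F, y <- F], a <- 1%g :: A].
exists F, K; split => //; split.
  move=> a x y aA xF yF; apply: sep; apply/allpairsP; exists ((x^-1 * y)%g, a).
  by split => //; apply/allpairsP; exists (x, y).
by move=> a aA; rewrite Feps//= ler_nat count_size.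
Qed.

(** * Means of periodized test fields *)

Section Test.
Context (F : seq gT) (K : nat) (A : seq gT) (f : gT -> 'rV[R]_n).
Hypotheses (MK : M K) (uF : uniq F) (FL : forall x, x \in F -> L x).
Hypotheses (AL : forall a, a \in A -> L a) (sep : separates K F A).

Let ext_sum (B : 'M[R]_n) (f' :
  gT -> 'rV[R]_n) a := \sum_(y <- F) bil B (restr F f (y * a)%g) (f' y).

Lemma N2_periodize : N2 K (periodize K F f) = cell K * \sum_(y <- F) nsq (f y).
Proof.
have -> : N2 K (periodize K F f) =
    m K (fun t => bil 1%:M (periodize K F f (t * 1)%g) (periodize K F f t)).
  by congr (m K _); apply/funext => t; rewrite mulg1 bil1.
rewrite mean_periodize//; last by move=> x y; apply: sep; rewrite inE eqxx.
congr (_ * _); rewrite !big_seq; apply: eq_bigr => y yF.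
by rewrite mulg1 /restr yF bil1.
Qed.

Lemma shift_defect_periodize a : a \in A ->
  shift_defect K a (periodize K F f) =
  cell K * (2 * \sum_(y <- F) nsq (f y) - 2 * ext_sum 1%:M (fun y => f y *m rho a) a).
Proof.
move=> aA; have La := AL aA; rewrite shift_defectE//; last exact: periodize_pfield.
rewrite N2_periodize.
have -> : m K (fun t => bil 1%:M (periodize K F f (t * a)%g) (periodize K F f t *m rho a)) =
    m K (fun t => bil (1%:M *m (rho a)^T) (periodize K F f (t * a)%g) (periodize K F f t)).
  by congr (m K _); apply/funext => t; rewrite bilMr.
rewrite mean_periodize//; last by move=> x y; apply: sep; rewrite inE aA orbT.
rewrite -(eq_bigr _ (fun y _ => bilMr _ _ _ _)) -/(ext_sum _ _ _).
by rewrite mulrBr; congr (_ - _); rewrite mulrCA.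
Qed.

Lemma form_periodize Y : (forall i, a_ i \in A) ->
  form K Y (periodize K F f) (periodize K F f) =
  cell K * \sum_i ext_sum ((rho (a_ i))^T *m Y i) f (a_ i).
Proof.
move=> aA; rewrite form_sum mulr_sumr; apply: eq_bigr => i _.
rewrite -mean_periodize//; last by move=> x y; apply: sep; rewrite inE aA orbT.
by congr (m K _); apply/funext => t; rewrite bilMl.
Qed.

Lemma ext_sum_const (B : 'M[R]_n) (f' : gT -> 'rV[R]_n) a c :
  (forall y, y \in F -> (y * a)%g \in F -> bil B (f (y * a)%g) (f' y) = c) ->
  ext_sum B f' a = overlap F a * c.
Proof.
move=> H; rewrite /ext_sum /overlap -sum1_count natr_sum mulr_suml [RHS]big_mkcond.
rewrite !big_seq; apply: eq_bigr => y yF; rewrite /restr.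
by case: ifPn => [yaF|_]; rewrite ?bil0l// H// mul1r.
Qed.

End Test.

Lemma rho_sq_cancel y a (x z : 'rV[R]_n) B : L y -> L a -> rho y *m B *m (rho y)^T = B ->
  bil ((rho a)^T *m B) (x *m rho (y * a)%g) (z *m rho y) = bil B x z.
Proof.
move=> Ly La BB; rewrite -bilMl -mulmxA rhoM// -mulmxA rhoO// mulmx1.
exact: bil_orth.
Qed.

(** The field [w *m rho t], cut off on a Folner set of accuracy [l ^- 2], has defect of order
    [l ^- 2] per point, while the form on it is nearly the sum in question per point. Testing the
    mixed bound on the pair [l *: s], [s] keeps its right side bounded per point but multiplies the
    left side by [l], so the sum must vanish. *)
Lemma kernel_form_diag Y : kernel_form Y -> (forall b, L b -> twist b Y = Y) ->
  forall w, \sum_i bil (Y i) w w = 0.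
Proof.
move=> [C [A0 [C0 AL0 H]]] inv w; apply/eqP; rewrite -normr_eq0; apply/negP => /negP T0.
pose A := A0 ++ [seq a_ i | i <- enum 'I_p].
have AL : forall a, a \in A -> L a.
  by apply: cat_in => // a /mapP[i _ ->].
have aA i : a_ i \in A by rewrite mem_cat map_f ?orbT// mem_enum.
set T := `|_| in T0; have {}T0 : 0 < T by rewrite lt_def T0 normr_ge0.
pose b i := bil (Y i) w w; pose Z := C * nsq w * (2 * (size A0)%:R + 1) + \sum_i `|b i|.
have Z0 : 0 <= Z.
  rewrite addr_ge0 ?sumr_ge0// mulr_ge0 ?addr_ge0// mulr_ge0//; exact: nsq_ge0.
(* In the end [Z] bounds [l * T], whereas this choice makes [l * T = Z + T]. *)
pose l := Z / T + 1; have l1 : 1 <= l by rewrite lerDr divr_ge0// ltW.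
have l0 : 0 < l by exact: lt_le_trans l1.
have e0 : 0 < l ^- 2 by rewrite invr_gt0 exprn_gt0.
have [F [K [MK uF F0 FL [sep ov]]]] := test_set AL e0.
pose f y := w *m rho y; pose s := periodize K F f.
pose X : R := (size F)%:R; have X0 : 0 < X by rewrite ltr0n.
have sK : pfield K s by exact: periodize_pfield.
have c0 : 0 < cell K by exact: (mean_cell ms).
have sumf : \sum_(y <- F) nsq (f y) = X * nsq w.
  rewrite /X -sum1_size natr_sum mulr_suml !big_seq; apply: eq_bigr => y yF.
  by rewrite nsq_orthr ?mul1r// rhoO//; exact: FL.
have N2s : N2 K s = cell K * (X * nsq w) by rewrite (N2_periodize f MK uF FL sep) sumf.
have Ds : Dl K A0 s <= (size A0)%:R * (cell K * (2 * l ^- 2 * X * nsq w)).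
  rewrite Dl_sum; apply: sum_le_const => a aA0.
  have aA' : a \in A by rewrite mem_cat aA0.
  rewrite -/(shift_defect K a s) (shift_defect_periodize f MK uF FL AL sep)// sumf.
  rewrite (ext_sum_const (c := nsq w)); last first.
    move=> y yF yaF; have Ly := FL y yF; have La := AL a aA'.
    by rewrite /f -mulmxA -rhoM// bil1_orth ?bil1//; exact: LM.
  rewrite ler_pM2l//; have /andP[ov1 _] := ov a aA'; have w0 := nsq_ge0 w.
  by move: (overlap F a) (nsq w) (l ^- 2) ov1 w0 => u v e; rewrite -/X; nra.
have Fs : form K Y s s = cell K * \sum_i overlap F (a_ i) * b i.
  rewrite (form_periodize f MK uF FL sep)//; congr (_ * _); apply: eq_bigr => i _.
  apply: ext_sum_const => y yF yaF; apply: rho_sq_cancel => //; first exact: FL.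
  by have /(congr1 (fun Z => Z i)) := inv _ (FL y yF).
have lsK : pfield K (fun t => l *: s t) by move=> t k Lt Pk; rewrite sK.
have [+ _] := H K _ _ MK lsK sK.
rewrite formZl Fs N2s.
have -> : Dl K A0 (fun t => l *: s t) = l ^+ 2 * Dl K A0 s.
  rewrite -meanZ; congr (m K _); apply/funext => t; rewrite mulr_sumr.
  by apply: eq_bigr => a _; rewrite -nsqZ scalerBr scalemxAl.
move=> main.
have sumb : T <= `|\sum_i overlap F (a_ i) * b i| / X + l ^- 2 * \sum_i `|b i|.
  have XT : X * T <= `|\sum_i overlap F (a_ i) * b i| + X * (l ^- 2 * \sum_i `|b i|).
    rewrite /T -[X in X * `|_|](gtr0_norm X0) -normrM.
    rewrite (_ : X * \sum_i bil (Y i) w w =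
      \sum_i overlap F (a_ i) * b i + \sum_i (X - overlap F (a_ i)) * b i).
      rewrite (le_trans (ler_normD _ _))// lerD2l (le_trans (ler_norm_sum _ _ _))//.
      rewrite !mulr_sumr ler_sum// => i _; rewrite normrM mulrA ler_wpM2r//.
      have /andP[h1 h2] := ov _ (aA i).
      by rewrite ger0_norm ?subr_ge0//; move: h1; rewrite -/X; lra.
    by rewrite mulr_sumr -big_split; apply: eq_bigr => i _; rewrite /= -mulrDl addrC subrK.
  by rewrite -(ler_pM2l X0) mulrDr mulrCA divff ?gt_eqF// mulr1.
have {main} : l * (`|\sum_i overlap F (a_ i) * b i| / X) <= C * nsq w * (2 * (size A0)%:R + 1).
  rewrite -(ler_pM2l (mulr_gt0 c0 X0)).
  rewrite (_ : cell K * X * _ = `|l * (cell K * \sum_i overlap F (a_ i) * b i)|); last first.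
    rewrite !normrM (gtr0_norm l0) (gtr0_norm c0); field; rewrite ?gt_eqF//.
  apply: (le_trans main).
  rewrite (_ : cell K * X * _ =
    C * (l ^+ 2 * ((size A0)%:R * (cell K * (2 * l ^- 2 * X * nsq w))) + cell K * (X * nsq w))).
    by rewrite ler_wpM2l// lerD2r ler_wpM2l// sqr_ge0.
  by field; rewrite ?gt_eqF//.
move=> main.
have h1 : l * T <= Z.
  have : l * T <= l * (`|\sum_i overlap F (a_ i) * b i| / X) + l * (l ^- 2 * \sum_i `|b i|).
    by rewrite -mulrDr ler_pM2l.
  move=> /le_trans; apply; rewrite /Z lerD// mulrA ler_piMl ?sumr_ge0//.
  by rewrite expr2 invfM mulrA divff ?gt_eqF// mul1r invf_le1.
by move: h1; rewrite /l mulrDl divfK ?gt_eqF// mul1r; lra.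
Qed.

Lemma ge0_limit (x y : R) : (forall eps, 0 < eps -> 0 <= x + eps * y) -> 0 <= x.
Proof.
move=> H; rewrite leNgt; apply/negP => x0.
have [y0|y0] := lerP y 0; first by have := H 1 ltr01; lra.
have := H (- x / (2 * y)); rewrite divr_gt0 ?oppr_gt0 ?mulr_gt0// => /(_ isT).
rewrite (_ : x + _ = x / 2); first by lra.
by field; rewrite ?gt_eqF//.
Qed.

(* The test fields are cut-offs of the reflection [rho t ^+ 2 *: s t^-1] of a given
   field about a point [p], and the inequality is averaged over [p]. *)
Lemma reflected_form_ge Y C A0 N s : 0 <= C -> (forall a, a \in A0 -> L a) ->
  (forall b, L b -> twist b Y = Y) ->
  (forall K f, M K -> pfield K f -> 0 <= form K Y f f + C * Dl K A0 f) ->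
  M N -> pfield N s ->
  0 <= \sum_i m N (fun t => bil (Y i) (s t *m rho (a_ i)) (s (t * a_ i)%g)) + C * Dl N A0 s.
Proof.
move=> C0 AL0 inv pos MN sN.
pose g i := m N (fun t => bil (Y i) (s t *m rho (a_ i)) (s (t * a_ i)%g)).
pose h a := m N (fun t => bil 1%:M (s (t * a)%g) (s t *m rho a)).
apply: (@ge0_limit _ (\sum_i `|g i| + C * ((size A0)%:R * (2 * N2 N s)))) => eps e0.
pose A := A0 ++ [seq a_ i | i <- enum 'I_p].
have AL : forall a, a \in A -> L a.
  by apply: cat_in => // a /mapP[i _ ->].
have aA i : a_ i \in A by rewrite mem_cat map_f ?orbT// mem_enum.
have [F [K [MK uF F0 FL [sep ov]]]] := test_set AL e0.
(* The power of [rho] is dictated by the demand that reflection preserves the fields of zero defect: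
   [s t = w *m rho t] gives [f q y = w *m rho y]. *)
pose f q y := s (q * y^-1)%g *m rho (y * y * q^-1)%g.
pose X : R := (size F)%:R; have X0 : 0 < X by rewrite ltr0n.
have c0 : 0 < cell K by exact: (mean_cell ms).
pose G q := \sum_i \sum_(y <- F) bil ((rho (a_ i))^T *m Y i) (restr F (f q) (y * a_ i)%g) (f q y)
  + C * \sum_(a <- A0) (2 * \sum_(y <- F) nsq (f q y)
      - 2 * \sum_(y <- F) bil 1%:M (restr F (f q) (y * a)%g) (f q y *m rho a)).
have G0 q : L q -> 0 <= G q.
  move=> Lq; have := pos K _ MK (periodize_pfield F (f q) MK).
  rewrite (form_periodize (f q) MK uF FL sep)// Dl_sum.
  rewrite (eq_big_seq (fun a => cell K * (2 * \sum_(y <- F) nsq (f q y)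
      - 2 * \sum_(y <- F) bil 1%:M (restr F (f q) (y * a)%g) (f q y *m rho a)))).
    by rewrite -mulr_sumr mulrCA -mulrDr pmulr_rge0.
  move=> a aA0; apply: (shift_defect_periodize (f q) MK uF FL AL sep).
  by rewrite mem_cat aA0.
have shiftF (H : gT -> R) y : L y -> (forall t k, L t -> P N k -> H (t * k)%g = H t) ->
    m N (fun q => H (q * y^-1)%g) = m N H.
  by move=> Ly HP; rewrite (shift_mean (F := H))//; exact: LV.
(* Averaged over the center [q], no term depends on [y] any longer; the set [F] survives only
   through its size and its overlaps with its translates. *)
have m1 y : y \in F -> m N (fun q => nsq (f q y)) = N2 N s.
  move=> yF; have Ly := FL y yF; rewrite /N2 -(shiftF (fun t => nsq (s t)) y)//.
    by apply: mean_ext => // q Lq; rewrite nsq_orthr// rhoO//; apply: LM; [exact: LM | exact: LV].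
  by move=> t k Lt Pk; rewrite sN.
have m2 y i : y \in F -> (y * a_ i)%g \in F ->
    m N (fun q => bil ((rho (a_ i))^T *m Y i) (f q (y * a_ i)%g) (f q y)) = g i.
  move=> yF yaF; have Ly := FL y yF; have Lya := FL _ yaF; have La := aL i.
  rewrite /g -(shiftF (fun t => bil (Y i) (s t *m rho (a_ i)) (s (t * a_ i)%g)) (y * a_ i)%g)//.
    apply: mean_ext => // q Lq; rewrite /f.
    have Lyq : L (y * y * q^-1)%g by apply: LM; [exact: LM | exact: LV].
    have -> : (y * a_ i * (y * a_ i) * q^-1 = a_ i * (y * y * q^-1 * a_ i))%g.
      by rewrite {1}(LC Ly La) -!mulgA (LC La (LV Lq)).
    have -> : (q * (y * a_ i)^-1 * a_ i =
      q * y^-1)%g by rewrite invgM -!mulgA (LC (LV Ly) La) mulKg.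
    rewrite [rho (a_ i * _)%g]rhoM//; last exact: LM.
    rewrite mulmxA; apply: rho_sq_cancel => //.
    by have /(congr1 (fun Z => Z i)) := inv _ Lyq.
  by move=> t k Lt Pk; rewrite (sN t k)// (pfield_shift MN La sN).
have m3 y a : a \in A0 -> y \in F -> (y * a)%g \in F ->
    m N (fun q => bil 1%:M (f q (y * a)%g) (f q y *m rho a)) = h a.
  move=> aA0 yF yaF; have Ly := FL y yF; have Lya := FL _ yaF; have La := AL0 a aA0.
  rewrite /h -(shiftF (fun t => bil 1%:M (s (t * a)%g) (s t *m rho a)) (y * a)%g)//.
    apply: mean_ext => // q Lq; rewrite /f.
    have Lyq : L (y * y * q^-1)%g by apply: LM; [exact: LM | exact: LV].
    have -> : (y * a * (y * a) * q^-1 = a * (y * y * q^-1 * a))%g.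
      by rewrite {1}(LC Ly La) -!mulgA (LC La (LV Lq)).
    have -> : (q * (y * a)^-1 * a = q * y^-1)%g by rewrite invgM -!mulgA (LC (LV Ly) La) mulKg.
    rewrite [rho (a * _)%g]rhoM//; last exact: LM.
    rewrite mulmxA -(mulmxA _ (rho (y * y * q^-1)%g)) -rhoM// bil1_orth; last exact: LM.
    exact: bil1C.
  by move=> t k Lt Pk; rewrite (sN t k)// (pfield_shift MN La sN).
have restr_mean (B : 'M[R]_n) (f' : gT -> gT -> 'rV[R]_n) a c :
    (forall y, y \in F -> (y * a)%g \in F ->
      m N (fun q => bil B (f q (y * a)%g) (f' q y)) = c) ->
    m N (fun q => \sum_(y <- F) bil B (restr F (f q) (y * a)%g) (f' q y)) = overlap F a * c.
  move=> H; rewrite mean_sum /overlap -sum1_count natr_sum mulr_suml [RHS]big_mkcond.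
  rewrite !big_seq; apply: eq_bigr => y yF; rewrite /restr.
  case: ifPn => [yaF|_]; first by rewrite H// mul1r.
  by rewrite -[RHS](mean_zero N); congr (m N _); apply/funext => q; rewrite bil0l.
have mG : m N G = \sum_i overlap F (a_ i) * g i
    + C * \sum_(a <- A0) (2 * (X * N2 N s) - 2 * (overlap F a * h a)).
  rewrite meanD meanZ !mean_sum; congr (_ + _ * _).
    by apply: eq_bigr => i _; apply: restr_mean => y yF yaF; exact: m2.
  rewrite !big_seq; apply: eq_bigr => a aA0; rewrite meanB !meanZ; congr (_ * _ - _ * _).
    rewrite mean_sum /X -sum1_size natr_sum mulr_suml !big_seq; apply: eq_bigr => y yF.
    by rewrite m1// mul1r.
  by apply: restr_mean => y yF yaF; exact: m3.
have : 0 <= m N G by exact: (mean_ge0 ms).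
rewrite {}mG => main; rewrite -(pmulr_rge0 _ X0); apply: (le_trans main).
(* Overlaps fall short of [X] by at most [eps * X]; the errors make up the multiple of [eps] that
   [ge0_limit] discards. *)
have p1 : \sum_i overlap F (a_ i) * g i <= \sum_i (X * g i + X * (eps * `|g i|)).
  apply: ler_sum => i _; have /andP[h1 h2] := ov _ (aA i).
  rewrite -/X in h1 h2; have := ler_norm (- g i); rewrite normrN.
  have := normr_ge0 (g i); have := ler_norm (g i).
  by move: (overlap F (a_ i)) (g i) `|g i| h1 h2 => u v w; nra.
have p2 : \sum_(a <- A0) (2 * (X * N2 N s) - 2 * (overlap F a * h a)) <=
    \sum_(a <- A0) (X * shift_defect N a s + X * (eps * (2 * N2 N s))).
  rewrite !big_seq; apply: ler_sum => a aA0.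
  have aA' : a \in A by rewrite mem_cat aA0.
  have /andP[h1 h2] := ov a aA'.
  rewrite -/X in h1 h2; have := shift_defect_ge0 a s MN.
  rewrite (shift_defectE MN (AL0 _ aA0) sN) -/(h a); have := N2_ge0 s MN.
  by move: (overlap F a) (h a) (N2 N s) h1 h2 => u v w; nra.
have p3 := ler_wpM2l C0 p2; apply: (le_trans (lerD p1 p3)).
rewrite !big_split/= -!mulr_sumr -(Dl_sum N A0 s) big_const_seq count_predT iter_addr_0.
rewrite -[N2 N s *+ _]mulr_natl le_eqVlt; apply/orP; left; apply/eqP; rewrite /g.
ring.
Qed.

(** For the invariant part, the form plus the reflected form is bounded by a multiple of the squared
    defect, because the diagonal terms cancel in the sum over [i]. Nonnegativity bounds the
    reflected form from below to the same order, which leaves an upper bound for the form itself. *)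
Theorem nonneg_form_le_defect Y : kernel_form Y ->
  (forall K s, M K -> pfield K s -> 0 <= form K Y s s) ->
  exists C A, [/\ 0 <= C, forall a, a \in A -> L a &
    forall K s, M K -> pfield K s -> form K Y s s <= C * Dl K A s].
Proof.
move=> KY pos; have [Y' [KY' [C1 [A1 [C10 A1L small]]] inv]] := invariant_part KY.
have diag := kernel_form_diag KY' inv.
pose A2 := [seq a_ i | i <- enum 'I_p]; pose C2 := \sum_i (1 + nsq (Y' i)) * 2.
have A2L : forall a, a \in A2 -> L a by move=> a /mapP[i _ ->].
have C20 : 0 <= C2.
  by apply: sumr_ge0 => i _; rewrite mulr_ge0// addr_ge0// nsq_ge0.
exists (2 * C1 + C2), (A1 ++ A2); split; [lra | exact: cat_in |].
move=> K s MK sK.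
have split_form f : form K Y f f = form K (Y - Y') f f + form K Y' f f.
  by rewrite -[form K (Y - Y') f f]mul1r -form_lin scale1r subrK.
have refl : 0 <= \sum_i m K (fun t =>
  bil (Y' i) (s t *m rho (a_ i)) (s (t * a_ i)%g)) + C1 * Dl K A1 s.
  apply: reflected_form_ge => // K' f MK' fK'.
  have := pos K' f MK' fK'; have := small K' f MK' fK'.
  rewrite -[in X in _ -> X](subrK Y' Y).
  rewrite -[Y - Y']scale1r form_lin mul1r scale1r.
  by move=> h1 h2; have := ler_norm (form K' (Y - Y') f f); lra.
(* Invariance transports the value at [t * a_ i] back to [t], as [z']. With [b = bil (Y' i)], the
   identity is [b(z',x) + b(x,z') = b(z',z') + b(x,x) - b(z'-x,z'-x)]; the last term has the order
   of the squared defect, and a shift identifies the means of the other two. *)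
have sym i : m K (fun t => bil (Y' i) (s (t * a_ i)%g *m (rho (a_ i))^T) (s t)) +
     m K (fun t => bil (Y' i) (s t *m rho (a_ i)) (s (t * a_ i)%g)) <=
     2 * m K (fun t => bil (Y' i) (s t) (s t)) + (1 + nsq (Y' i)) * 2 * Dl K A2 s.
  have La := aL i; have invi : rho (a_ i) *m Y' i *m (rho (a_ i))^T = Y' i.
    by have /(congr1 (fun Z => Z i)) := inv _ La.
  rewrite mulr_natl mulr2n -[X in X + _ + _](shift_mean (a := a_ i) MK)//; last first.
    by move=> t k Lt Pk; rewrite sK.
  have D2 : shift_defect K (a_ i) s <= Dl K A2 s.
    by apply: shift_defect_le => //; rewrite map_f// mem_enum.
  apply: (@le_trans _ _ (m K (fun t => bil (Y' i) (s (t * a_ i)%g) (s (t * a_ i)%g)) +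
     m K (fun t => bil (Y' i) (s t) (s t)) + (1 + nsq (Y' i)) * 2 * shift_defect K (a_ i) s)).
    rewrite -meanZ -!meanD; apply: mean_le => // t Lt.
    set z := s (t * a_ i)%g; set x := s t.
    have -> : bil (Y' i) (x *m rho (a_ i)) z = bil (Y' i) x (z *m (rho (a_ i))^T).
      by rewrite -[RHS](bil_orth _ _ La invi) -mulmxA rhoO'// mulmx1.
    have -> : bil (Y' i) z z = bil (Y' i) (z *m (rho (a_ i))^T) (z *m (rho (a_ i))^T).
      by rewrite -[RHS](bil_orth _ _ La invi) -!mulmxA rhoO'// mulmx1.
    have -> : nsq (z - x *m rho (a_ i)) = nsq (z *m (rho (a_ i))^T - x).
      rewrite -[RHS](nsq_orthr _ (rhoO La)) mulmxBl -mulmxA rhoO'//.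
      by rewrite mulmx1.
    move: (z *m _) => z'; have := bil_le (Y' i) (z' - x) (z' - x).
    rewrite !bilDl !bilDr !bilNl !bilNr.
    have := ler_norm (- (bil (Y' i) z' z' + - bil (Y' i) z' x +
      (- bil (Y' i) x z' - - bil (Y' i) x x))).
    by rewrite normrN; lra.
  rewrite lerD2l ler_wpM2l// mulr_ge0// addr_ge0//; exact: nsq_ge0.
have diag0 : \sum_i m K (fun t => bil (Y' i) (s t) (s t)) = 0.
  rewrite -mean_sum -[RHS](mean_zero K); congr (m K _); apply/funext => t; exact: diag.
have := ler_sum (index_enum 'I_p) (fun i (_ : true) => sym i).
rewrite big_split/= big_split/= -form_sum -mulr_sumr diag0 mulr0 add0r -mulr_suml -/C2.
rewrite split_form Dl_cat; have := small K s MK sK; have := ler_norm (form K (Y - Y') s s).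
have := mulr_ge0 C10 (Dl_ge0 A2 s MK); have := mulr_ge0 C20 (Dl_ge0 A1 s MK).
by move: refl; rewrite !mulrDr !mulrDl; lra.
Qed.

End AbelianForms.

(** * Translation lattices *)

(** Each orbit inside a list of length [n] is a cycle of length at most [n], and all such lengths
    divide the factorial of [n]. *)
Lemma iter_fact_fixed (X : eqType) (s : seq X) (phi : X -> X) (x : X) :
  injective phi -> (forall y, y \in s -> phi y \in s) -> x \in s ->
  iter (size s)`! phi x = x.
Proof.
move=> inj phis xs; set n := size s.
have tr : {subset traject phi x n.+1 <= s}.
  move=> y /trajectP[i _ ->]; elim: i => // i IH; exact: phis.
have : ~~ uniq (traject phi x n.+1).
  by apply/negP => /uniq_leq_size /(_ tr); rewrite size_traject ltnn.
rewrite looping_uniq negbK /looping => /trajectP[i ilt e].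
have fixd : iter (n - i) phi x = x.
  have injn k : injective (iter k phi) by elim: k => //= k IH y z /inj /IH.
  by apply: (injn i); rewrite -iterD subnKC ?e// ltnW.
have /dvdnP[q ->] : (n - i %| n`!)%N by rewrite dvdn_fact// subn_gt0 ilt leq_subr.
elim: q => [|q IH]; first by rewrite mul0n.
by rewrite mulSn iterD IH.
Qed.

(** The class-two commutator formula: each of the ['C(n, 2)] exchanges of a [y] with a later [x]
    leaves behind one factor [c]. *)
Lemma expMg_binomial (gT : groupType) (x y c : gT) n :
  (y * x = x * y * c)%g -> commute x c -> commute y c ->
  ((x * y) ^+ n = x ^+ n * y ^+ n * c ^+ 'C(n, 2))%g.
Proof.
move=> yx xc yc; elim: n => [|n IH]; first by rewrite !expg0 !mulg1.
have ynx : (y ^+ n * x = x * y ^+ n * c ^+ n)%g.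
  elim: n {IH} => [|n IH]; first by rewrite !expg0 !mulg1 mul1g.
  rewrite expgSr -mulgA yx !mulgA IH expgSr -!mulgA; congr (_ * _)%g; congr (_ * _)%g.
  rewrite !mulgA; congr (_ * _)%g; exact/commute_sym/commuteX.
rewrite expgSr IH binS bin1 expgnDr [in RHS]expgSr [in RHS]expgSr.
have cC z k : commute z c -> (z * c ^+ k = c ^+ k * z)%g by move=> h; exact: commuteX.
rewrite -!mulgA; congr (_ * _)%g.
rewrite [(c ^+ _ * (x * y))%g]mulgA -(cC x)// !mulgA ynx -!mulgA.
congr (_ * (_ * _))%g.
by rewrite mulgA -!expgnDr cC// addnC.
Qed.

(** * Isolated orbits and finiteness by pigeonhole *)

Section Discreteness.
Context {R : realType} {n : nat}.

Lemma discrete_group_radius (G : groupClosed (euclid R n)) x : discrete_group G ->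
  exists2 r, 0 < r & forall g, g \in G -> nsq (act g x - x) < r -> act g x = x.
Proof.
move=> /(_ x x)[|_ [V /nbhs_ballP[e /= e0 eV] VG]].
  by exists 1%g => //; rewrite /act mul1mx addr0.
(* The library ball is taken entrywise, and every squared entry is at most [nsq]. *)
exists (e ^+ 2); first by rewrite exprn_gt0.
move=> g gG h; have : (V `&` gorbit G x) (act g x).
  split; last by exists (Elt gG).
  apply: eV; split => // i j; rewrite /ball/= distrC.
  rewrite -(ltr_pXn2r (_ : 0 < 2)%N) ?nnegrE ?normr_ge0 ?ltW// real_normK ?num_real//.
  apply: le_lt_trans h; have := entry_le_nsq (act g x - x) i j.
  by rewrite mxE [(- x) i j]mxE.
by rewrite VG.
Qed.

(** Pigeonhole: the cube of entries in [[-1, 1]] is cut into cells of side [1 / N], and two points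
    of one cell have squared distance at most [n ^ 2 / N], which is below [r]. *)
Lemma finite_separated (I : choiceType) (F : set I) (A : I -> 'M[R]_n) (r : R) : 0 < r ->
  (forall x i j, F x -> `|A x i j| <= 1) ->
  (forall x y, F x -> F y -> nsq (A x - A y) < r -> x = y) -> finite_set F.
Proof.
move=> r0 A1 sep; pose N := (Num.bound ((n ^ 2)%:R / r)).+1.
have N0 : 0 < N%:R :> R by rewrite ltr0n.
have NB : (n ^ 2)%:R / N%:R < r.
  rewrite ltr_pdivrMr// -ltr_pdivrMl// mulrC.
  by rewrite (lt_trans (archi_boundP _))// ?ltr_nat// divr_ge0// ltW.
clearbody N; pose f x : {ffun 'I_n * 'I_n -> 'I_(N.*2).+1} :=
  [ffun ij => inord (Num.truncn ((A x ij.1 ij.2 + 1) * N%:R))].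
have fi : {in F &, injective f}.
  move=> x y; rewrite !inE => Fx Fy fxy; apply: sep => //; apply: le_lt_trans NB.
  have key i j : (A x i j - A y i j) ^+ 2 <= N%:R^-1.
    have pos z : F z -> 0 <= (A z i j + 1) * N%:R <= (N.*2)%:R.
      move=> Fz; have := A1 z i j Fz; rewrite ler_norml => /andP[h1 h2].
      by rewrite -muln2 natrM; apply/andP; split; nra.
    have tr z : F z -> (f z (i, j) : nat) = Num.truncn ((A z i j + 1) * N%:R).
      move=> Fz; rewrite ffunE inordK// ltnS truncn_le_nat; have /andP[_ h2] := pos z Fz.
      by rewrite (le_lt_trans h2)// ltr_nat.
    have e : Num.truncn ((A x i j + 1) * N%:R) = Num.truncn ((A y i j + 1) * N%:R).
      by rewrite -!tr// fxy.
    have /andP[px _] := pos x Fx; have /andP[py _] := pos y Fy.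
    have /andP[x1 x2] := truncn_itv px; have /andP[y1 y2] := truncn_itv py.
    rewrite -e in y1 y2; move: x2 y2; rewrite -!natr1.
    move=> x2 y2; have N1 : 1 <= N%:R :> R by move: N0; rewrite ltr0n ler1n.
    have h : ((A x i j - A y i j) * N%:R) ^+ 2 <= 1.
      have -> : (A x i j - A y i j) * N%:R = (A x i j + 1) * N%:R - (A y i j + 1) * N%:R by ring.
      by move: (_ * N%:R) ((A y i j + 1) * N%:R) (_%:R) x1 y1 x2 y2 => X Y u; nra.
    rewrite -[_^-1]mul1r ler_pdivlMr//; apply: le_trans h.
    by rewrite exprMn ler_wpM2l ?sqr_ge0// expr2 ler_peMr// ltW.
  apply: (@le_trans _ _ (\sum_(i < n) \sum_(j < n) N%:R^-1)).
    by apply: ler_sum => i _; apply: ler_sum => j _; rewrite !mxE; apply: key.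
  by rewrite !sumr_const !card_ord -mulrnA -mulnn mulr_natl.
have := inj_card_eq fi; rewrite card_eq_sym => /card_eqPle[+ _] => /card_le_finite; apply.
exact: finite_finset.
Qed.

End Discreteness.

(** * The translation lattice inside the group *)

Section Groups.
Context {R : realType} {d1 d2 : nat} {S : groupClosed (euclid R d2)}.
Context {G : groupClosed (euclid R (d1 + d2))} {T : set (elt G)}.
Hypothesis nf : normal_form S G.
Hypothesis Tbij : set_bij T (translations S) (fun t => dsum_proj (val t)).
Implicit Types g h t : elt G.

Definition prj g : euclid R d2 := dsum_proj (val g).

Lemma orth_inj n (A B : orth R n) : (A : 'M_n) = B -> A = B.
Proof. exact: val_inj. Qed.

Lemma dsumM A B (s s' : euclid R d2) :
  (dsum A s * dsum B s' = dsum (A * B : orth R d1) (s * s'))%g.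
Proof.
congr Euclid.
  apply: orth_inj; rewrite /= mulmx_block !mulmx0 !mul0mx !addr0 add0r.
  by [].
by rewrite /= mul_block_col add_col_mx !mulmx0 !mul0mx !add0r.
Qed.

Lemma elt_dsum g : exists A, val g = dsum A (prj g).
Proof.
case: nf => _ _ H _; have [s _ [A e]] := H _ (valP g).
by exists A; rewrite /prj e dsum_projE.
Qed.

Lemma prjM g h : prj (g * h)%g = (prj g * prj h)%g.
Proof.
have [A eA] := elt_dsum g; have [B eB] := elt_dsum h.
by rewrite {1}/prj valM eA eB dsumM dsum_projE.
Qed.

Lemma val_elt1 : val (1%g : elt G) = 1%g.
Proof. by apply: (@mulgI _ (val (1%g : elt G))); rewrite -valM !mulg1. Qed.

Lemma val_eltV g : val g^-1%g = ((val g)^-1)%g.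
Proof. by apply: (@mulgI _ (val g)); rewrite -valM !mulgV val_elt1. Qed.

Lemma prj1 : prj 1%g = 1%g.
Proof.
by apply: (@mulgI _ (prj 1%g)); rewrite -prjM !mulg1.
Qed.

Lemma prjV g : prj g^-1%g = ((prj g)^-1)%g.
Proof.
apply: (@mulgI _ (prj g)); rewrite -prjM !mulgV; exact: prj1.
Qed.

Lemma prjS g : prj g \in S.
Proof.
case: nf => _ _ _ H; have : [set dsum_proj x | x in [set` G]] (prj g).
  by exists (val g) => //=; exact: valP.
by rewrite H.
Qed.

Definition tau g : 'cV[R]_d2 := trans (prj g).
Definition translational g := lin (prj g) = 1%:M.

Lemma tauM g h : tau (g * h)%g = tau g + lin (prj g) *m tau h.
Proof. by rewrite /tau prjM. Qed.

Lemma linM n (g h : euclid R n) : lin (g * h)%g = lin g *m lin h.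
Proof. by []. Qed.

Lemma lin1 n : lin (1%g : euclid R n) = 1%:M. Proof. by []. Qed.

Lemma linV n (g : euclid R n) : lin g^-1%g = (lin g)^T. Proof. by []. Qed.

Lemma lin_orth n (g : euclid R n) : (lin g)^T *m lin g = 1%:M.
Proof. by rewrite /lin; case: (linpart g) => A /= /eqP. Qed.

Lemma lin_orth' n (g : euclid R n) : lin g *m (lin g)^T = 1%:M.
Proof. by apply: mulmx1C; exact: lin_orth. Qed.

Lemma translational1 : translational 1%g.
Proof. by rewrite /translational prj1. Qed.

Lemma translationalM g h : translational g -> translational h -> translational (g * h)%g.
Proof. by rewrite /translational prjM linM => -> ->; rewrite mulmx1. Qed.

Lemma translationalV g : translational g -> translational (g^-1)%g.
Proof. by rewrite /translational prjV linV => ->; rewrite trmx1. Qed.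

Lemma translationalJ g h : translational h -> translational (g * h * g^-1)%g.
Proof.
by rewrite /translational !prjM prjV !linM linV => ->; rewrite mulmx1 lin_orth'.
Qed.

Lemma translationalX g n : translational g -> translational (g ^+ n)%g.
Proof.
move=> tg; elim: n => [|n IH]; first by rewrite expg0; exact: translational1.
by rewrite expgS; exact: translationalM.
Qed.

Lemma euclid_eq n (g h : euclid R n) : lin g = lin h -> trans g = trans h -> g = h.
Proof. by case: g h => [A a] [B b] /= AB ->; congr Euclid; exact: orth_inj. Qed.

Lemma tau_inj g h : translational g -> translational h -> tau g = tau h -> prj g = prj h.
Proof. by move=> tg th e; apply: euclid_eq; rewrite ?tg ?th. Qed.

Lemma tauX g n : translational g -> tau (g ^+ n)%g = n%:R *: tau g.
Proof.
move=> tg; elim: n => [|n IH]; first by rewrite expg0 /tau prj1 scale0r.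
by rewrite expgS tauM tg mul1mx IH -natr1 scalerDl scale1r addrC.
Qed.

Lemma prj_translationalC g h : translational g -> translational h ->
  prj (g * h)%g = prj (h * g)%g.
Proof.
move=> tg th; apply: tau_inj; [exact: translationalM | exact: translationalM |].
by rewrite !tauM tg th !mul1mx addrC.
Qed.

Lemma T_translational t : T t -> translational t.
Proof. by case: Tbij => H _ _ /H []. Qed.

Lemma T_inj t t' : T t -> T t' -> prj t = prj t' -> t = t'.
Proof. by case: Tbij => _ H _ Tt Tt'; apply: H; rewrite inE. Qed.

Lemma T_surj g : translational g -> exists2 t, T t & prj t = prj g.
Proof.
case: Tbij => _ _ H tg; have [|t Tt e] := H (prj g); first by split => //; exact: prjS.
by exists t.
Qed.

Lemma powers_translational N x : powers T N x -> translational x.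
Proof. by move=> [t Tt <-]; apply: translationalX; exact: T_translational. Qed.

Lemma powers_inj N x y : (0 < N)%N -> powers T N x -> powers T N y ->
  prj x = prj y -> x = y.
Proof.
move=> N0 [t Tt <-] [t' Tt' <-] e; congr (_ ^+ _)%g; apply: T_inj => //.
apply: tau_inj; try exact: T_translational.
have : tau (t ^+ N)%g = tau (t' ^+ N)%g by rewrite /tau e.
rewrite !tauX; try exact: T_translational.
by move=> /scalerI; apply; rewrite pnatr_eq0 -lt0n.
Qed.

Lemma powers_abelian N x y : M0 T N -> powers T N x -> powers T N y -> (x * y = y * x)%g.
Proof.
move=> [N0 [[_ PM _] _]] Px Py; apply: (powers_inj N0); try exact: PM.
by apply: prj_translationalC; apply: powers_translational; eassumption.
Qed.

Lemma M0_mul N k : M0 T N -> (0 < k)%N -> M0 T (N * k)%N.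
Proof.
move=> MN k0; have [N0 [[P1 PM PV] PJ]] := MN.
have PX x : powers T (N * k) x <-> exists2 y, powers T N y & (y ^+ k)%g = x.
  split => [[t Tt <-]|[_ [t Tt <-] <-]].
    by exists (t ^+ N)%g; [exists t | rewrite expgnA].
  by exists t => //; rewrite expgnA.
split; first by rewrite muln_gt0 N0.
split; first split.
- by apply/PX; exists 1%g => //; rewrite expg1n.
- move=> g h /PX[x Px <-] /PX[y Py <-]; apply/PX; exists (x * y)%g; first exact: PM.
  by rewrite expgMn//; exact: (powers_abelian MN).
- move=> g /PX[x Px <-]; apply/PX; exists x^-1%g; first exact: PV.
  by rewrite expVgn.
- move=> g h /PX[x Px <-]; apply/PX; exists (g * x * g^-1)%g; first exact: PJ.
  have e z : (g * z * g^-1 = z ^ g^-1)%g by rewrite conjgE invgK mulgA.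
  by rewrite !e conjXg.
Qed.

Lemma powers_mul_sub N k : M0 T N -> powers T (N * k) `<=` powers T N.
Proof.
move=> [_ [HP _]] _ [t Tt <-]; rewrite expgnA; apply: (subgroupX HP).
by exists t.
Qed.

(* The kernel fixes the origin, so discreteness of the orbits of the basis vectors
   separates its elements inside the bounded set of orthogonal matrices. *)
Lemma finite_prj_kernel : finite_set [set g | prj g = 1%g].
Proof.
case: (nf) => _ Gd _ _.
have kerE g : prj g = 1%g -> trans (val g) = 0.
  move=> g1; have [A ->] := elt_dsum g; rewrite g1 /=.
  by apply/matrixP => i j; rewrite !mxE; case: splitP => k _; rewrite !mxE.
have rad j := discrete_group_radius (delta_mx j 0 : 'cV[R]_(d1 + d2)) Gd.
have [r r0 rP] : exists2 r : R, 0 < r & forall (j : 'I_(d1 + d2)) (g : euclid R (d1 + d2)),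
  g \in G ->
    nsq (act g (delta_mx j 0) - delta_mx j 0) < r -> act g (delta_mx j 0) = delta_mx j 0.
  have /choice[r rP] : forall j : 'I_(d1 + d2), exists r : R,
    0 < r /\ forall g : euclid R (d1 + d2), g \in G ->
      nsq (act g (delta_mx j 0) - delta_mx j 0) < r -> act g (delta_mx j 0) = delta_mx j 0.
    by move=> j; have [r r0 rP] := rad j; exists r.
  exists (\big[Num.min/1]_j r j).
    by elim/big_ind : _ => // [x y x0 y0|j _]; [rewrite lt_min x0 | have [] := rP j].
  move=> j g gG h; have [_] := rP j; apply => //; apply: (lt_le_trans h).
  exact: bigmin_le_cond.
apply: (finite_separated (A := fun g => lin (val g)) r0).
  move=> g i j _; have := congr1 (fun M : 'M[R]__ => M j j) (lin_orth (val g)).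
  rewrite !mxE eqxx (bigD1 i)//= !mxE => e.
  rewrite -(ler_pXn2r (_ : 0 < 2)%N) ?nnegrE// expr1n real_normK ?num_real// expr2.
  apply: le_trans (_ : _ <= 1%:R) _ => //; rewrite -{}e.
  by rewrite lerDl sumr_ge0// => k _; rewrite !mxE -expr2 sqr_ge0.
move=> g h g1 h1 d; apply: val_inj; apply: euclid_eq; last by rewrite !kerE.
apply/matrixP => i j.
have hg : act (val (h^-1 * g)%g) (delta_mx j 0) = delta_mx j 0.
  apply: rP; first exact: valP.
  apply: le_lt_trans d; rewrite /act kerE; last by rewrite prjM prjV h1 g1 invg1 mulg1.
  rewrite addr0 valM linM -(nsq_orthl _ (lin_orth (val h))) mulmxBr mulmxA mulmxA.
  have -> : lin (val h) *m lin (val h^-1%g) = 1%:M by rewrite val_eltV linV lin_orth'.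
  rewrite mul1mx -mulmxBl -colE /nsq ler_sum// => k _.
  by rewrite big_ord1 (bigD1 j)//= mxE lerDl sumr_ge0// => *; rewrite sqr_ge0.
move: hg; rewrite /act kerE; last by rewrite prjM prjV h1 g1 invg1 mulg1.
rewrite addr0 valM linM => /(congr1 (mulmx (lin (val h)))).
rewrite !mulmxA val_eltV linV lin_orth' mul1mx -!colE => /(congr1 (fun M : 'cV[R]__ => M i 0)).
by rewrite !mxE.
Qed.

(** The obstruction is the finite kernel of [prj]: translational elements commute only up to it. For
    a suitable exponent, taking powers is multiplicative on translational elements and kills the
    kernel, so the powers of [T] are the powers of all translational elements, a set stable under
    products, inverses and conjugation. *)
Lemma M0_nonempty : exists N, M0 T N.
Proof.
have [sK sKP] : exists s : seq (elt G), forall g, g \in s <-> prj g = 1%g.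
  exists (fset_set [set g | prj g = 1%g]) => g.
  by rewrite in_fset_set ?inE//; exact: finite_prj_kernel.
pose e := (size sK)`!; have e0 : (0 < e)%N by exact: fact_gt0.
have kerX g : prj g = 1%g -> (g ^+ e = 1)%g.
  move=> g1; rewrite -(iter_mulg_1 e g); apply: iter_fact_fixed; first exact: mulgI.
    by move=> y /sKP y1; apply/sKP; rewrite prjM g1 y1 mulg1.
  by apply/sKP; exact: prj1.
have centr x f : prj f = 1%g -> commute (x ^+ e)%g f.
  move=> f1; have : iter e (fun y => y ^ x)%g f = f.
    apply: iter_fact_fixed; first exact: conjg_inj.
      by move=> y /sKP y1; apply/sKP; rewrite conjgE !prjM prjV y1 mul1g mulVg.
    exact/sKP.
  have -> k : iter k (fun y => y ^ x)%g f = (f ^ (x ^+ k))%g.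
    by elim: k => [|k IH]; rewrite ?expg0 ?conjg1//= IH -conjgM -expgSr.
  by move=> h; apply: commute_sym; rewrite /commute conjgC h.
(* The first factor makes [e]-th powers commute with the kernel, hence with the commutator of two
   such powers. In the second, ['C(2 * e, 2)] is a multiple of [e], so the commutator term of
   [expMg_binomial] dies. *)
pose N := (e * (2 * e))%N.
have ker_quot x y : translational x -> translational y -> tau x = tau y ->
    prj (x^-1 * y)%g = 1%g.
  by move=> tx ty /(tau_inj tx ty) xy; rewrite prjM prjV xy mulVg.
have XM x y : translational x -> translational y -> ((x * y) ^+ N = x ^+ N * y ^+ N)%g.
  move=> tx ty; rewrite /N !(expgnA _ e).
  pose x' := (x ^+ e)%g; pose y' := (y ^+ e)%g.
  have tx' : translational x' by exact: translationalX.
  have ty' : translational y' by exact: translationalX.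
  pose f := ((x' * y')^-1 * (x * y) ^+ e)%g.
  have f1 : prj f = 1%g.
    apply: ker_quot; [exact: translationalM | exact/translationalX/translationalM |].
    by rewrite tauM tx' mul1mx !tauX ?tauM ?tx ?mul1mx ?scalerDr//; exact: translationalM.
  have -> : ((x * y) ^+ e = x' * y' * f)%g by rewrite /f mulgA mulgV mul1g.
  have cxf : commute x' f by exact: centr.
  have cyf : commute y' f by exact: centr.
  rewrite expgMn; last by apply: commute_sym; apply: commuteM; exact: commute_sym.
  rewrite (_ : f ^+ (2 * e) = 1)%g; last by rewrite mulnC expgnA kerX// expg1n.
  rewrite mulg1; pose c := [~ y', x']%g.
  have c1 : prj c = 1%g.
    rewrite /c commgEl conjgE !mulgA -mulgA -invgM; apply: ker_quot; try exact: translationalM.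
    by rewrite !tauM tx' ty' !mul1mx addrC.
  rewrite (expMg_binomial _ (c := c)); [| exact: commgC | exact: centr | exact: centr].
  rewrite (_ : c ^+ _ = 1)%g ?mulg1// bin2 -mulnA mul2n half_double expgnA kerX//.
  by rewrite expg1n.
have Xker x : prj x = 1%g -> (x ^+ N = 1)%g.
  by move=> x1; rewrite expgnA kerX// expg1n.
have PH x : translational x -> powers T N (x ^+ N)%g.
  move=> tx; have [t Tt tE] := T_surj tx; exists t => //.
  have -> : (x = t * (t^-1 * x))%g by rewrite mulgA mulgV mul1g.
  have f1 : prj (t^-1 * x)%g = 1%g by rewrite prjM prjV tE mulVg.
  have tf : translational (t^-1 * x)%g by rewrite /translational f1.
  by rewrite (XM _ _ (T_translational Tt) tf) (Xker _ f1) mulg1.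
exists N; split; first by rewrite !muln_gt0 e0.
split; first split.
- by rewrite -(expg1n _ N); apply: PH; exact: translational1.
- move=> _ _ [t Tt <-] [t' Tt' <-]; rewrite -XM; try exact: T_translational.
  by apply: PH; apply: translationalM; exact: T_translational.
- by move=> _ [t Tt <-]; rewrite -expVgn; apply: PH; apply: translationalV; exact: T_translational.
- move=> g _ [t Tt <-].
  have ez z : (g * z * g^-1 = z ^ g^-1)%g by rewrite conjgE invgK mulgA.
  rewrite ez conjXg -ez; by apply: PH; apply: translationalJ; exact: T_translational.
Qed.

(** A nontrivial element of [powers T (N * k)] is a power of some [t] whose translation part is
    bounded below by discreteness; for large [k] it is longer than every translation occurring in
    [s]. *)
Lemma powers_separated N (s : seq (elt G)) : M0 T N ->
  exists k, (0 < k)%N /\ forall a, a \in s -> powers T (N * k) a -> a = 1%g.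
Proof.
move=> MN; case: (nf) => -[Sd _] _ _ _; have [N0 [[P1 _ _] _]] := MN.
have [r r0 rP] := discrete_group_radius (0 : 'cV[R]_d2) Sd.
pose k := (Num.bound ((\sum_(a <- s) nsq (tau a)) / r)).+1.
exists k; split => // a sa Pa; have Pa' := powers_mul_sub MN Pa.
case: Pa => t Tt ta; have tt := T_translational Tt.
have [h|h] := ltrP (nsq (tau t)) r.
  have t0 : tau t = 0.
    have := rP (prj t) (prjS t); rewrite /act tt mul1mx add0r subr0; exact.
  apply: (powers_inj N0 Pa' P1); apply: tau_inj;
    [exact: powers_translational Pa' | exact: translational1 |].
  by rewrite -ta tauX// t0 scaler0 /tau prj1.
have ha : nsq (tau a) <= \sum_(a <- s) nsq (tau a).
  elim: s sa {k ta Pa'} => // b s IH; rewrite big_cons inE => /orP[/eqP <-|/IH h'].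
    by rewrite lerDl sumr_ge0// => *; exact: nsq_ge0.
  by rewrite (le_trans h')// lerDr nsq_ge0.
have hk : (\sum_(a <- s) nsq (tau a)) / r < k%:R.
  rewrite (lt_trans (archi_boundP _))// ?ltr_nat// divr_ge0 ?(ltW r0)//.
  by apply: sumr_ge0 => *; exact: nsq_ge0.
move: hk; rewrite ltr_pdivrMr// => hk.
move: ha; rewrite -ta tauX// nsqZ => ha.
have k1 : 1 <= k%:R :> R by rewrite ler1n.
have N1 : 1 <= N%:R :> R by rewrite ler1n.
have := le_lt_trans ha hk; rewrite natrM exprMn ltNge => /negP[].
have h1 : k%:R <= N%:R ^+ 2 * k%:R ^+ 2 :> R.
  have : 1 <= N%:R ^+ 2 * k%:R :> R by rewrite mulr_ege1// exprn_ege1.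
  by move=> h1; rewrite (expr2 k%:R) mulrA ler_peMl// (le_trans ler01 k1).
by apply: ler_pM => //; rewrite ?ltW.
Qed.

End Groups.

(** * Means over the group *)

Section Averages.
Context {R : realType} {gT : groupType}.
Implicit Types (H : set gT) (C : {fset gT}) (F : gT -> R).

Definition avg C F : R := (#|` C|)%:R^-1 * \sum_(g <- C) F g.

Definition rep H C g : gT := xget 1%g [set c | c \in C /\ lcoset_of H c g].

Lemma avg_lin C c F F' : avg C (fun g => c * F g + F' g) = c * avg C F + avg C F'.
Proof. by rewrite /avg big_split/= -mulr_sumr mulrDr mulrCA. Qed.

Lemma avgD C F F' : avg C (fun g => F g + F' g) = avg C F + avg C F'.
Proof. by rewrite /avg big_split mulrDr. Qed.

Lemma avgZ C c F : avg C (fun g => c * F g) = c * avg C F.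
Proof. by rewrite /avg -mulr_sumr mulrCA. Qed.

Lemma avg_sum (I : Type) (r : seq I) (P : pred I) C (F : I -> gT -> R) :
  avg C (fun g => \sum_(i <- r | P i) F i g) = \sum_(i <- r | P i) avg C (F i).
Proof. by rewrite /avg exchange_big mulr_sumr. Qed.

Lemma avg_le C F F' : (forall g, F g <= F' g) -> avg C F <= avg C F'.
Proof. by move=> h; rewrite ler_wpM2l ?invr_ge0// ler_sum. Qed.

Lemma avg_ge0 C F : (forall g, 0 <= F g) -> 0 <= avg C F.
Proof. by move=> h; rewrite mulr_ge0 ?invr_ge0// sumr_ge0. Qed.

Lemma avg_norm C F : `|avg C F| <= avg C (fun g => `|F g|).
Proof. by rewrite normrM ger0_norm ?invr_ge0// ler_wpM2l ?invr_ge0// ler_norm_sum. Qed.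

Context {H : set gT} {C : {fset gT}}.
Hypotheses (Hn : normal_subgroup H) (CH : representatives C H).

Let HM g h : H g -> H h -> H (g * h)%g. Proof. by case: Hn => -[_ hM _] _; exact: hM. Qed.
Let HV g : H g -> H g^-1%g. Proof. by case: Hn => -[_ _ hV] _; exact: hV. Qed.
Let H1 : H 1%g. Proof. by case: Hn => -[]. Qed.
Let HJ g h : H h -> H (g * h * g^-1)%g. Proof. by case: Hn => _ hJ; exact: hJ. Qed.

Lemma lcoset_ofE c g : lcoset_of H c g <-> H (c^-1 * g)%g.
Proof.
split=> [[h Hh <-]|Hh]; first by rewrite mulKg.
by exists (c^-1 * g)%g => //; rewrite mulVKg.
Qed.

Lemma repP g : rep H C g \in C /\ H ((rep H C g)^-1 * g)%g.
Proof.
have [c [[cC cg] _]] := CH g.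
have : [set c | c \in C /\ lcoset_of H c g] !=set0 by exists c.
by move=> /(xgetPex 1%g)[h1 /lcoset_ofE h2].
Qed.

Lemma rep_uniq c g : c \in C -> H (c^-1 * g)%g -> rep H C g = c.
Proof.
move=> cC cg; have [c' [_ h]] := CH g; have [r1 r2] := repP g.
rewrite -(h _ (conj r1 ((lcoset_ofE _ _).2 r2))).
by apply: h; split => //; exact/lcoset_ofE.
Qed.

Lemma rep_periodic g h : H h -> rep H C (g * h)%g = rep H C g.
Proof.
move=> Hh; have [r1 r2] := repP g; apply: rep_uniq => //.
by rewrite mulgA; exact: HM.
Qed.

Lemma avg_one : avg C (fun=> 1) = 1.
Proof.
rewrite /avg (_ : \sum_(g <- C) 1 = (size C)%:R); last by rewrite -sum1_size natr_sum.
rewrite mulVf// pnatr_eq0 -lt0n.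
by rewrite -has_predT; apply/hasP; exists (rep H C 1%g) => //; have [] := repP 1%g.
Qed.

Lemma avg_const c : avg C (fun=> c) = c.
Proof. by rewrite -[RHS]mulr1 -avg_one -avgZ; under [in RHS]eq_fun do rewrite mulr1. Qed.

(** The condition on [phi] makes it send representatives of distinct cosets to distinct cosets;
    there are finitely many, so it permutes them. *)
Lemma avg_reindex (phi : gT -> gT) F :
  (forall g g', H ((phi g)^-1 * phi g')%g -> H (g^-1 * g')%g) ->
  (forall g h, H h -> F (g * h)%g = F g) -> avg C (F \o phi) = avg C F.
Proof.
move=> phiH FH; congr (_ * _).
pose psi g := rep H C (phi g).
transitivity (\sum_(g <- [seq psi c | c <- C]) F g).
  rewrite big_map; apply: eq_bigr => c _; have [_ r2] := repP (phi c).
  by rewrite /= -(FH (psi c) _ r2) mulVKg.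
have sub : {subset [seq psi c | c <- C] <= C}.
  by move=> _ /mapP[c _ ->]; have [] := repP (phi c).
have uC : uniq [seq psi c | c <- C].
  rewrite map_inj_in_uniq ?fset_uniq// => c c' cC c'C e.
  have [_ r2] := repP (phi c); have [_ r2'] := repP (phi c').
  have h : H (c^-1 * c')%g.
    apply: phiH; rewrite -/(psi c) in r2; rewrite -/(psi c') -e in r2'.
    have -> : ((phi c)^-1 * phi c' = ((psi c)^-1 * phi c)^-1 * ((psi c)^-1 * phi c'))%g.
      by rewrite invgM invgK -mulgA mulVKg.
    by apply: HM => //; exact: HV.
  by rewrite -(rep_uniq cC h); apply/rep_uniq => //; rewrite mulVg.
apply: perm_big; apply: uniq_perm => //; first exact: fset_uniq.
by have [|_] := uniq_min_size uC sub; rewrite ?size_map.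
Qed.

Lemma avg_mull b F : (forall g h, H h -> F (g * h)%g = F g) ->
  avg C (fun g => F (b * g)%g) = avg C F.
Proof.
move=> FH; apply: (avg_reindex (phi := fun g => (b * g)%g)) => // g g'.
by rewrite invgM -mulgA mulKg.
Qed.

Lemma avg_mulr b F : (forall g h, H h -> F (g * h)%g = F g) ->
  avg C (fun g => F (g * b)%g) = avg C F.
Proof.
move=> FH; apply: (avg_reindex (phi := fun g => (g * b)%g)) => // g g' h.
have := HJ b h; rewrite invgM !mulgA mulgK.
by rewrite mulgV mul1g.
Qed.

End Averages.

(** Splitting over the cosets of [H] reduces the finer mean to the density of [H], which the
    constant function 1 then identifies. *)
Lemma avg_sub (R : realType) (gT : groupType) (H H' : set gT) (C C' : {fset gT}) (F : gT -> R) :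
  normal_subgroup H -> representatives C H ->
  normal_subgroup H' -> representatives C' H' -> H' `<=` H ->
  (forall g h, H h -> F (g * h)%g = F g) -> avg C' F = avg C F.
Proof.
move=> Hn CH Hn' CH' HH' FH.
have [[_ HM HV] _] := Hn.
pose ind g : R := (`[< H g >])%:R.
have key E : (forall g h, H h -> E (g * h)%g = E g) ->
    avg C' E = (\sum_(c <- C) E c) * avg C' ind.
  move=> EH; transitivity (avg C' (fun g => \sum_(c <- C) E c * ind (c^-1 * g)%g)).
    congr (_ * _); apply: eq_bigr => g _; have [r1 r2] := repP CH g.
    rewrite (bigD1_seq (rep H C g)) ?fset_uniq//= big_seq_cond big1 ?addr0.
      by rewrite /ind; case: asboolP => // _; rewrite mulr1 -(EH (rep H C g) _ r2) mulVKg.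
    move=> c /andP[cC cr]; rewrite /ind; case: asboolP; rewrite ?mulr0// => h.
    by move: cr; rewrite (rep_uniq CH cC h) eqxx.
  rewrite avg_sum mulr_suml; apply: eq_bigr => c _; rewrite avgZ; congr (_ * _).
  apply: (avg_mull Hn' CH') => g h /HH' Hh; congr (_%:R); congr (nat_of_bool _).
  apply: asbool_equiv_eq; split => h'; last exact: HM.
  by rewrite -(mulgK h g); apply: HM => //; exact: HV.
have /esym := key (fun=> 1) (fun _ _ _ => erefl).
rewrite (avg_one CH') (_ : \sum_(g <- C) 1 = (size C)%:R); last by rewrite -sum1_size natr_sum.
move=> e; rewrite key//.
have C0 : (size C)%:R != 0 :> R.
  by apply/eqP => C0; move: e; rewrite C0 mul0r => /eqP; rewrite eq_sym oner_eq0.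
by rewrite /avg mulrC; congr (_ * _); apply: (mulfI C0); rewrite e divff.
Qed.

Section GroupAverages.
Context {R : realType} {d1 d2 : nat} {S : groupClosed (euclid R d2)}.
Context {G : groupClosed (euclid R (d1 + d2))} {T : set (elt G)}.
Context {C : nat -> {fset elt G}}.
Hypothesis nf : normal_form S G.
Hypothesis Tbij : set_bij T (translations S) (fun t => dsum_proj (val t)).
Hypothesis Crep : forall N, M0 T N -> representatives (C N) (powers T N).
Implicit Types g h t : elt G.

Lemma M0_normal N : M0 T N -> normal_subgroup (powers T N).
Proof. by case. Qed.

Lemma avg_indep N K (F : elt G -> R) : M0 T N -> M0 T K -> periodic T N F -> periodic T K F ->
  avg (C N) F = avg (C K) F.
Proof.
move=> MN MK FN FK; have K0 : (0 < K)%N by case: MK.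
have MNK := M0_mul nf Tbij MN K0.
rewrite -(avg_sub (M0_normal MN) (Crep MN) (M0_normal MNK) (Crep MNK))//; last first.
  exact: (powers_mul_sub MN).
rewrite -(avg_sub (M0_normal MK) (Crep MK) (M0_normal MNK) (Crep MNK))//.
by rewrite mulnC; exact: (powers_mul_sub MK).
Qed.

Lemma periodic_mul N k (X : Type) (u : elt G -> X) :
  M0 T N -> periodic T N u -> periodic T (N * k) u.
Proof. by move=> MN uN g t /(powers_mul_sub MN); exact: uN. Qed.

Context {N0 : nat} (MN0 : M0 T N0).

Definition crep g := rep (powers T N0) (C N0) g.
(** Normality lets the lattice factor stand on the left, so left translation by the lattice changes
    [lpart] and fixes [crep]. *)
Definition lpart g : elt G := (g * (crep g)^-1)%g.

Let Pn := M0_normal MN0.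
Let Cn := Crep MN0.

Lemma lpart_in g : powers T N0 (lpart g).
Proof.
have [_ r2] := repP Cn g; case: Pn => _ /(_ (crep g) _ r2).
by rewrite /crep !mulgA mulgV mul1g.
Qed.

Lemma crep_in g : crep g \in C N0.
Proof. by have [] := repP Cn g. Qed.

Lemma lpartK g : (lpart g * crep g = g)%g.
Proof. by rewrite /lpart mulgVK. Qed.

Lemma crep_mull a g : powers T N0 a -> crep (a * g)%g = crep g.
Proof.
move=> Pa; have [[_ PM _] PJ] := Pn.
have -> : (a * g = g * (g^-1 * a * g^-1^-1))%g by rewrite invgK !mulgA mulgV mul1g.
by apply: (rep_periodic Pn Cn); exact: PJ.
Qed.

Lemma lpart_mull a g : powers T N0 a -> lpart (a * g)%g = (a * lpart g)%g.
Proof. by move=> Pa; rewrite /lpart crep_mull// mulgA. Qed.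

Lemma crep_C c : c \in C N0 -> crep c = c.
Proof.
by move=> cC; apply: (rep_uniq Cn cC); rewrite mulVg; case: Pn => -[].
Qed.

Lemma lpart_periodic K g k : powers T K `<=` powers T N0 -> M0 T K -> powers T K k ->
  exists2 k', powers T K k' & lpart (g * k)%g = (lpart g * k')%g.
Proof.
move=> KN MK Pk; exists (crep g * k * (crep g)^-1)%g.
  by case: MK => _ [_ PJ]; exact: PJ.
rewrite /lpart; have -> : crep (g * k)%g = crep g.
  by apply: (rep_periodic Pn Cn); exact: KN.
by rewrite !mulgA mulgVK.
Qed.

(** Multiples of [N0] only, so that every period subgroup lies inside the lattice. *)
Definition scales : set nat := [set K | exists2 k, (0 < k)%N & K = (N0 * k)%N].

Lemma scales_M0 K : scales K -> M0 T K.
Proof. by case=> k k0 ->; exact: (M0_mul nf Tbij). Qed.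

Lemma scales_sub K : scales K -> powers T K `<=` powers T N0.
Proof. by case=> k k0 ->; exact: (powers_mul_sub MN0). Qed.

Lemma scales_periodic K (F : elt G -> R) : scales K ->
  (forall t k, powers T N0 t -> powers T K k -> F (t * k)%g = F t) ->
  forall g k, powers T K k -> F (lpart (g * k)%g) = F (lpart g).
Proof.
move=> sK FK g k Pk; have [k' Pk' ->] := lpart_periodic g (scales_sub sK) (scales_M0 sK) Pk.
by apply: FK => //; exact: lpart_in.
Qed.

(** Functions on the lattice are averaged over a period of the whole group after composition with
    [lpart], which avoids a separate choice of representatives inside the lattice. *)
Lemma lattice_mean_system :
  mean_system (powers T N0) scales (powers T) (fun K (F : elt G -> R) => avg (C K) (F \o lpart)).
Proof.
have PL K : scales K -> subgroup (powers T K) /\ powers T K `<=` powers T N0.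
  by move=> sK; split; [case: (M0_normal (scales_M0 sK)) | exact: scales_sub].
split.
- by case: Pn.
- by move=> a b Pa Pb; apply: (powers_abelian nf Tbij MN0).
- exact: PL.
- by move=> K c F F'; exact: avg_lin.
- by move=> K F sK F0; apply: avg_ge0 => g; apply: F0; exact: lpart_in.
- move=> K F a sK Pa FK; have MK := scales_M0 sK.
  rewrite -[RHS](avg_mull (M0_normal MK) (Crep MK) a); last exact: scales_periodic.
  congr (_ * _); apply: eq_bigr => g _.
  by rewrite /= lpart_mull// (powers_abelian nf Tbij MN0)//; exact: lpart_in.
- move=> K sK; have MK := scales_M0 sK.
  (* The lattice part of [c0] is trivial, so that of the representative [c1] of its coset is a
     period; this one term makes the mean positive. *)
  pose c0 := crep 1%g; pose c1 := rep (powers T K) (C K) c0.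
  have [c1C c1P] := repP (Crep MK) c0.
  have [[P1 PM PV] _] := M0_normal MK.
  rewrite mulr_gt0// ?invr_gt0 ?ltr0n.
    by rewrite cardfE; apply/card_gt0P; exists (FSetSub c1C).
  rewrite (bigD1_seq c1) ?fset_uniq//= ltr_pwDl//; last by apply: sumr_ge0.
  have -> : c1 = (c0 * (c1^-1 * c0)^-1)%g by rewrite invgM invgK mulgA mulgV mul1g.
  have [k' Pk' ->] := lpart_periodic c0 (scales_sub sK) MK (PV _ c1P).
  rewrite /lpart crep_C ?mulgV ?mul1g; last exact: crep_in.
  by case: asboolP.
- move=> s; have [k [k0 kP]] := powers_separated nf Tbij s MN0.
  by exists (N0 * k)%N => //; exists k.
Qed.

End GroupAverages.

(** * Frechet derivatives *)

(** A bridge from the epsilon-delta derivatives used here to the mean value theorem for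
    [is_derive]. *)
Lemma mean_value (R : realType) (f df : R -> R) (a b : R) : a < b ->
  (forall x eps, 0 < eps -> exists2 del, 0 < del &
    forall h, `|h| < del -> `|f (x + h) - f x - df x * h| <= eps * `|h|) ->
  exists c, [/\ a < c, c < b & f b - f a = df c * (b - a)].
Proof.
move=> ab fd.
have cv x : (fun h => h^-1 *: ((f \o shift x) (h *: 1) - f x)) @ 0^' --> df x.
  apply/cvgrPdist_le => eps eps0; have [del del0 H] := fd x eps eps0.
  near=> h; have h0 : h != 0 by near: h; exact: nbhs_dnbhs_neq.
  have hd : `|h| < del by near: h; exact: dnbhs0_lt.
  rewrite -(ler_pM2r (_ : 0 < `|h|)) ?normr_gt0// -normrM.
  apply: le_trans (H h hd); rewrite -normrN le_eqVlt; apply/orP; left; apply/eqP.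
  by congr (`| _ |); rewrite /= /GRing.scale/= mulr1 (addrC h); field.
have isd (x : R) : is_derive x (1 : R) f (df x).
  by apply: DeriveDef; [apply/cvg_ex; exists (df x); exact: cv | apply/cvg_lim => //; exact: cv].
have cont : {within `[a, b], continuous f}.
  by apply: derivable_within_continuous => x _; have [] := isd x.
have [c cab e] := MVT ab (fun x _ => isd x) cont.
by exists c; move: cab; rewrite in_itv/= => /andP[].
Unshelve. all: by end_near. Qed.

(** A supremum norm behaves as a norm only on bounded functions, so the calculus is developed
    relative to a subspace; the instances are [Linfty] and the periodic functions. *)
Record seminormed (R : realType) (X : lmodType R) (nrm : X -> R) (W : set X) : Prop := {
  sn0 : W 0 ;
  snlin : forall a u v, W u -> W v -> W (a *: u + v) ;
  sn_ge0 : forall u, W u -> 0 <= nrm u ;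
  snZ : forall a u, W u -> nrm (a *: u) = `|a| * nrm u ;
  snD : forall u v, W u -> W v -> nrm (u + v) <= nrm u + nrm v }.

Section FrechetTheory.
Context {R : realType} {X : lmodType R} {nrm : X -> R} {W : set X}.
Hypothesis sn : seminormed nrm W.
Implicit Types (F A : X -> R) (B : X -> X -> R).

Lemma seminormed_scale a u : W u -> W (a *: u).
Proof. by move=> Wu; rewrite -[_ *: _]addr0; apply: (snlin sn) => //; exact: (sn0 sn). Qed.

Lemma seminormed_add u v : W u -> W v -> W (u + v).
Proof. by move=> Wu Wv; rewrite -[u]scale1r; exact: (snlin sn). Qed.

Lemma linear_on0 A : linear_on W A -> A 0 = 0.
Proof.
move=> /(_ 1 0 0 (sn0 sn) (sn0 sn)); rewrite scaler0 addr0 mul1r => /eqP.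
by rewrite -subr_eq subrr => /eqP.
Qed.

Lemma linear_onZ A a u : linear_on W A -> W u -> A (a *: u) = a * A u.
Proof.
move=> lA Wu; rewrite -[a *: u]addr0 lA//; last exact: (sn0 sn).
by rewrite (linear_on0 lA) addr0.
Qed.

Lemma linear_onD A u v : linear_on W A -> W u -> W v -> A (u + v) = A u + A v.
Proof. by move=> lA Wu Wv; rewrite -[u]scale1r lA// mul1r scale1r. Qed.

Lemma small_scaling (h : X) (del : R) : W h -> 0 < del ->
  exists2 t : R, 0 < t & forall s, 0 <= s <= t -> nrm (s *: h) < del.
Proof.
move=> Wh del0; have h0 := sn_ge0 sn Wh.
exists (del / (2 * (nrm h + 1))); first by rewrite divr_gt0// mulr_gt0// ltr_wpDl.
move=> s /andP[s0 st]; rewrite (snZ sn)// ger0_norm//.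
have p : 0 < 2 * (nrm h + 1) by rewrite mulr_gt0// ltr_wpDl.
move: st; rewrite ler_pdivlMr// => st; nra.
Qed.

Lemma eq_of_le_eps (x y C : R) : (forall eps, 0 < eps -> `|x - y| <= eps * C) -> x = y.
Proof.
move=> H; apply/eqP; rewrite -subr_eq0 -normr_le0 -oppr_ge0.
apply: (@ge0_limit _ _ C) => eps eps0; have := H eps eps0; lra.
Qed.

Lemma derivative1_unique F x A A' u : is_derivative1 nrm W F x A ->
  is_derivative1 nrm W F x A' -> W u -> A u = A' u.
Proof.
move=> [[lA _] dA] [[lA' _] dA'] Wu; apply: (@eq_of_le_eps _ _ (2 * nrm u)) => eps e0.
have [d d0 H] := dA eps e0; have [d' d'0 H'] := dA' eps e0.
have dd : 0 < Num.min d d' by rewrite lt_min d0.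
have [t t0 ht] := small_scaling Wu dd.
have := ht t; rewrite lexx ltW// lt_min => /(_ isT)/andP[n1 n2].
have Wt := seminormed_scale t Wu.
have := H _ Wt n1; have := H' _ Wt n2; rewrite (linear_onZ t lA Wu) (linear_onZ t lA' Wu).
rewrite (snZ sn)// (gtr0_norm t0) => h1 h2.
rewrite -(ler_pM2l t0) -[X in X * `|_|](gtr0_norm t0) -normrM.
have -> : t * (A u - A' u) = (F (x + t *: u) - F x - t * A' u) - (F (x + t *:
  u) - F x - t * A u) by ring.
rewrite (le_trans (ler_normB _ _))// (le_trans (lerD h1 h2))//; lra.
Qed.

Lemma derivative1P F x : (exists A, is_derivative1 nrm W F x A) ->
  is_derivative1 nrm W F x (derivative1 nrm W F x).
Proof. by move=> H; exact: (xgetPex (fun=> 0) (P := [set A | is_derivative1 nrm W F x A])). Qed.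

Lemma derivative1E F x A u : is_derivative1 nrm W F x A -> W u ->
  derivative1 nrm W F x u = A u.
Proof.
move=> dA; apply: derivative1_unique (dA).
by apply: derivative1P; exists A.
Qed.

Lemma derivative2_unique F x B B' u v : is_derivative2 nrm W F x B ->
  is_derivative2 nrm W F x B' -> W u -> W v -> B u v = B' u v.
Proof.
move=> [[_ lB _] dB] [[_ lB' _] dB'] Wu Wv.
apply: (@eq_of_le_eps _ _ (2 * nrm u * nrm v)) => eps e0.
have [d d0 H] := dB eps e0; have [d' d'0 H'] := dB' eps e0.
have dd : 0 < Num.min d d' by rewrite lt_min d0.
have [t t0 ht] := small_scaling Wu dd.
have := ht t; rewrite lexx ltW// lt_min => /(_ isT)/andP[n1 n2].
have Wt := seminormed_scale t Wu.
have := H _ Wt n1 _ Wv; have := H' _ Wt n2 _ Wv.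
rewrite (linear_onZ t (lB _ Wv) Wu) (linear_onZ t (lB' _ Wv) Wu).
rewrite (snZ sn)// (gtr0_norm t0); set D := _ - derivative1 _ _ _ _ _ => h1 h2.
rewrite -(ler_pM2l t0) -[X in X * `|_|](gtr0_norm t0) -normrM.
have -> : t * (B u v - B' u v) = (D - t * B' u v) - (D - t * B u v) by ring.
rewrite (le_trans (ler_normB _ _))// (le_trans (lerD h1 h2))//; lra.
Qed.

Lemma derivative2P F x : (exists B, is_derivative2 nrm W F x B) ->
  is_derivative2 nrm W F x (derivative2 nrm W F x).
Proof. by move=> H; exact: (xgetPex (fun _ _ =>
  0) (P := [set B | is_derivative2 nrm W F x B])). Qed.

Lemma derivative2E F x B u v : is_derivative2 nrm W F x B -> W u -> W v ->
  derivative2 nrm W F x u v = B u v.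
Proof.
move=> dB; apply: derivative2_unique (dB).
by apply: derivative2P; exists B.
Qed.

(* The second difference [F (x + th + tk) - F (x + th) - F (x + tk) + F x] is
   symmetric in [h] and [k]. *)
Lemma derivative2_sym F x B : W x ->
  (forall y, W y -> exists A, is_derivative1 nrm W F y A) ->
  is_derivative2 nrm W F x B -> forall h k, W h -> W k -> B h k = B k h.
Proof.
move=> Wx dF [[_ lB _] dB].
pose D y := derivative1 nrm W F y.
have DP y : W y -> is_derivative1 nrm W F y (D y) by move=> /dF /derivative1P.
(* The mean value theorem is applied on [[0, t]] to [phi], the increment of [F] along [t *: k];
   expanding its derivative at the intermediate point gives [t ^+ 2 * B k h]. Exchanging [h] and [k]
   then compares the two values of [B]. *)
have half h k eps : W h -> W k -> 0 < eps -> exists2 t0, 0 < t0 & forall t, 0 < t <= t0 ->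
    `|F (x + t *: h + t *: k) - F (x + t *: h) - F (x + t *: k) + F x - t ^+ 2 * B k h|
      <= t ^+ 2 * (eps * ((2 * nrm h + nrm k) * nrm h)).
  move=> Wh Wk e0; have [d d0 H] := dB eps e0.
  have h0 := sn_ge0 sn Wh; have k0 := sn_ge0 sn Wk.
  have d2 : 0 < d / 2 by rewrite divr_gt0.
  have [t1 t10 H1] := small_scaling Wh d2; have [t2 t20 H2] := small_scaling Wk d2.
  exists (Num.min t1 t2); first by rewrite lt_min t10.
  move=> t /andP[t0]; rewrite le_min => /andP[tt1 tt2].
  pose phi s := F (x + t *: k + s *: h) - F (x + s *: h).
  pose dphi s := D (x + t *: k + s *: h) h - D (x + s *: h) h.
  have line y : W y -> forall s e, 0 < e -> exists2 del, 0 < del & forall r : R, `|r| < del ->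
      `|F (y + (s + r) *: h) - F (y + s *: h) - D (y + s *: h) h * r| <= e * `|r|.
    move=> Wy s e e0'; have Wys : W (y + s *: h) by apply: seminormed_add => //;
      exact: seminormed_scale.
    have [[lD _] dD] := DP _ Wys.
    have e1 : 0 < e / (nrm h + 1) by rewrite divr_gt0// ltr_wpDl.
    have [del del0 Hd] := dD _ e1; exists (del / (nrm h + 1)); first by rewrite divr_gt0// ltr_wpDl.
    move=> r; rewrite ltr_pdivlMr ?ltr_wpDl// => rd; have r0 := normr_ge0 r.
    have nr : nrm (r *: h) < del by rewrite (snZ sn)//; nra.
    have := Hd _ (seminormed_scale r Wh) nr.
    rewrite (linear_onZ _ lD Wh) scalerDl addrA mulrC => /le_trans; apply.
    rewrite (snZ sn)// [leRHS]mulrC mulrA (mulrC _ `|r|) -mulrA ler_wpM2l//.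
    by rewrite mulrAC ler_pdivrMr ?ltr_wpDl//; nra.
  have Wtk : W (t *: k) by exact: seminormed_scale.
  have [s e|c [c0 ct e]] := @mean_value R phi dphi 0 t t0 _.
    move=> e0'; have e2 : 0 < e / 2 by rewrite divr_gt0.
    have [r1 r10 L1] := line _ (seminormed_add Wx Wtk) s _ e2; have [r2 r20 L2] := line _ Wx s _ e2.
    exists (Num.min r1 r2); first by rewrite lt_min r10.
    move=> r; rewrite lt_min => /andP[rr1 rr2].
    rewrite /phi /dphi; have := L1 r rr1; have := L2 r rr2.
    set a := F _; set b := F _; set c := D _ h; set a' := F _; set b' := F _; set c' := D _ h.
    move=> h1 h2; rewrite (_ : _ - _ - _ = (a' - b' - c' * r) - (a - b - c * r)); last by ring.
    rewrite (le_trans (ler_normB _ _))//; lra.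
  have Wch : W (c *: h) by exact: seminormed_scale.
  have n1 : nrm (c *: h) < d.
    have : nrm (c *: h) < d / 2 by apply: H1; rewrite (ltW c0) (le_trans (ltW ct)).
    lra.
  have n2 : nrm (t *: k + c *: h) < d.
    have : nrm (c *: h) < d / 2 by apply: H1; rewrite (ltW c0) (le_trans (ltW ct)).
    have : nrm (t *: k) < d / 2 by apply: H2; rewrite (ltW t0).
    have := snD sn Wtk Wch; lra.
  have := H _ Wch n1 _ Wh; have := H _ (seminormed_add Wtk Wch) n2 _ Wh.
  rewrite (linear_onD (lB _ Wh) Wtk Wch) (linear_onZ _ (lB _ Wh) Wk) addrA => h1 h2.
  have -> : F (x + t *: h + t *: k) - F (x + t *: h) - F (x + t *: k) + F x = dphi c * t.
    by move: e; rewrite /phi scale0r !addr0 subr0 (addrAC x (t *: h)) => <-; ring.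
  have t20' : 0 <= t ^+ 2 by rewrite sqr_ge0.
  have -> : dphi c * t - t ^+ 2 * B k h = (dphi c - t * B k h) * t by ring.
  rewrite normrM (gtr0_norm t0) mulrC expr2 -mulrA ler_pM2l//.
  have h3 : `|dphi c - t * B k h| <= eps * nrm (t *: k + c *: h) * nrm h + eps * nrm (c *:
    h) * nrm h.
    apply: le_trans (lerD h1 h2); rewrite /dphi -/D.
    apply: le_trans (ler_normB _ _); rewrite le_eqVlt; apply/orP; left; apply/eqP.
    by congr (`| _ |); rewrite /D; ring.
  apply: (le_trans h3); have := snD sn Wtk Wch;
    rewrite !(snZ sn)// (gtr0_norm t0) (gtr0_norm c0) => h4.
  rewrite -mulrA -(mulrA eps (c * _)) -mulrDr mulrCA ler_pM2l// -mulrDl.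
  rewrite mulrA ler_wpM2r// mulrDr.
  have : c * nrm h <= t * nrm h by rewrite ler_wpM2r// ltW.
  lra.
move=> h k Wh Wk.
apply: (@eq_of_le_eps _ _ ((2 * nrm k + nrm h) * nrm k + (2 * nrm h + nrm k) * nrm h)) => eps e0.
have [s s0 Hs] := half h k eps Wh Wk e0; have [r r0 Hr] := half k h eps Wk Wh e0.
pose t := Num.min s r; have t0 : 0 < t by rewrite lt_min s0.
have := Hs t; rewrite t0 ge_min lexx => /(_ isT) h1.
have := Hr t; rewrite t0 ge_min lexx orbT => /(_ isT) h2.
have t2 : 0 < t ^+ 2 by rewrite exprn_gt0.
rewrite -(ler_pM2l t2) -[X in X * `|_|](gtr0_norm t2) -normrM.
move: h1 h2; rewrite (addrAC x (t *: k)); set a := F _; set b := F _; set c := F _ => h1 h2.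
have -> : t ^+ 2 * (B h k - B k h) =
  (a - b - c + F x - t ^+ 2 * B k h) - (a - c - b + F x - t ^+ 2 * B h k) by ring.
rewrite (le_trans (ler_normB _ _))// (le_trans (lerD h1 h2))// -!mulrDr addrC.
by [].
Qed.

End FrechetTheory.

(** * Rotation invariance *)

Section FNorm.
Context {R : realType}.

Lemma fnormE m n (A : 'M[R]_(m, n)) : fnorm A = Num.sqrt (nsq A). Proof. by []. Qed.

Lemma fnorm_ge0 m n (A : 'M[R]_(m, n)) : 0 <= fnorm A.
Proof. by rewrite fnormE sqrtr_ge0. Qed.

Lemma sqr_fnorm m n (A : 'M[R]_(m, n)) : fnorm A ^+ 2 = nsq A.
Proof. by rewrite fnormE sqr_sqrtr// nsq_ge0. Qed.

Lemma fnorm0 m n : fnorm (0 : 'M[R]_(m, n)) = 0.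
Proof. by rewrite fnormE nsq0 sqrtr0. Qed.

Lemma fnormZ m n c (A : 'M[R]_(m, n)) : fnorm (c *: A) = `|c| * fnorm A.
Proof. by rewrite !fnormE nsqZ sqrtrM ?sqr_ge0// sqrtr_sqr. Qed.

Lemma fnormM m n p (A : 'M[R]_(m, n)) (B : 'M[R]_(n, p)) :
  fnorm (A *m B) <= fnorm A * fnorm B.
Proof. by rewrite !fnormE -sqrtrM ?nsq_ge0// ler_wsqrtr// nsqM_le. Qed.

Lemma fnorm_orth m n (O : 'M[R]_m) (A : 'M[R]_(m, n)) : O^T *m O = 1%:M ->
  fnorm (O *m A) = fnorm A.
Proof. by move=> OO; rewrite !fnormE nsq_orthl. Qed.

Lemma fnormD m n (A B : 'M[R]_(m, n)) : fnorm (A + B) <= fnorm A + fnorm B.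
Proof.
rewrite -(ler_pXn2r (_ : 0 < 2)%N) ?nnegrE ?addr_ge0 ?fnorm_ge0//.
rewrite sqrrD !sqr_fnorm.
pose c := \sum_(ij : 'I_m * 'I_n) A ij.1 ij.2 * B ij.1 ij.2.
have c2 : c ^+ 2 <= nsq A * nsq B.
  by apply: le_trans (cauchy_sum _ _) _; rewrite /nsq !pair_bigA.
have -> : nsq (A + B) = nsq A + c *+ 2 + nsq B.
  rewrite /nsq /c !pair_bigA -mulr_natl mulr_sumr -!big_split; apply: eq_bigr => ij _ /=.
  by rewrite mxE; ring.
rewrite lerD2r lerD2l lerMn2r/=; apply: le_trans (ler_norm c) _.
rewrite -(ler_pXn2r (_ : 0 < 2)%N) ?nnegrE ?mulr_ge0 ?fnorm_ge0//.
by rewrite real_normK ?num_real// exprMn !sqr_fnorm.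
Qed.

Lemma fnorm_sum (J : Type) (r : seq J) m n (A : J -> 'M[R]_(m, n)) :
  fnorm (\sum_(j <- r) A j) <= \sum_(j <- r) fnorm (A j).
Proof.
elim: r => [|j r IH]; first by rewrite !big_nil fnorm0.
by rewrite !big_cons (le_trans (fnormD _ _))// lerD2l.
Qed.

Context {n : nat} {I : Type}.
Implicit Types z y : I -> 'cV[R]_n.

Lemma fnorm_le_supnorm z i : Linfty z -> fnorm (z i) <= supnorm z.
Proof. by move=> [M zM]; apply: ub_le_sup; [exists M => _ [j _ <-] | exists i]. Qed.

Lemma supnorm_le z M : 0 <= M -> (forall i, fnorm (z i) <= M) -> supnorm z <= M.
Proof.
move=> M0 zM; have [[i]|I0] := pselect (inhabited I).
  by apply: ge_sup; [exists (fnorm (z i)); exists i | move=> _ [j _ <-]].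
(* An empty index type gives the supremum of the empty set, which is 0. *)
rewrite /supnorm (_ : [set _ | _ in _] = set0) ?sup0//.
by apply/seteqP; split => // x [i _ _]; apply: I0.
Qed.

Lemma supnorm_ge0 z : 0 <= supnorm z.
Proof.
have [[i]|I0] := pselect (inhabited I); last first.
  rewrite /supnorm (_ : [set _ | _ in _] = set0) ?sup0//.
  by apply/seteqP; split => // x [i _ _]; apply: I0.
have [h|h] := pselect (has_ubound [set fnorm (z i) | i in [set: I]]).
  by apply: le_trans (fnorm_ge0 (z i)) _; apply: ub_le_sup => //; exists i.
by rewrite /supnorm sup_out// => -[].
Qed.

Lemma Linfty_seminormed : seminormed (@supnorm R n I) (@Linfty R n I).
Proof.
have Z (a : R) (u : I -> 'cV[R]_n) : Linfty u -> Linfty (a *: u).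
  by move=> [M uM]; exists (`|a| * M) => i; rewrite fnormZ ler_wpM2l.
have Dd (u v : I -> 'cV[R]_n) : Linfty u -> Linfty v -> Linfty (u + v).
  by move=> [M uM] [N vN]; exists (M + N) => i; rewrite (le_trans (fnormD _ _))// lerD.
have Zle (a : R) (u : I -> 'cV[R]_n) : Linfty u -> supnorm (a *: u) <= `|a| * supnorm u.
  move=> Lu; apply: supnorm_le => [|i]; first by rewrite mulr_ge0// supnorm_ge0.
  by rewrite fnormZ ler_wpM2l// fnorm_le_supnorm.
split.
- by exists 0 => i; rewrite fnorm0.
- by move=> a u v Lu Lv; apply: Dd => //; exact: Z.
- by move=> u _; exact: supnorm_ge0.
- move=> a u Lu; apply/eqP; rewrite eq_le Zle//=.
  have [->|a0] := eqVneq a 0; first by rewrite normr0 mul0r supnorm_ge0.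
  have := Zle a^-1 _ (Z a _ Lu); rewrite scalerA mulVf// scale1r normfV.
  by rewrite ler_pdivlMl// normr_gt0.
- move=> u v Lu Lv; apply: supnorm_le => [|i]; first by rewrite addr_ge0 ?supnorm_ge0.
  by rewrite (le_trans (fnormD _ _))// lerD// fnorm_le_supnorm.
Qed.

Definition mulmxf (S : 'M[R]_n) z : I -> 'cV[R]_n := fun h => S *m z h.

Lemma mulmxf_Linfty S z : Linfty z -> Linfty (mulmxf S z).
Proof.
move=> [M zM]; exists (fnorm S * M) => i.
by rewrite (le_trans (fnormM _ _))// ler_wpM2l// fnorm_ge0.
Qed.

Lemma supnorm_mulmxf S z : Linfty z -> supnorm (mulmxf S z) <= fnorm S * supnorm z.
Proof.
move=> Lz; apply: supnorm_le => [|i]; first by rewrite mulr_ge0 ?supnorm_ge0 ?fnorm_ge0.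
by rewrite (le_trans (fnormM _ _))// ler_wpM2l ?fnorm_ge0// fnorm_le_supnorm.
Qed.

Lemma supnorm_orth (O : 'M[R]_n) z : O^T *m O = 1%:M -> supnorm (mulmxf O z) = supnorm z.
Proof.
move=> OO; congr (sup _); apply/seteqP.
by split => _ [i _ <-]; exists i => //; rewrite /mulmxf fnorm_orth.
Qed.

Lemma mulmxfD S S' z : mulmxf (S + S') z = mulmxf S z + mulmxf S' z.
Proof. by apply/funext => h; rewrite /mulmxf mulmxDl. Qed.

Lemma mulmxfZ c S z : mulmxf (c *: S) z = c *: mulmxf S z.
Proof. by apply/funext => h; rewrite /mulmxf -scalemxAl. Qed.

Lemma mulmxf1 z : mulmxf 1%:M z = z.
Proof. by apply/funext => h; rewrite /mulmxf mul1mx. Qed.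

End FNorm.

(* The Cayley transform [(1 - tS)^-1 (1 + tS)] of a skew matrix. *)
Lemma cayley (R : realType) n (S : 'M[R]_n) (t : R) : S^T = - S ->
  exists O E : 'M[R]_n, [/\ O^T *m O = 1%:M, O = 1%:M + (2 * t) *: S + t ^+ 2 *: E
    & fnorm E <= 2 * fnorm (S *m S)].
Proof.
move=> SS; pose Pt (r : R) := 1%:M - r *: S.
(* Skewness removes the linear term: [|(1 - r S) B|^2 = |B|^2 + r^2 |S B|^2]. This yields both the
   invertibility of [P] and the contraction by its inverse. *)
have nP r m (B : 'M_(n, m)) : nsq B <= nsq (Pt r *m B).
  rewrite !nsqE trmx_mul /Pt linearB/= linearZ/= trmx1 SS scalerN opprK.
  rewrite mulmxA -(mulmxA B^T).
  have -> : (1%:M + r *: S) *m (1%:M - r *: S) = 1%:M + r ^+ 2 *: (S^T *m S).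
    rewrite mulmxBr !mulmxDl !mul1mx mulmx1 SS mulNmx scalerN -scalemxAl -scalemxAr scalerA -expr2.
    by rewrite opprD addrA addrK.
  rewrite mulmxDr mulmx1 mulmxDl linearD/= lerDl -scalemxAr -scalemxAl linearZ/=.
  by rewrite mulr_ge0 ?sqr_ge0// mulmxA -trmx_mul -mulmxA -nsqE nsq_ge0.
pose P := Pt t; pose Q := Pt (- t).
have PT : P^T = Q by rewrite /P /Q /Pt linearB/= linearZ/= trmx1 SS scalerN scaleNr.
have QT : Q^T = P by rewrite -PT trmxK.
have QE : Q = 1%:M + t *: S by rewrite /Q /Pt scaleNr opprK.
have PQ : P *m Q = Q *m P.
  rewrite QE /P /Pt !(mulmxBl, mulmxBr, mulmxDl, mulmxDr) !mul1mx !mulmx1.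
  by rewrite mulNmx mulmxN.
have Qu : Q \in unitmx.
  rewrite -row_free_unit -kermx_eq0; apply/eqP/trmx_inj; rewrite trmx0; apply: nsq_eq0.
  apply/eqP; rewrite eq_le nsq_ge0 andbT; apply: le_trans (nP t _ _) _.
  by rewrite -/P -QT -trmx_mul mulmx_ker trmx0 nsq0.
have Pu : P \in unitmx by rewrite -QT unitmx_tr.
(* Using [P^-1 = 1 + t S P^-1] twice, [Q P^-1 = 1 + 2 t S + 2 t^2 S^2 P^-1]. *)
exists (Q *m invmx P), (2 *: (S *m S *m invmx P)).
have PiE : invmx P = 1%:M + t *: (S *m invmx P).
  by rewrite -{1}(mulmxV Pu) {1}/P /Pt mulmxBl mul1mx -scalemxAl subrK.
split.
- rewrite trmx_mul QT trmx_inv PT mulmxA -(mulmxA (invmx Q)) PQ mulmxA.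
  by rewrite mulVmx// mul1mx mulmxV.
- rewrite {1}QE mulmxDl mul1mx -scalemxAl {1}PiE -addrA -scalerDr.
  rewrite -mulr2n -scaler_nat scalerA mulrC {1}PiE mulmxDr mulmx1 -scalemxAr scalerDr.
  by rewrite mulmxA !scalerA addrA; congr (_ + _ *: _); ring.
- rewrite fnormZ ger0_norm// ler_pM2l// !fnormE ler_wsqrtr// -nsq_tr -[leRHS]nsq_tr.
  apply: le_trans (nP (- t) _ _) _; rewrite -/Q -PT -trmx_mul mulmxKV//.
Qed.

Section Rotation.
Context {R : realType} {n : nat} {I : Type} (V : (I -> 'cV[R]_n) -> R).
Local Notation nI := (@supnorm R n I).
Local Notation LI := (@Linfty R n I).
Hypothesis VO : forall (A : orth R n) y, V (fun h => A *m y h) = V y.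
Hypothesis V1 : forall y, LI y -> exists A, is_derivative1 nI LI V y A.
Hypothesis V2 : forall y, LI y -> exists B, is_derivative2 nI LI V y B.

Let sn := @Linfty_seminormed R n I.

Lemma derivative1_orth (O : 'M[R]_n) x z : O^T *m O = 1%:M -> LI x -> LI z ->
  derivative1 nI LI V (mulmxf O x) (mulmxf O z) = derivative1 nI LI V x z.
Proof.
move=> OO Lx Lz; have VO' y : V (mulmxf O y) = V y.
  by have OP : O^T *m O == 1%:M by [apply/eqP]; exact: (VO (Orth OP)).
have [lD [[C CP] dD]] : let D := derivative1 nI LI V (mulmxf O x) in
    linear_on LI D /\ (exists C, forall u, LI u -> `|D u| <= C * nI u) /\
  forall eps, 0 < eps -> exists2 del, 0 < del &
    forall h, LI h -> nI h < del -> `|V (mulmxf O x + h) - V (mulmxf O x) - D h| <= eps * nI h.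
  have [[h1 h2] h3] := derivative1P (V1 (mulmxf_Linfty O Lx)).
  by split.
apply/esym; apply: (derivative1E sn (A := fun z =>
  derivative1 nI LI V (mulmxf O x) (mulmxf O z))) Lz.
have addO u v : mulmxf O (u + v) = mulmxf O u + mulmxf O v.
  by apply/funext => h; rewrite /mulmxf mulmxDr.
split; first split.
- move=> a u v Lu Lv; have -> : mulmxf O (a *: u + v) = a *: mulmxf O u + mulmxf O v.
    by rewrite addO; congr (_ + _); apply/funext => h; exact/esym/scalemxAr.
  by rewrite lD//; exact: mulmxf_Linfty.
- exists C => u Lu; rewrite -(supnorm_orth u OO); apply: CP; exact: mulmxf_Linfty.
move=> eps e0; have [del del0 H] := dD eps e0; exists del => // h Lh hd.
rewrite -(VO' (x + h)) -(VO' x) addO -(supnorm_orth h OO); apply: H; first exact: mulmxf_Linfty.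
by rewrite supnorm_orth.
Qed.

(** The identity [V'(O x)(O z) = V'(x)(z)] is differentiated along a curve of rotations leaving the
    identity in direction [S]. The Cayley curve is convenient because its quadratic remainder is
    explicit; dividing by its speed [2 * t] leaves the claim. *)
Lemma derivative2_rotation (S : 'M[R]_n) x z : S^T = - S -> LI x -> LI z ->
  derivative2 nI LI V x (mulmxf S x) z = - derivative1 nI LI V x (mulmxf S z).
Proof.
move=> SS Lx Lz; pose D := derivative1 nI LI V x; pose H := derivative2 nI LI V x.
have [[lH lH' [C2 C20 bH]] dH] := derivative2P (V2 Lx).
rewrite -/H in lH lH' bH dH.
have [[lD [C1 bD]] _] := derivative1P (V1 Lx); rewrite -/D in lD bD.
pose c := 2 * fnorm (S *m S); pose X := nI x; pose Z := nI z; pose s := fnorm S.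
have [X0 Z0 s0 c0] : [/\ 0 <= X, 0 <= Z, 0 <= s & 0 <= c].
  by split; rewrite /c ?mulr_ge0 ?supnorm_ge0 ?fnorm_ge0.
have C10 u : LI u -> 0 <= C1 * nI u by move=> Lu; apply: le_trans (bD _ Lu).
(* [M] collects the coefficients of all terms of second order in [t]; since [t <= eps], they
   contribute at most [t * (eps * M)]. *)
pose M := `|C1| * c * Z + C2 * c * X * Z + 2 * C2 * (s * X) * ((2 * s + c) * Z).
have C20' : 0 <= C2 by exact: ltW.
have M0 : 0 <= M by rewrite /M; repeat (done || apply: addr_ge0 || apply: mulr_ge0).
apply: (@eq_of_le_eps _ _ _ (((2 * s + c) * X * Z + M) / 2)) => eps e0.
have [del del0 Hd] := dH eps e0.
pose t := Num.min 1 (Num.min eps (del / (2 * ((2 * s + c) * X + 1)))).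
have q0 : 0 < (2 * s + c) * X + 1 by rewrite ltr_wpDl// mulr_ge0// addr_ge0// mulr_ge0.
have t0 : 0 < t by rewrite !lt_min ltr01 e0 divr_gt0// mulr_gt0.
have t1 : t <= 1 by rewrite ge_min lexx.
have te : t <= eps by rewrite !ge_min lexx orbT.
have td : t * (2 * ((2 * s + c) * X + 1)) <= del.
  by rewrite -ler_pdivlMr ?mulr_gt0// !ge_min lexx !orbT.
have [O [E [OO OE nE]]] := cayley t SS.
have mE y : LI y -> nI (mulmxf E y) <= c * nI y.
  by move=> Ly; apply: le_trans (supnorm_mulmxf _ Ly) _; rewrite ler_wpM2r ?supnorm_ge0.
have mS y : LI y -> nI (mulmxf S y) <= s * nI y by exact: supnorm_mulmxf.
have OyE (y : I -> 'cV[R]_n) : mulmxf O y = y + ((2 * t) *: mulmxf S y + t ^+ 2 *: mulmxf E y).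
  by rewrite OE !mulmxfD !mulmxfZ mulmxf1 addrA.
pose dl (y : I -> 'cV[R]_n) : I -> 'cV[R]_n := (2 * t) *: mulmxf S y + t ^+ 2 *: mulmxf E y.
have LS y : LI y -> LI (mulmxf S y) by exact: mulmxf_Linfty.
have LE y : LI y -> LI (mulmxf E y) by exact: mulmxf_Linfty.
have Ldl y : LI y -> LI (dl y).
  by move=> Ly; apply: (snlin sn); [exact: LS | apply: (seminormed_scale sn); exact: LE].
have ndl y : LI y -> nI (dl y) <= t * ((2 * s + c) * nI y).
  move=> Ly; have y0 : 0 <= nI y by exact: supnorm_ge0.
  apply: le_trans (snD sn _ _) _; try by apply: (seminormed_scale sn); auto.
  rewrite !(snZ sn); [|exact: LE | exact: LS].
  rewrite (ger0_norm (sqr_ge0 t)) gtr0_norm ?mulr_gt0//.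
  have tt : t ^+ 2 <= t by rewrite expr2 ler_piMr// ltW.
  have := ler_wpM2l (ltW t0) (mS y Ly); have := ler_wpM2l (sqr_ge0 t) (mE y Ly).
  have := ler_wpM2r (mulr_ge0 c0 y0) tt; lra.
have Hx : nI (dl x) < del.
  apply: le_lt_trans (ndl x Lx) _; apply: lt_le_trans td.
  by rewrite ltr_pM2l// -/X; lra.
have LOz : LI (mulmxf O z) by exact: mulmxf_Linfty.
have := Hd (dl x) (Ldl x Lx) Hx _ LOz.
rewrite -OyE derivative1_orth// -/D supnorm_orth// -/Z => main.
have DO : D (mulmxf O z) = D z + ((2 * t) * D (mulmxf S z) + t ^+ 2 * D (mulmxf E z)).
  rewrite OyE (linear_onD lD Lz (Ldl z Lz)) lD; [|exact: LS|].
    by rewrite (linear_onZ sn _ lD (LE z Lz)).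
  by apply: (seminormed_scale sn); exact: LE.
have HO u : LI u -> H u (mulmxf O z) = H u z + H u (dl z).
  by move=> Lu; rewrite OyE (linear_onD (lH _ Lu) Lz (Ldl z Lz)).
have Hdl y : LI y -> H (dl x) y = (2 * t) * H (mulmxf S x) y + t ^+ 2 * H (mulmxf E x) y.
  move=> Ly; rewrite (lH' _ Ly); [|exact: LS|].
    by rewrite (linear_onZ sn _ (lH' _ Ly) (LE x Lx)).
  by apply: (seminormed_scale sn); exact: LE.
move: main; rewrite DO Hdl// (HO _ (LS x Lx)).
set a := D (mulmxf S z); set b := H (mulmxf S x) z => main.
have r1 : `|D (mulmxf E z)| <= `|C1| * c * Z.
  apply: le_trans (bD _ (LE z Lz)) _; rewrite -mulrA.
  apply: le_trans (_ : _ <= `|C1| * nI (mulmxf E z)) _.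
    by rewrite ler_wpM2r ?supnorm_ge0// ler_norm.
  by rewrite ler_wpM2l// mE.
have r2 : `|H (mulmxf E x) (mulmxf O z)| <= C2 * c * X * Z.
  apply: le_trans (bH _ _ (LE x Lx) LOz) _; rewrite (supnorm_orth z OO) -/Z.
  apply: ler_wpM2r => //; rewrite -mulrA; apply: ler_wpM2l => //; exact: mE.
have r3 : `|H (mulmxf S x) (dl z)| <= t * (C2 * (s * X) * ((2 * s + c) * Z)).
  apply: le_trans (bH _ _ (LS x Lx) (Ldl z Lz)) _.
  rewrite mulrCA; apply: ler_pM; rewrite ?mulr_ge0 ?supnorm_ge0 ?(ltW C20)//.
    by rewrite ler_pM2l// mS.
  exact: ndl.
have dx := ndl x Lx; rewrite -/X in dx.
have e1 : `|- (2 * t) * (b + a) - t ^+ 2 * (D (mulmxf E z)) - 2 * t * H (mulmxf S x) (dl z)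
   - t ^+ 2 * H (mulmxf E x) (mulmxf O z)| <= eps * (t * ((2 * s + c) * X)) * Z.
  apply: le_trans (_ : _ <= eps * nI (dl x) * Z) _; last by rewrite ler_wpM2r// ler_pM2l.
  apply: le_trans main; rewrite le_eqVlt; apply/orP; left; apply/eqP; congr (`| _ |); ring.
rewrite opprK -(ler_pM2l (_ : 0 < 2 * t)) ?mulr_gt0//.
rewrite -[X in X * `|_|](gtr0_norm (_ : 0 < 2 * t)) ?mulr_gt0// -normrM.
have -> : 2 * t * (b + a) =
  - ((- (2 * t) * (b + a) - t ^+ 2 * (D (mulmxf E z)) - 2 * t * H (mulmxf S x) (dl z)
   - t ^+ 2 * H (mulmxf E x) (mulmxf O z)) + t ^+ 2 * (D (mulmxf E z) +
       H (mulmxf E x) (mulmxf O z)) + 2 * t * H (mulmxf S x) (dl z)).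
  by ring.
rewrite normrN (le_trans (ler_normD _ _))// (le_trans (lerD (ler_normD _ _) (lexx _)))//.
have t20' : 0 < 2 * t by rewrite mulr_gt0.
rewrite (normrM (t ^+ 2)) (normrM (2 * t)) (ger0_norm (sqr_ge0 t)) (gtr0_norm t20').
have r12 : `|D (mulmxf E z) + H (mulmxf E x) (mulmxf O z)| <= `|C1| * c * Z + C2 * c * X * Z.
  by rewrite (le_trans (ler_normD _ _))// lerD.
have t20 : 0 <= t ^+ 2 by exact: sqr_ge0.
have r12' := ler_wpM2l t20 r12.
have r3' := ler_wpM2l (ltW t0) r3.
have tM : t ^+ 2 * M <= t * (eps * M) by rewrite expr2 -mulrA ler_pM2l// ler_wpM2r.
have EM : t ^+ 2 * M =
  t ^+ 2 * (`|C1| * c * Z + C2 * c * X * Z) + 2 * (t * (t * (C2 * (s * X) * ((2 * s + c) * Z)))).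
  by rewrite /M; ring.
have -> : 2 * t * (eps * (((2 * s + c) * X * Z + M) / 2)) =
  eps * (t * ((2 * s + c) * X)) * Z + t * (eps * M).
  by field.
rewrite -addrA; apply: lerD => //; apply: le_trans tM; rewrite EM; apply: lerD => //.
by rewrite -(mulrA 2 t) ler_pM2l.
Qed.

End Rotation.

(** * Derivatives of the energy *)

(** The moduli of differentiability of [V] depend on the configuration; a periodic displacement
    produces finitely many of them, so a minimum serves all. *)
Lemma uniform_on_seq (R : realType) (X : eqType) (s : seq X) (Q : X -> R -> Prop) :
  (forall x, exists2 e, 0 < e & Q x e) ->
  (forall x e e', 0 < e' -> e' <= e -> Q x e -> Q x e') ->
  exists2 e, 0 < e & forall x, x \in s -> Q x e.
Proof.
move=> ex mono; elim: s => [|x s [e e0 IH]]; first by exists 1.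
have [e' e'0 Qx] := ex x; have m0 : 0 < Num.min e e' by rewrite lt_min e0.
exists (Num.min e e') => // y; rewrite inE => /orP[/eqP ->|ys].
  by apply: mono Qx => //; rewrite ge_min lexx orbT.
by apply: mono (IH y ys) => //; rewrite ge_min lexx.
Qed.

Lemma mulr_le_double (R : realDomainType) (p q a b : R) :
  0 <= p -> 0 <= q -> p <= 2 * a -> q <= 2 * b -> p * q <= 4 * (a * b).
Proof. by move=> p0 q0 pa qb; have := ler_pM p0 q0 pa qb; lra. Qed.

Section EnergyDerivatives.
Context {R : realType} {d1 d2 : nat} {S : groupClosed (euclid R d2)}.
Local Notation d := (d1 + d2)%N.
Context {G : groupClosed (euclid R d)} {T : set (elt G)} {C : nat -> {fset elt G}}.
Hypothesis nf : normal_form S G.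
Hypothesis Tbij : set_bij T (translations S) (fun t => dsum_proj (val t)).
Hypothesis Crep : forall N, M0 T N -> representatives (C N) (powers T N).
Context {x0 : 'cV[R]_d} (V : (cosets_star G x0 -> 'cV[R]_d) -> R).
Hypothesis HV : interaction_potential G x0 V.
Hypothesis stab_fin : finite_set (stab G x0).
Context {A : set (cosets_star G x0)} (Afin : finite_set A).
Hypothesis VA : forall y, V y = V (fun h => \1_A h *: y h).

Local Notation I := (cosets_star G x0).
Implicit Types (g k : elt G) (u v w : elt G -> 'cV[R]_d) (z y : I -> 'cV[R]_d).

Definition lv g : 'M[R]_d := lin (val g).

Lemma lvM g h : lv (g * h)%g = lv g *m lv h.
Proof. by rewrite /lv valM. Qed.

Lemma lv_orth g : (lv g)^T *m lv g = 1%:M. Proof. exact: lin_orth. Qed.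

Definition stabs : seq (elt G) := fset_set (stab G x0).

Lemma mem_stabs s : (s \in stabs) = `[< stab G x0 s >].
Proof. by rewrite /stabs in_fset_set// [LHS]inE; apply/asboolP/asboolP. Qed.

Lemma stab_sub : subgroup (stab G x0).
Proof.
split; rewrite /stab/=.
- by rewrite /act mul1mx addr0.
- by move=> g h gx hx; rewrite actM hx.
- by move=> g e; rewrite -{1}e -actM mulVg /act mul1mx addr0.
Qed.

Lemma stabs_gt0 : (0 < size stabs)%N.
Proof.
rewrite -has_predT; apply/hasP; exists 1%g => //; rewrite mem_stabs; apply/asboolP.
by case: stab_sub.
Qed.

Lemma stab_weightE : stab_weight G x0 * (size stabs)%:R = 1.
Proof. by rewrite mulVf// pnatr_eq0 -lt0n stabs_gt0. Qed.

Lemma sum_coset k (F : elt G -> 'cV[R]_d) :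
  \sum_(h \in lcoset_of (stab G x0) k) F h = \sum_(s <- stabs) F (k * s)%g.
Proof.
rewrite /lcoset_of fsbig_image; first by rewrite fsbig_finite.
by move=> s s' _ _; apply: mulgI.
Qed.

Definition krep (h : I) : elt G := xget 1%g [set k | lcoset_of (stab G x0) k = sval h].

Lemma krepP (h : I) : lcoset_of (stab G x0) (krep h) = sval h.
Proof.
have : [set k | lcoset_of (stab G x0) k = sval h] !=set0.
  by have := svalP h; rewrite inE => -[[k _ e] _]; exists k.
by move=> /(xgetPex 1%g).
Qed.

Definition ub u g : 'cV[R]_d := stab_weight G x0 *: \sum_(s <- stabs) lv s *m u (g * s)%g.

(** The change of the relative positions around [g], rotated back to the frame of [g];
    [local_configE] separates off that rotation, which [V] ignores. *)
Definition dq u g : I -> 'cV[R]_d := fun h => lv (krep h) *m ub u (g * krep h)%g - ub u g.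

Definition y0 : I -> 'cV[R]_d := fun h => act (val (krep h)) x0 - x0.

Lemma local_configE u g :
  local_config (x0 := x0) (cst x0 + u) g = fun h => lv g *m (y0 h + dq u g h).
Proof.
have key k : stab_weight G x0 *: (\sum_(h \in lcoset_of (stab G x0) k)
    act (val (g * h)%g) ((cst x0 + u) (g * h)%g)) =
    act (val g) (act (val k) x0) + lv g *m (lv k *m ub u (g * k)%g).
  rewrite sum_coset.
  have actD k' (y : 'cV[R]_d) : act (val k') (x0 + y) = act (val k') x0 + lv k' *m y.
    by rewrite /act mulmxDr addrAC.
  rewrite (eq_big_seq (fun s => act (val g) (act (val k) x0) +
      lv g *m (lv k *m (lv s *m u (g * k * s)%g)))); last first.
    move=> s; rewrite mem_stabs => /asboolP sx; rewrite -[(cst x0 + u) _]/(x0 + u _) actD.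
    by rewrite !valM !actM (sx : act _ _ = _) !lvM !mulmxA !mulgA.
  rewrite big_split/= big_const_seq count_predT iter_addr_0 -[_ *+ _]scaler_nat scalerDr scalerA.
  rewrite stab_weightE scale1r; congr (_ + _).
  by rewrite -!mulmx_sumr !scalemxAr.
have st1 : lcoset_of (stab G x0) 1%g = stab G x0.
  by apply/seteqP; split=> [_ [s sx <-]|s sx]; [rewrite mul1g | exists s => //; rewrite mul1g].
have := key 1%g; rewrite st1 => key1.
apply/funext => h; rewrite /local_config -krepP key key1.
rewrite mulg1 /y0 /dq; have -> : lv 1%g = 1%:M by rewrite /lv val_elt1.
have -> : act (val (1%g : elt G)) x0 = x0 by rewrite val_elt1 /act mul1mx addr0.
rewrite mul1mx; move: (act (val (krep h)) x0) (lv (krep h) *m _) => p q.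
rewrite /act -/(lv g) opprD addrACA !mulmxDr !mulmxN; congr (_ + _).
by rewrite opprD addrACA subrr addr0.
Qed.

Lemma periodic_shift N (X : Type) (u : elt G -> X) k :
  M0 T N -> periodic T N u -> periodic T N (fun g => u (g * k)%g).
Proof.
move=> MN uN g t Pt; have [_ [_ PJ]] := MN.
have -> : (g * t * k = g * k * (k^-1 * t * k^-1^-1))%g.
  by rewrite invgK !mulgA mulgK.
by rewrite uN//; exact: PJ.
Qed.

Lemma ub_periodic N u : M0 T N -> periodic T N u -> periodic T N (ub u).
Proof.
move=> MN uN g t Pt; congr (_ *: _); apply: eq_bigr => s _.
by rewrite (periodic_shift s MN uN _ Pt).
Qed.

Lemma dq_periodic N u : M0 T N -> periodic T N u -> periodic T N (dq u).
Proof.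
move=> MN uN g t Pt; apply/funext => h; rewrite /dq.
by rewrite (periodic_shift _ MN (ub_periodic MN uN) _ Pt) (ub_periodic MN uN _ Pt).
Qed.

(** [y0] may be unbounded over infinitely many cosets; cut to the range of [V] it becomes an element
    of [Linfty], where the derivatives of [V] itself are available. *)
Definition trunc z : I -> 'cV[R]_d := fun h => \1_A h *: z h.
Definition Dq u g := trunc (dq u g).
Definition ty0 := trunc y0.

Lemma trunc_bound z : exists2 M, 0 <= M & forall h, A h -> fnorm (z h) <= M.
Proof.
have [s As] := (finite_seqP A).1 Afin.
exists (\sum_(h <- s) fnorm (z h)); first by apply: sumr_ge0 => *; exact: fnorm_ge0.
move=> h; rewrite As/=; elim: s {As} => // k s IH; rewrite inE big_cons => /orP[/eqP ->|/IH hs].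
  by rewrite lerDl sumr_ge0// => *; exact: fnorm_ge0.
by rewrite (le_trans hs)// lerDr fnorm_ge0.
Qed.

Lemma fnorm_trunc z h : fnorm (trunc z h) <= fnorm (z h).
Proof.
rewrite /trunc fnormZ indicE; case: (h \in A); rewrite ?normr1 ?mul1r//.
by rewrite normr0 mul0r fnorm_ge0.
Qed.

Lemma trunc_out z h : ~ A h -> trunc z h = 0.
Proof. by move=> Ah; rewrite /trunc indicE memNset// scale0r. Qed.

Lemma trunc_in z h : A h -> trunc z h = z h.
Proof. by move=> Ah; rewrite /trunc indicE mem_set// scale1r. Qed.

Lemma trunc_Linfty z : Linfty (trunc z).
Proof.
have [M M0 zM] := trunc_bound z; exists M => h.
have [Ah|Ah] := pselect (A h); first by rewrite (le_trans (fnorm_trunc _ _))// zM.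
by rewrite trunc_out// fnorm0.
Qed.

Lemma truncD z y : trunc (z + y) = trunc z + trunc y.
Proof. by apply/funext => h; rewrite /trunc -[(z + y) h]/(z h + y h) scalerDr. Qed.

Lemma truncZ a z : trunc (a *: z) = a *: trunc z.
Proof. by apply/funext => h; rewrite /trunc -[(a *: z) h]/(a *: z h) scalerA mulrC -scalerA. Qed.

Lemma trunc_mulmxf M z : trunc (mulmxf M z) = mulmxf M (trunc z).
Proof. by apply/funext => h; rewrite /trunc /mulmxf scalemxAr. Qed.

Lemma V_local_config u g : V (local_config (x0 := x0) (cst x0 + u) g) = V (ty0 + Dq u g).
Proof.
rewrite local_configE.
have OP : (lv g)^T *m lv g == 1%:M by apply/eqP/lv_orth.
rewrite (potential_invariant HV (Orth OP) (fun h => y0 h + dq u g h)).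
by rewrite VA /ty0 /Dq -truncD.
Qed.

Lemma ub_lin a u v g : ub (a *: u + v) g = a *: ub u g + ub v g.
Proof.
rewrite /ub scalerA mulrC -scalerA -scalerDr; congr (_ *: _).
rewrite scaler_sumr -big_split; apply: eq_bigr => s _ /=.
by rewrite -[(a *: u + v) _]/(a *: u _ + v _) mulmxDr scalemxAr.
Qed.

Lemma dq_lin a u v g : dq (a *: u + v) g = a *: dq u g + dq v g.
Proof.
apply/funext => h; rewrite -[RHS]/(a *: dq u g h + dq v g h) /dq !ub_lin.
by rewrite mulmxDr -scalemxAr scalerBr opprD addrACA.
Qed.

Lemma Dq_lin a u v g : Dq (a *: u + v) g = a *: Dq u g + Dq v g.
Proof. by rewrite /Dq dq_lin truncD truncZ. Qed.

Lemma fnorm_ub u g : Linfty u -> fnorm (ub u g) <= supnorm u.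
Proof.
move=> Lu; have w0 : 0 <= stab_weight G x0 by rewrite invr_ge0.
rewrite /ub fnormZ ger0_norm// -[leRHS]mul1r -stab_weightE -mulrA ler_wpM2l//.
apply: le_trans (fnorm_sum _ _) _; apply: sum_le_const => s _.
by rewrite fnorm_orth; [exact: fnorm_le_supnorm | exact: lv_orth].
Qed.

Lemma supnorm_Dq u g : Linfty u -> supnorm (Dq u g) <= 2 * supnorm u.
Proof.
move=> Lu; have u0 := supnorm_ge0 u; apply: supnorm_le => [|h]; first by rewrite mulr_ge0.
apply: le_trans (fnorm_trunc _ _) _; apply: le_trans (fnormD _ _) _.
rewrite -[X in _ + fnorm X]scaleN1r fnormZ normrN1 mul1r fnorm_orth; last exact: lv_orth.
by have := fnorm_ub g Lu; have := fnorm_ub (g * krep h)%g Lu; lra.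
Qed.

Local Notation W := (UperG G T).
Local Notation nU := (@supnorm R d (elt G)).
Local Notation nI := (@supnorm R d I).
Local Notation LI := (@Linfty R d I).

Lemma Uper_common u v : W u -> W v ->
  exists N, [/\ M0 T N, periodic T N u & periodic T N v].
Proof.
move=> [N MN uN] [N' MN' vN]; exists (N * N')%N; split.
- by apply: (M0_mul nf Tbij MN); case: MN'.
- exact: (periodic_mul MN uN).
- by rewrite mulnC; exact: (periodic_mul MN' vN).
Qed.

Lemma periodic_rep N (X : Type) (u : elt G -> X) g : M0 T N -> periodic T N u ->
  u g = u (rep (powers T N) (C N) g).
Proof.
move=> MN uN; have [_ r2] := repP (Crep MN) g.
by rewrite -(uN (rep _ _ g) _ r2) mulVKg.
Qed.

Lemma Uper_Linfty u : W u -> Linfty u.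
Proof.
move=> [N MN uN]; exists (\sum_(c <- C N) fnorm (u c)) => g.
rewrite (periodic_rep g MN uN); have [r1 _] := repP (Crep MN) g.
rewrite (bigD1_seq _ r1) ?fset_uniq//= lerDl sumr_ge0// => *; exact: fnorm_ge0.
Qed.

Lemma periodic_lin N a u v : periodic T N u -> periodic T N v -> periodic T N (a *: u + v).
Proof.
move=> uN vN g t Pt; rewrite -[LHS]/(a *: u (g * t)%g + v (g * t)%g).
by rewrite (uN _ _ Pt) (vN _ _ Pt).
Qed.

Lemma Uper_lin a u v : W u -> W v -> W (a *: u + v).
Proof.
move=> Wu Wv; have [N [MN uN vN]] := Uper_common Wu Wv.
by exists N => //; exact: periodic_lin.
Qed.

Lemma Uper0 : W 0.
Proof. by have [N MN] := M0_nonempty nf Tbij; exists N. Qed.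

Lemma Uper_seminormed : seminormed nU W.
Proof.
have sn := @Linfty_seminormed R d (elt G).
split; first exact: Uper0.
- exact: Uper_lin.
- by move=> u _; exact: supnorm_ge0.
- by move=> a u /Uper_Linfty Lu; exact: (snZ sn).
- by move=> u v /Uper_Linfty Lu /Uper_Linfty Lw; exact: (snD sn).
Qed.

(** A derivative is a single function of its argument, while the common period varies with that
    argument; averaging over a period of the integrand itself gives one formula for all. *)
Definition mper (F : elt G -> R) := avg (C (period T F)) F.

Lemma mperE N F : M0 T N -> periodic T N F -> mper F = avg (C N) F.
Proof.
move=> MN FN; have : [set K | M0 T K /\ periodic T K F] !=set0 by exists N.
move=> /(xgetPex 1%N)[MP FP]; exact: (avg_indep nf Tbij Crep MP MN FP FN).
Qed.

Lemma V_C2 : C2_on nI LI V.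
Proof.
have := potential_C2 HV 0.
have -> : (fun z => V (0 + z)) = V by apply/funext => z; rewrite add0r.
by [].
Qed.

Lemma V_derivative1 y : LI y -> is_derivative1 nI LI V y (derivative1 nI LI V y).
Proof. by move=> Ly; apply: derivative1P; case: (V_C2 Ly). Qed.

Lemma V_derivative2 y : LI y -> is_derivative2 nI LI V y (derivative2 nI LI V y).
Proof. by move=> Ly; apply: derivative2P; case: (V_C2 Ly). Qed.

Definition ell : (I -> 'cV[R]_d) -> R := derivative1 nI LI V ty0.
Definition hess : (I -> 'cV[R]_d) -> (I -> 'cV[R]_d) -> R := derivative2 nI LI V ty0.

Lemma Dq_periodic N u : M0 T N -> periodic T N u -> periodic T N (Dq u).
Proof. by move=> MN uN g t Pt; rewrite /Dq (dq_periodic MN uN _ Pt). Qed.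

Lemma Dq_Linfty u g : LI (Dq u g).
Proof. exact: trunc_Linfty. Qed.

Lemma energyE N u : M0 T N -> periodic T N u ->
  energy T C V (cst x0 + u) = avg (C N) (fun g => V (ty0 + Dq u g)).
Proof.
move=> MN uN; set w := cst x0 + u.
have : [set K | M0 T K /\ periodic T K w] !=set0.
  by exists N; split => // g t Pt; rewrite /w -[LHS]/(x0 + u (g * t)%g) (uN _ _ Pt).
move=> /(xgetPex 1%N)[MP wP].
have uP : periodic T (period T w) u.
  by move=> g t Pt; have := wP g t Pt; rewrite /w => /addrI.
have per K : M0 T K -> periodic T K u -> periodic T K (fun g => V (ty0 + Dq u g)).
  by move=> MK uK g t Pt; rewrite (Dq_periodic MK uK _ Pt).
rewrite -(avg_indep nf Tbij Crep MP MN (per _ MP uP) (per _ MN uN)).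
by congr (_ * _); apply: eq_bigr => g _; exact: V_local_config.
Qed.

(** The common period of [u] and an increment depends on the increment, but each summand obeys a
    bound independent of [g], and the mean of a constant is that constant. Every periodic [u] is
    treated because the second derivative compares first derivatives at nearby points. *)
Lemma energy_derivative1 u : W u -> is_derivative1 nU W (energy T C V) (cst x0 + u)
  (fun v : elt G -> 'cV[R]_d => mper (fun g => derivative1 nI LI V (ty0 + Dq u g) (Dq v g))).
Proof.
move=> Wu; have [Nu MNu uNu] := Wu.
pose x g := ty0 + Dq u g; pose D g := derivative1 nI LI V (x g).
have Lx g : LI (x g) by apply: (seminormed_add Linfty_seminormed); exact: trunc_Linfty.
have DP g : is_derivative1 nI LI V (x g) (D g) by exact: V_derivative1.
have xrep g : x g = x (rep (powers T Nu) (C Nu) g).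
  by rewrite /x (periodic_rep g MNu (Dq_periodic MNu uNu)).
have Dper K (k : elt G -> 'cV[R]_d) :
  M0 T K -> periodic T K u -> periodic T K k -> periodic T K (fun g => D g (Dq k g)).
  by move=> MK uK kK g t Pt; rewrite /D /x !(Dq_periodic MK _ _ Pt).
split; first split.
- move=> a k l Wk Wl; have [N1 [M1 k1 l1]] := Uper_common Wk Wl.
  have Wk1 : W (a *: k + l) by exact: Uper_lin.
  pose K := (Nu * N1)%N; have N10 : (0 < N1)%N by case: M1.
  have MK : M0 T K by exact: (M0_mul nf Tbij MNu).
  have uK : periodic T K u by exact: (periodic_mul MNu uNu).
  have kK : periodic T K k by rewrite /K mulnC; exact: (periodic_mul M1 k1).
  have lK : periodic T K l by rewrite /K mulnC; exact: (periodic_mul M1 l1).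
  rewrite !(mperE (N := K))//; try by apply: Dper => //; exact: periodic_lin.
  rewrite -avg_lin; congr (_ * _); apply: eq_bigr => g _.
  have [[lD _] _] := DP g; rewrite Dq_lin; apply: lD; exact: Dq_Linfty.
- have [e e0 He] : exists2 e, 0 < e & forall g, g \in (C Nu : seq _) ->
      forall z, LI z -> `|D g z| <= e^-1 * nI z.
    apply: (@uniform_on_seq R _ (C Nu) (fun g e => forall z, LI z -> `|D g z| <= e^-1 * nI z)).
      move=> g; have [[_ [c cP]] _] := DP g; exists (`|c| + 1)^-1.
        by rewrite invr_gt0 ltr_wpDl.
      move=> z Lz; rewrite invrK; apply: (le_trans (cP z Lz)).
      by rewrite ler_wpM2r ?supnorm_ge0// (le_trans (ler_norm _))// lerDl.
    move=> g e e' e'0 ee' H z Lz; apply: (le_trans (H z Lz)).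
    by rewrite ler_wpM2r ?supnorm_ge0// lef_pV2// posrE (lt_le_trans e'0).
  exists (e^-1 * 2) => k Wk; have [K [MK uK kK]] := Uper_common Wu Wk.
  rewrite (mperE MK (Dper _ _ MK uK kK)); apply: (le_trans (avg_norm _ _)).
  rewrite -[leRHS](avg_const (Crep MK)); apply: avg_le => g.
  have [r1 _] := repP (Crep MNu) g.
  rewrite /D (xrep g); apply: (le_trans (He _ r1 _ (Dq_Linfty _ _))).
  by rewrite -mulrA ler_pM2l ?invr_gt0// supnorm_Dq//; exact: Uper_Linfty.
move=> eps eps0; have eps2 : 0 < eps / 2 by rewrite divr_gt0.
have [del del0 Hd] : exists2 del, 0 < del & forall g, g \in (C Nu : seq _) ->
    forall z, LI z -> nI z < del -> `|V (x g + z) - V (x g) - D g z| <= eps / 2 * nI z.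
  apply: (@uniform_on_seq R _ (C Nu) (fun g del => forall z, LI z -> nI z < del ->
      `|V (x g + z) - V (x g) - D g z| <= eps / 2 * nI z)).
    by move=> g; have [_ /(_ _ eps2)[del del0 H]] := DP g; exists del.
  by move=> g e e' e'0 ee' H z Lz ze; apply: H => //; exact: lt_le_trans ee'.
exists (del / 2); first by rewrite divr_gt0.
move=> k Wk kd; have [K [MK uK kK]] := Uper_common Wu Wk.
have Lk := Uper_Linfty Wk.
have uk : periodic T K (u + k) by rewrite -[u]scale1r; exact: periodic_lin.
rewrite -(addrA (cst x0)) (energyE MK uk) (energyE MK uK) (mperE MK (Dper _ _ MK uK kK)).
rewrite [X in `|X|](_ : _ = avg (C K) (fun g => V (x g + Dq k g) - V (x g) - D g (Dq k g)));
  last first.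
  rewrite /avg -!mulrBr -!sumrB; congr (_ * _); apply: eq_bigr => g _.
  by rewrite -[u]scale1r Dq_lin !scale1r addrA.
apply: (le_trans (avg_norm _ _)); rewrite -[leRHS](avg_const (Crep MK)); apply: avg_le => g.
have [r1 _] := repP (Crep MNu) g.
have nk := supnorm_Dq g Lk.
have := Hd _ r1 (Dq k g) (Dq_Linfty _ _); rewrite /D -(xrep g) => H.
apply: le_trans (H _) _; first by lra.
by rewrite -mulrA ler_pM2l//; lra.
Qed.

Lemma energy_derivative1E u v : W u -> W v ->
  derivative1 nU W (energy T C V) (cst x0 + u) v =
  mper (fun g => derivative1 nI LI V (ty0 + Dq u g) (Dq v g)).
Proof. by move=> Wu Wv; apply: (derivative1E Uper_seminormed (energy_derivative1 Wu) Wv). Qed.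

Lemma hess_props : bounded_bilinear nI LI hess.
Proof. by have [] := V_derivative2 (trunc_Linfty y0). Qed.

Lemma ell_props : bounded_linear nI LI ell.
Proof. by have [] := V_derivative1 (trunc_Linfty y0). Qed.

Lemma energy_derivative2 : is_derivative2 nU W (energy T C V) (cst x0)
  (fun u v : elt G -> 'cV[R]_d => mper (fun g => hess (Dq u g) (Dq v g))).
Proof.
have [lH lH' [c c0 bH]] := hess_props.
have Hper K u v : M0 T K -> periodic T K u -> periodic T K v ->
    periodic T K (fun g => hess (Dq u g) (Dq v g)).
  by move=> MK uK vK g t Pt; rewrite !(Dq_periodic MK _ _ Pt).
have com3 u v w : W u -> W v -> W w ->
    exists K, [/\ M0 T K, periodic T K u, periodic T K v & periodic T K w].
  move=> Wu Wv [N MN wN]; have [K [MK uK vK]] := Uper_common Wu Wv.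
  have N0 : (0 < N)%N by case: MN.
  exists (K * N)%N; split; [exact: (M0_mul nf Tbij) | exact: periodic_mul | exact: periodic_mul |].
  by rewrite mulnC; exact: periodic_mul.
split; first split.
- move=> u Wu a v w Wv Ww; have [K [MK uK vK wK]] := com3 _ _ _ Wu Wv Ww.
  rewrite (mperE MK (Hper _ _ _ MK uK (periodic_lin a vK wK))).
  rewrite (mperE MK (Hper _ _ _ MK uK vK)) (mperE MK (Hper _ _ _ MK uK wK)).
  rewrite -avg_lin; congr (_ * _); apply: eq_bigr => g _.
  by rewrite Dq_lin (lH _ (Dq_Linfty _ _))//; exact: Dq_Linfty.
- move=> u Wu a v w Wv Ww; have [K [MK uK vK wK]] := com3 _ _ _ Wu Wv Ww.
  rewrite (mperE MK (Hper _ _ _ MK (periodic_lin a vK wK) uK)).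
  rewrite (mperE MK (Hper _ _ _ MK vK uK)) (mperE MK (Hper _ _ _ MK wK uK)).
  rewrite -avg_lin; congr (_ * _); apply: eq_bigr => g _.
  by rewrite Dq_lin (lH' _ (Dq_Linfty _ _))//; exact: Dq_Linfty.
- exists (c * 4); first by rewrite mulr_gt0.
  move=> u v Wu Wv; have [K [MK uK vK]] := Uper_common Wu Wv.
  rewrite (mperE MK (Hper _ _ _ MK uK vK)); apply: (le_trans (avg_norm _ _)).
  rewrite -[leRHS](avg_const (Crep MK)); apply: avg_le => g.
  apply: (le_trans (bH _ _ (Dq_Linfty _ _) (Dq_Linfty _ _))).
  have := supnorm_Dq g (Uper_Linfty Wu); have := supnorm_Dq g (Uper_Linfty Wv).
  move=> hv hu; rewrite -!mulrA ler_pM2l//.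
  by apply: mulr_le_double => //; exact: supnorm_ge0.
(* The quarter of [eps] and the half of [del] absorb the factors 2 from [supnorm_Dq]. *)
move=> eps eps0; have eps4 : 0 < eps / 4 by rewrite divr_gt0.
have [_ /(_ _ eps4)[del del0 Hd]] := V_derivative2 (trunc_Linfty y0).
exists (del / 2); first by rewrite divr_gt0.
move=> u Wu ud v Wv; have [K [MK uK vK]] := Uper_common Wu Wv.
have D0 g : Dq 0 g = 0.
  by have := Dq_lin (-1) 0 0 g; rewrite scaler0 add0r scaleN1r addNr.
rewrite energy_derivative1E//.
rewrite -[X in derivative1 _ _ _ X v](addr0 (cst x0)) energy_derivative1E//; last exact: Uper0.
have p1 w : periodic T K w -> periodic T K (fun g => derivative1 nI LI V (ty0 + Dq w g) (Dq v g)).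
  by move=> wK g t Pt; rewrite !(Dq_periodic MK _ _ Pt).
rewrite (mperE MK (p1 _ uK)) (mperE MK (p1 0 (fun _ _ _ =>
  erefl))) (mperE MK (Hper _ _ _ MK uK vK)).
rewrite /avg -!mulrBr -!sumrB -/(avg _ _).
apply: (le_trans (avg_norm _ _)); rewrite -[leRHS](avg_const (Crep MK)); apply: avg_le => g.
have nu := supnorm_Dq g (Uper_Linfty Wu); have nv := supnorm_Dq g (Uper_Linfty Wv).
rewrite D0 addr0; apply: le_trans (Hd _ (Dq_Linfty _ _) _ _ (Dq_Linfty _ _)) _.
  by apply: (le_lt_trans nu); rewrite -ltr_pdivlMl// mulrC.
rewrite -!mulrA ler_pM2l// ler_pdivrMl//.
by apply: mulr_le_double => //; exact: supnorm_ge0.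
Qed.

End EnergyDerivatives.

(** * Quantities controlled by translates of a density *)

Section Controlled.
Context {R : realType} {gT : groupType} {U : Type} (nu : U -> gT -> R).
Hypothesis nu0 : forall u g, 0 <= nu u g.
Implicit Types phi : U -> gT -> R.

(** The constant and the translates are uniform in [u]. Translates cost nothing after averaging over
    a period, see [controlled_avg]. *)
Definition controlled phi : Prop := exists c (F : seq gT), 0 <= c /\
  forall u g, phi u g <= c * \sum_(a <- F) nu u (g * a)%g.

Let sum0 (F : seq gT) u g : 0 <= \sum_(a <- F) nu u (g * a)%g.
Proof. by rewrite sumr_ge0. Qed.

Lemma controlled_le c phi phi' : 0 <= c -> controlled phi' ->
  (forall u g, phi u g <= c * phi' u g) -> controlled phi.
Proof.
move=> c0 [c' [F [c'0 H]]] le; exists (c * c'), F; split; first by rewrite mulr_ge0.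
by move=> u g; rewrite (le_trans (le u g))// -mulrA ler_wpM2l.
Qed.

Lemma controlled0 : controlled (fun _ _ => 0).
Proof. by exists 0, [::]; split => // u g; rewrite mul0r. Qed.

Lemma controlled_nu : controlled nu.
Proof. by exists 1, [:: 1%g]; split => // u g; rewrite big_seq1 mulg1 mul1r. Qed.

Lemma controlledD phi phi' : controlled phi -> controlled phi' ->
  controlled (fun u g => phi u g + phi' u g).
Proof.
move=> [c [F [c0 H]]] [c' [F' [c'0 H']]]; exists (c + c'), (F ++ F'); split.
  by rewrite addr_ge0.
move=> u g; rewrite big_cat/=.
have := H u g; have := H' u g; have := sum0 F u g; have := sum0 F' u g.
move: (\sum_(a <- F) _) (\sum_(a <- F') _) => x y y0 x0 h' h.
have := mulr_ge0 c0 y0; have := mulr_ge0 c'0 x0; nra.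
Qed.

Lemma controlled_sum (J : Type) (r : seq J) (phi : J -> U -> gT -> R) :
  (forall j, controlled (phi j)) -> controlled (fun u g => \sum_(j <- r) phi j u g).
Proof.
move=> H; elim: r => [|j r IH].
  by apply: (controlled_le ler01 controlled0) => u g; rewrite big_nil mulr0.
apply: (controlled_le ler01 (controlledD (H j) IH)) => u g.
by rewrite big_cons mul1r.
Qed.

Lemma controlled_sum_seq (J : eqType) (r : seq J) (phi : J -> U -> gT -> R) :
  (forall j, j \in r -> controlled (phi j)) -> controlled (fun u g => \sum_(j <- r) phi j u g).
Proof.
move=> H; rewrite (_ : (fun _ _ => _) =
    fun u g => \sum_(j <- r) (if j \in r then phi j u g else 0)); last first.
  by apply/funext => u; apply/funext => g; apply: eq_big_seq => j ->.
apply: controlled_sum => j; have [/H//|_] := boolP (j \in r); exact: controlled0.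
Qed.

Lemma controlled_shift a phi : controlled phi -> controlled (fun u g => phi u (g * a)%g).
Proof.
move=> [c [F [c0 H]]]; exists c, [seq (a * b)%g | b <- F]; split => // u g.
by rewrite big_map; under eq_bigr do rewrite mulgA; exact: H.
Qed.

Lemma controlled_nsqD m n (x y : U -> gT -> 'M[R]_(m, n)) :
  controlled (fun u g => nsq (x u g)) -> controlled (fun u g => nsq (y u g)) ->
  controlled (fun u g => nsq (x u g + y u g)).
Proof.
move=> cx cy; apply: (controlled_le (ler0n R 2) (controlledD cx cy)) => u g.
by rewrite mulrDr; exact: nsqD_le.
Qed.

Lemma controlled_nsqN m n (x : U -> gT -> 'M[R]_(m, n)) :
  controlled (fun u g => nsq (x u g)) -> controlled (fun u g => nsq (- x u g)).
Proof. by move=> cx; apply: (controlled_le ler01 cx) => u g; rewrite nsqN mul1r. Qed.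

Lemma controlled_nsq_sum (J : eqType) (r : seq J) m n (x : J -> U -> gT -> 'M[R]_(m, n)) :
  (forall j, j \in r -> controlled (fun u g => nsq (x j u g))) ->
  controlled (fun u g => nsq (\sum_(j <- r) x j u g)).
Proof.
move=> H; apply: (controlled_le (ler0n R (2 ^ size r)) (controlled_sum_seq H)).
by move=> u g; exact: nsq_sum_le.
Qed.

Lemma controlled_nsqM m n p q (c : 'M[R]_(m, n)) (c' : 'M[R]_(p, q))
    (x : U -> gT -> 'M[R]_(n, p)) :
  controlled (fun u g => nsq (x u g)) -> controlled (fun u g => nsq (c *m x u g *m c')).
Proof.
move=> cx; apply: (controlled_le (mulr_ge0 (nsq_ge0 c') (nsq_ge0 c)) cx) => u g.
by rewrite (le_trans (nsqM_le _ _))// mulrC -mulrA ler_wpM2l ?nsq_ge0 ?nsqM_le.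
Qed.

(** The three inequalities are those of the squared norm of a cocycle; control on a generating set
    then spreads to the whole group. *)
Lemma controlled_subgroup (phi : U -> gT -> gT -> R) :
  (forall u g, phi u g 1%g <= 0) ->
  (forall u g h k, phi u g (h * k)%g <= 2 * phi u g h + 2 * phi u (g * h)%g k) ->
  (forall u g k, phi u g k^-1%g <= phi u (g * k^-1)%g k) ->
  subgroup [set k | controlled (fun u g => phi u g k)].
Proof.
move=> p1 pM pV; split => /=.
- by apply: (controlled_le ler01 controlled0) => u g; rewrite mulr0.
- move=> h k ch ck; apply: (controlled_le (ler0n R 2) (controlledD ch (controlled_shift h ck))).
  by move=> u g; rewrite mulrDr.
- move=> k ck; apply: (controlled_le ler01 (controlled_shift k^-1%g ck)) => u g.
  by rewrite mul1r.
Qed.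

End Controlled.

Lemma generates_subgroup (gT : groupType) (H K : set gT) :
  generates H -> subgroup K -> H `<=` K -> forall k, K k.
Proof. by move=> gH sK HK k; have : [set: gT] k by []; rewrite -gH; apply. Qed.

Section Cut.
Context {R : realType} {n : nat}.
Implicit Types (b : pred 'I_n) (M : 'M[R]_n).

Definition cut b : 'M[R]_n := diag_mx (\row_i (b i)%:R).

Lemma cutE b i j : cut b i j = (b i && (i == j))%:R.
Proof. by rewrite /cut !mxE; case: eqP => [->|]; rewrite ?andbT ?andbF. Qed.

Lemma cut_mulE b m (M : 'M[R]_(n, m)) i j : (cut b *m M) i j = (b i)%:R * M i j.
Proof. by rewrite mul_diag_mx !mxE. Qed.

Lemma mul_cutE b m (M : 'M[R]_(m, n)) i j : (M *m cut b) i j = M i j * (b j)%:R.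
Proof. by rewrite mul_mx_diag !mxE. Qed.

Lemma tr_cut b : (cut b)^T = cut b.
Proof. exact: tr_diag_mx. Qed.

Lemma cutK b : cut b *m cut b = cut b.
Proof.
apply/matrixP => i j; rewrite cut_mulE cutE.
by case: (b i); rewrite /= ?mul1r ?mul0r.
Qed.

Lemma cutC b b' : cut b *m cut b' = cut b' *m cut b.
Proof. exact: diag_mxC. Qed.

Lemma cut_comm b M : (forall i j, b i != b j -> M i j = 0) -> M *m cut b = cut b *m M.
Proof.
move=> Mb; apply/matrixP => i j; rewrite cut_mulE mul_cutE mulrC.
by have [->//|/Mb ->] := eqVneq (b i) (b j); rewrite !mulr0.
Qed.

End Cut.

(** * Skew-matrix fields *)

Section Skew.
Context {R : realType} {d1 d2 : nat} {S : groupClosed (euclid R d2)}.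
Local Notation d := (d1 + d2)%N.
Context {G : groupClosed (euclid R d)} {x0 : 'cV[R]_d}.
Hypothesis nf : normal_form S G.
Implicit Types (g h k : elt G) (X Y : 'M[R]_d).

Lemma lv1 : lv (1%g : elt G) = 1%:M. Proof. by rewrite /lv val_elt1. Qed.

Lemma lv_orth' g : lv g *m (lv g)^T = 1%:M. Proof. exact: lin_orth'. Qed.

(** A right action of the group; a field with [f (g * k) = rot k (f g)] is one fixed matrix seen
    from the moving frames. *)
Definition rot k X : 'M[R]_d := (lv k)^T *m X *m lv k.

Lemma rotM h k X : rot (h * k)%g X = rot k (rot h X).
Proof. by rewrite /rot lvM trmx_mul !mulmxA. Qed.

Lemma rot1 X : rot 1%g X = X.
Proof. by rewrite /rot lv1 trmx1 mul1mx mulmx1. Qed.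

Lemma rot_lin k a X Y : rot k (a *: X + Y) = a *: rot k X + rot k Y.
Proof. by rewrite /rot mulmxDr mulmxDl -scalemxAr -scalemxAl. Qed.

Lemma rotB k X Y : rot k (X - Y) = rot k X - rot k Y.
Proof. by rewrite /rot mulmxBr mulmxBl. Qed.

Lemma nsq_rot k X : nsq (rot k X) = nsq X.
Proof.
rewrite /rot nsq_orthr; last exact: lv_orth'.
by rewrite nsq_orthl// trmxK; exact: lv_orth'.
Qed.

Definition inner : 'M[R]_d := cut (fun i : 'I_d => (i < d1)%N).

Lemma lv_inner k : lv k *m inner = inner *m lv k.
Proof.
apply: cut_comm => i j; rewrite /lv; have [A ->] := elt_dsum nf k; rewrite /lin /=.
case: (split_ordP i) => i' ->; case: (split_ordP j) => j' -> /=.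
- by [].

- by rewrite block_mxEur mxE.
- by rewrite block_mxEdl mxE.
- by [].
Qed.

Lemma inner_trans k : inner *m trans (val k) = 0.
Proof.
have [A ->] := elt_dsum nf k; apply/matrixP => i j; rewrite cut_mulE [RHS]mxE /=.
case: (split_ordP i) => i' -> /=; first by rewrite col_mxEu mxE mulr0.
by rewrite mul0r.
Qed.

Lemma skew00P X : skew00 X <-> X^T = - X /\ inner *m X *m inner = X.
Proof.
split=> [[XT X0]|[XT XI]]; split => //.
  apply/matrixP => i j; rewrite mul_cutE cut_mulE.
  have := X0 i j; case: (i < d1)%N; case: (j < d1)%N; rewrite /= ?mul1r ?mulr1// => ->//;
    by rewrite !mul0r.
move=> i j ij; rewrite -XI mul_cutE cut_mulE.
by move: ij; case: (i < d1)%N; case: (j < d1)%N => //= _; rewrite ?mul0r ?mulr0.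
Qed.

(** Translations of the group live in the last [d2] coordinates, which these matrices annihilate. *)
Lemma skew00_act X k x : skew00 X -> X *m act (val k) x = X *m (lv k *m x).
Proof.
move=> /skew00P[_ XI]; rewrite /act mulmxDr -[X in _ + X *m _]XI -!mulmxA inner_trans.
by rewrite !mulmx0 addr0.
Qed.

Lemma skew00_rot k X : skew00 X -> skew00 (rot k X).
Proof.
move=> /skew00P[XT XI]; apply/skew00P; split.
  by rewrite /rot !trmx_mul trmxK XT mulNmx mulmxN mulmxA.
rewrite -[in RHS]XI /rot -!mulmxA lv_inner !mulmxA; congr (_ *m _ *m _ *m _).
by have := congr1 trmx (lv_inner k); rewrite !trmx_mul tr_cut.
Qed.

Lemma skew000 : skew00 (0 : 'M[R]_d).
Proof. by apply/skew00P; rewrite trmx0 oppr0 mulmx0 mul0mx. Qed.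

Lemma skew00_lin a X Y : skew00 X -> skew00 Y -> skew00 (a *: X + Y).
Proof.
move=> /skew00P[XT XI] /skew00P[YT YI]; apply/skew00P; split.
  by rewrite linearD linearZ /= XT YT opprD scalerN.
by rewrite mulmxDr mulmxDl -scalemxAr -scalemxAl XI YI.
Qed.

Local Notation stabs := (@stabs R d1 d2 G x0).
Local Notation ub := (@ub R d1 d2 G x0).

Definition fdiff u g k : 'cV[R]_d := lv k *m ub u (g * k)%g - ub u g.

Lemma fdiffM u g h k : fdiff u g (h * k)%g = fdiff u g h + lv h *m fdiff u (g * h)%g k.
Proof.
by rewrite /fdiff mulmxBr mulmxA -lvM mulgA [RHS]addrC addrA subrK.
Qed.

Lemma fdiff1 u g : fdiff u g 1%g = 0.
Proof. by rewrite /fdiff mulg1 lv1 mul1mx subrr. Qed.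

Lemma fdiffV u g k : fdiff u g k^-1%g = - (lv k^-1%g *m fdiff u (g * k^-1)%g k).
Proof.
apply/eqP; rewrite -addr_eq0 -fdiffM mulVg; apply/eqP; exact: fdiff1.
Qed.

Lemma nsq_fdiffM u g h k :
  nsq (fdiff u g (h * k)%g) <= 2 * nsq (fdiff u g h) + 2 * nsq (fdiff u (g * h)%g k).
Proof.
by rewrite fdiffM -(nsq_orthl (fdiff u (g * h)%g k) (lv_orth h)); exact: nsqD_le.
Qed.

Lemma nsq_fdiffV u g k : nsq (fdiff u g k^-1%g) <= nsq (fdiff u (g * k^-1)%g k).
Proof. by rewrite fdiffV nsqN nsq_orthl//; exact: lv_orth. Qed.

Lemma fdiffB u v g k : fdiff (u - v) g k = fdiff u g k - fdiff v g k.
Proof.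
rewrite /fdiff -[u - v]addrC -scaleN1r !ub_lin !scaleN1r mulmxDr mulmxN.
move: (lv k *m _) (lv k *m _) (ub u g) (ub v g) => a b c e.
by apply/matrixP => i j; rewrite !mxE; ring.
Qed.

Hypothesis stab_fin : finite_set (stab G x0).

Lemma ub_stab w g s : stab G x0 s -> lv s *m ub w (g * s)%g = ub w g.
Proof.
move=> sx; have [s1 sM sV] := @stab_sub R d1 d2 G x0.
rewrite /ub -scalemxAr mulmx_sumr; congr (_ *: _).
rewrite (eq_bigr (fun t => lv (s * t)%g *m w (g * (s * t))%g)); last first.
  by move=> t _; rewrite lvM !mulmxA mulgA.
rewrite -(big_map (fun t => s * t)%g xpredT (fun t => lv t *m w (g * t)%g)).
apply: perm_big; apply: uniq_perm; last 1 first.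
- move=> t; rewrite (mem_stabs stab_fin); apply/mapP/asboolP => [[t' + ->]|xt].
    by rewrite (mem_stabs stab_fin) => /asboolP; exact: sM.
  exists (s^-1 * t)%g; last by rewrite mulVKg.
  by rewrite (mem_stabs stab_fin); apply/asboolP; apply: sM => //; exact: sV.
- by rewrite map_inj_uniq; [exact: fset_uniq | exact: mulgI].
- exact: fset_uniq.
Qed.

Definition rdef (f : elt G -> 'M[R]_d) g k : 'M[R]_d := f (g * k)%g - rot k (f g).

Lemma lv_rdef f g k : lv k *m f (g * k)%g = lv k *m rdef f g k + f g *m lv k.
Proof. by rewrite /rdef mulmxBr /rot !mulmxA lv_orth' mul1mx subrK. Qed.

Lemma rdef1 f g : rdef f g 1%g = 0.
Proof. by rewrite /rdef mulg1 rot1 subrr. Qed.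

Lemma rdefM f g h k : rdef f g (h * k)%g = rot k (rdef f g h) + rdef f (g * h)%g k.
Proof. by rewrite /rdef rotB -rotM mulgA [RHS]addrC addrA subrK. Qed.

Lemma nsq_rdefV f g k : nsq (rdef f g k^-1%g) <= nsq (rdef f (g * k^-1)%g k).
Proof.
rewrite -(nsq_rot k) -(nsqN (rdef f (g * k^-1)%g k)) /rdef mulgVK rotB -rotM mulVg rot1.
by rewrite opprB.
Qed.

Lemma nsq_rdefM f g h k :
  nsq (rdef f g (h * k)%g) <= 2 * nsq (rdef f g h) + 2 * nsq (rdef f (g * h)%g k).
Proof. by rewrite rdefM -(nsq_rot k (rdef f g h)); exact: nsqD_le. Qed.

Definition vfield (f : elt G -> 'M[R]_d) (y : elt G -> 'cV[R]_d) g := f g *m y g.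

Lemma ub_vfield f y g : (forall s, stab G x0 s -> f g *m (lv s *m y (g * s)%g) = f g *m y g) ->
  ub (vfield f y) g - vfield f y g =
  stab_weight G x0 *: \sum_(s <- stabs) lv s *m (rdef f g s *m y (g * s)%g).
Proof.
move=> fy; rewrite /ub (eq_big_seq (fun s =>
    lv s *m (rdef f g s *m y (g * s)%g) + f g *m y g)); last first.
  move=> s; rewrite (mem_stabs stab_fin) => /asboolP sx.
  by rewrite /vfield -/(lv s) mulmxA lv_rdef mulmxDl -!mulmxA (fy _ sx).
rewrite big_split/= big_const_seq count_predT iter_addr_0 -[_ *+ _]scaler_nat scalerDr scalerA.
by rewrite (stab_weightE stab_fin) scale1r addrK.
Qed.

(** A discrete product rule: apart from the difference falling on [y], there are a defect of [f] and
    two corrections for averaging over the stabilizer, which [ub_vfield] also turns into defects. *)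
Lemma fdiff_vfield f y g k :
  fdiff (vfield f y) g k - f g *m (lv k *m y (g * k)%g - y g) =
  lv k *m (ub (vfield f y) (g * k)%g - vfield f y (g * k)%g)
  - (ub (vfield f y) g - vfield f y g) + lv k *m (rdef f g k *m y (g * k)%g).
Proof.
have e : lv k *m vfield f y (g * k)%g = lv k *m (rdef f g k *m y (g * k)%g) +
    f g *m (lv k *m y (g * k)%g) by rewrite /vfield mulmxA lv_rdef mulmxDl -!mulmxA.
rewrite /fdiff !mulmxBr e -/(vfield f y g).
move: (lv k *m (rdef _ _ _ *m _)) (vfield f y g) (f g *m _) (ub _ g) (lv k *m ub _ _) => a b c v r.
by apply/matrixP => i j; rewrite !mxE; ring.
Qed.

End Skew.

(** * Gradients of rotation fields up to the defect *)

Section FieldEstimates.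
Context {R : realType} {d1 d2 : nat} {S : groupClosed (euclid R d2)}.
Local Notation d := (d1 + d2)%N.
Context {G : groupClosed (euclid R d)} {x0 : 'cV[R]_d}.
Hypothesis nf : normal_form S G.
Hypothesis stab_fin : finite_set (stab G x0).
Context {A : set (cosets_star G x0)} (Afin : finite_set A).
Local Notation I := (cosets_star G x0).
Local Notation stabs := (@stabs R d1 d2 G x0).
Local Notation ub := (@ub R d1 d2 G x0).
Local Notation fdiff := (@fdiff R d1 d2 G x0).

Lemma supnorm_trunc : exists ks : seq I, forall z : I -> 'cV[R]_d,
  supnorm (trunc (A := A) z) <= \sum_(h <- ks) fnorm (z h) /\
  supnorm (trunc (A := A) z) ^+ 2 <= \sum_(h <- ks) nsq (z h).
Proof.
have [ks Aks] := (finite_seqP A).1 Afin; exists ks => z.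
have le (F : I -> R) h : (forall h, 0 <= F h) -> A h -> F h <= \sum_(h <- ks) F h.
  rewrite Aks/= => F0; elim: {Aks} ks => // k ks IH; rewrite inE big_cons => /orP[/eqP ->|/IH hs].
    by rewrite lerDl sumr_ge0.
  by rewrite (le_trans hs)// lerDr.
have s0 : 0 <= \sum_(h <- ks) nsq (z h) by rewrite sumr_ge0// => *; exact: nsq_ge0.
split.
  apply: supnorm_le => [|h]; first by rewrite sumr_ge0// => *; exact: fnorm_ge0.
  have [Ah|Ah] := pselect (A h).
    rewrite trunc_in//; apply: (le (fun h => fnorm (z h))) => // *; exact: fnorm_ge0.
  by rewrite trunc_out// fnorm0 sumr_ge0// => *; exact: fnorm_ge0.
rewrite -[leRHS]sqr_sqrtr// ler_pXn2r// ?nnegrE ?sqrtr_ge0 ?supnorm_ge0//.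
apply: supnorm_le => [|h]; first exact: sqrtr_ge0.
have [Ah|Ah] := pselect (A h).
  rewrite trunc_in// fnormE ler_wsqrtr//.
  apply: (le (fun h => nsq (z h))) => // *; exact: nsq_ge0.
by rewrite trunc_out// fnorm0 sqrtr_ge0.
Qed.

Context {U : Type} (nu : U -> elt G -> R).
Hypothesis nu0 : forall u g, 0 <= nu u g.
Context (f : U -> elt G -> 'M[R]_d).
Hypothesis f00 : forall u g, skew00 (f u g).

Local Notation ctl := (controlled nu).
Let rdefc k := ctl (fun u g => nsq (rdef (f u) g k)).
Hypothesis fstab : forall s, stab G x0 s -> rdefc s.

Lemma skew00_stab X s : skew00 X -> stab G x0 s -> X *m (lv s *m x0) = X *m x0.
Proof. by move=> X0 sx; rewrite -(skew00_act nf)// (sx : act _ _ = _). Qed.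

Lemma controlled_ub_vfield :
  ctl (fun u g => nsq (ub (vfield (f u) (cst x0)) g - vfield (f u) (cst x0) g)).
Proof.
rewrite (_ : (fun _ _ => _) = fun u g => nsq ((stab_weight G x0)%:M *m
    (\sum_(s <- stabs) lv s *m rdef (f u) g s *m x0) *m 1%:M)); last first.
  apply/funext => u; apply/funext => g; congr nsq.
  rewrite mulmx1 mul_scalar_mx ub_vfield//; last first.
    by move=> s sx; exact: skew00_stab.
  by congr (_ *: _); apply: eq_bigr => s _; rewrite mulmxA.
apply: controlled_nsqM; apply: controlled_nsq_sum => // s.
by rewrite (mem_stabs stab_fin) => /asboolP sx; apply: controlled_nsqM; exact: fstab.
Qed.

Lemma controlled_fdiff_vfield k : rdefc k -> ctl (fun u g =>
  nsq (fdiff (vfield (f u) (cst x0)) g k - f u g *m (act (val k) x0 - x0))).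
Proof.
move=> fk; rewrite (_ : (fun _ _ => _) = fun u g => nsq (
    lv k *m (ub (vfield (f u) (cst x0)) (g * k)%g - vfield (f u) (cst x0) (g * k)%g) *m 1%:M
    + - (ub (vfield (f u) (cst x0)) g - vfield (f u) (cst x0) g)
    + lv k *m rdef (f u) g k *m x0)); last first.
  apply/funext => u; apply/funext => g; congr nsq.
  rewrite mulmx1 -[_ *m rdef _ _ _ *m x0]mulmxA -(fdiff_vfield (f u) (cst x0) g k).
  by rewrite !mulmxBr (skew00_act nf).
apply: controlled_nsqD => //; last exact: controlled_nsqM.
apply: controlled_nsqD => //; last by apply: controlled_nsqN; exact: controlled_ub_vfield.
by apply: controlled_nsqM; apply: (controlled_shift k controlled_ub_vfield).
Qed.

Context (w : U -> elt G -> 'cV[R]_d).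
Hypothesis wctl : ctl (fun u g => nsq (w u g)).

Lemma controlled_ub : ctl (fun u g => nsq (ub (w u) g)).
Proof.
rewrite (_ : (fun _ _ => _) = fun u g => nsq ((stab_weight G x0)%:M *m
    (\sum_(s <- stabs) lv s *m w u (g * s)%g *m 1%:M) *m 1%:M)); last first.
  apply/funext => u; apply/funext => g; congr nsq.
  rewrite mulmx1 mul_scalar_mx; congr (_ *: _); apply: eq_bigr => s _.
  by rewrite mulmx1.
apply: controlled_nsqM; apply: controlled_nsq_sum => // s _.
by apply: controlled_nsqM; exact: (controlled_shift s wctl).
Qed.

Lemma controlled_fdiff k : ctl (fun u g => nsq (fdiff (w u) g k)).
Proof.
apply: controlled_nsqD => //; last by apply: controlled_nsqN; exact: controlled_ub.
rewrite (_ : (fun _ _ => _) = fun u g => nsq (lv k *m ub (w u) (g * k)%g *m 1%:M)).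
  by apply: controlled_nsqM; exact: (controlled_shift k controlled_ub).
by apply/funext => u; apply/funext => g; rewrite mulmx1.
Qed.

Let fnorm_mul_le m n p (X : 'M[R]_(m, n)) (Y : 'M[R]_(n, p)) : fnorm (X *m Y) <= nsq X + nsq Y.
Proof.
apply: (le_trans (fnormM _ _)); rewrite -!sqr_fnorm.
have := sqr_ge0 (fnorm X - fnorm Y); have := fnorm_ge0 X; have := fnorm_ge0 Y; nra.
Qed.

Let rdef_ub_ctl k : rdefc k ->
  ctl (fun u g => fnorm (rdef (f u) g k *m ub (w u) (g * k)%g)).
Proof.
move=> fk; apply: (controlled_le ler01
  (controlledD nu0 fk (controlled_shift k controlled_ub))) => u g.
by rewrite mul1r.
Qed.

Let ub_vfield_ub_ctl : ctl (fun u g =>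
  fnorm (ub (vfield (f u) (ub (w u))) g - vfield (f u) (ub (w u)) g)).
Proof.
have w0 : 0 <= stab_weight G x0 by rewrite invr_ge0.
have H s : s \in stabs -> ctl (fun u g => fnorm (rdef (f u) g s *m ub (w u) (g * s)%g)).
  by rewrite (mem_stabs stab_fin) => /asboolP sx; apply: rdef_ub_ctl; exact: fstab.
apply: (controlled_le w0 (controlled_sum_seq nu0 H)) => u g.
rewrite ub_vfield//; last by move=> s sx; rewrite ub_stab.
rewrite fnormZ ger0_norm// ler_wpM2l// (le_trans (fnorm_sum _ _))//.
by apply: ler_sum => s _; rewrite fnorm_orth//; exact: lv_orth.
Qed.

(** The error consists of products of a defect of [f] with an averaged value of [w], so already its
    first power, not its square, is controlled by the quadratic density. *)
Lemma controlled_fdiff_vfield_ub k : rdefc k -> ctl (fun u g =>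
  fnorm (fdiff (vfield (f u) (ub (w u))) g k - f u g *m fdiff (w u) g k)).
Proof.
move=> fk; apply: (controlled_le ler01 (controlledD nu0 (controlledD nu0
  (controlled_shift k ub_vfield_ub_ctl) ub_vfield_ub_ctl) (rdef_ub_ctl fk))) => u g.
rewrite mul1r -[X in _ *m X]/(lv k *m ub (w u) (g * k)%g - ub (w u) g) fdiff_vfield.
apply: (le_trans (fnormD _ _)); rewrite lerD//; last by rewrite fnorm_orth//; exact: lv_orth.
apply: (le_trans (fnormD _ _)); rewrite fnorm_orth; last exact: lv_orth.
by rewrite lerD2l -[X in fnorm X]scaleN1r fnormZ normrN1 mul1r.
Qed.

End FieldEstimates.

(** * The affine hull of the orbit *)

Lemma col_sum (R : realType) m n (M : 'M[R]_(m, n)) :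
  M = \sum_j col j M *m (delta_mx 0 j : 'rV_n).
Proof.
apply/matrixP => i j; rewrite summxE (bigD1 j)//= big1 ?addr0.
  by rewrite mxE big_ord1 !mxE !eqxx mulr1.
by move=> k kj; rewrite mxE big_ord1 !mxE (eq_sym j) (negPf kj) andbF mulr0.
Qed.

Section Outer.
Context {R : realType} {d1 d2 : nat} {S : groupClosed (euclid R d2)}.
Local Notation d := (d1 + d2)%N.
Context {G : groupClosed (euclid R d)} {x0 : 'cV[R]_d} {daff : nat}.
Hypothesis nf : normal_form S G.
Hypothesis nc : normalized_coordinates G x0 daff.
Implicit Types (g h k : elt G) (X Y : 'M[R]_d).

Definition outer : 'M[R]_d := cut (fun i : 'I_d => (i < d - daff)%N).

Lemma outer_aff e : outer *m e = 0 <-> aff (gorbit G x0) e.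
Proof.
case: nc => _ -> _; split => [e0 i id|e0].
  by have /matrixP/(_ i 0) := e0; rewrite cut_mulE id mul1r mxE.
apply/matrixP => i j; rewrite cut_mulE ord1 [RHS]mxE.
by case: ltnP => [/e0 ->|_]; rewrite ?mulr0 ?mul0r.
Qed.

Lemma aff_sub (Z : set 'cV[R]_d) : Z `<=` aff Z.
Proof.
move=> x Zx; exists 1%N, (fun=> 1), (fun=> x); split => //; first by rewrite big_ord1.
by rewrite big_ord1 scale1r.
Qed.

Lemma outer_orbit k : outer *m act (val k) x0 = 0.
Proof. by apply/outer_aff; apply: aff_sub; exists k. Qed.

Lemma outer_x0 : outer *m x0 = 0.
Proof. by have := outer_orbit 1%g; rewrite val_elt1 /act mul1mx addr0. Qed.

Lemma outer_diff k : outer *m (act (val k) x0 - x0) = 0.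
Proof. by rewrite mulmxBr outer_orbit outer_x0 subrr. Qed.

Lemma lv_outer k : lv k *m outer = outer *m lv k.
Proof.
have row_id (i : 'I_d) j : (i < d - daff)%N -> lv k i j = (i == j)%:R.
  move=> id; case: nc => _ _ /(_ _ (valP k)) H.
  have := H 0 i id; have := H (delta_mx j 0) i id.
  rewrite /act mulmx0 add0r -/(lv k) !mxE => h1 h0.
  move: h1; rewrite h0 addr0 eqxx andbT => <-.
  rewrite (bigD1 j)//= big1 ?addr0 => [|l lj]; first by rewrite mxE !eqxx mulr1.
  by rewrite mxE (negPf lj) mulr0.
apply: cut_comm => i j; have [id|id] := ltnP i (d - daff).
  case: ltnP => // jd _; rewrite row_id//; case: eqP => // ij.
  by move: jd; rewrite -ij leqNgt id.
case: ltnP => // jd _.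
(* Row [j] of [lv k] is a unit vector, so this entry of the product with the transpose equals
   [lv k i j]; orthogonality makes it vanish. *)
have := congr1 (fun M : 'M[R]_d => M i j) (lv_orth' k).
rewrite !mxE (bigD1 j)//= [X in _ * X]mxE (row_id j j)// eqxx mulr1 big1 ?addr0 => [->|l lj].
  by case: eqP => // ij; move: id; rewrite ij leqNgt jd.
by rewrite mxE (row_id j l)// eq_sym (negPf lj) mulr0.
Qed.

(** The removed block acts trivially on displacements of the orbit, so the fits cannot determine it;
    setting it to zero makes the fitted matrices controllable. *)
Definition skew_red X := skew00 X /\ outer *m X *m outer = 0.

Lemma skew_red_lin a X Y : skew_red X -> skew_red Y -> skew_red (a *: X + Y).
Proof.
move=> [X0 XQ] [Y0 YQ]; split; first exact: skew00_lin.
by rewrite mulmxDr mulmxDl -scalemxAr -scalemxAl XQ YQ scaler0 addr0.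
Qed.

Lemma skew_red_rot k X : skew_red X -> skew_red (rot k X).
Proof.
move=> [X0 XQ]; split; first exact: (skew00_rot nf).
have e : outer *m (lv k)^T = (lv k)^T *m outer.
  by have := congr1 trmx (lv_outer k); rewrite !trmx_mul tr_cut.
rewrite /rot !mulmxA e -!mulmxA lv_outer.
by rewrite (mulmxA X) (mulmxA outer) (mulmxA outer) XQ mul0mx mulmx0.
Qed.

Lemma skew_red_rdef (f : elt G -> 'M[R]_d) g k :
  (forall g, skew_red (f g)) -> skew_red (rdef f g k).
Proof.
move=> f0; rewrite /rdef addrC -scaleN1r; apply: skew_red_lin => //.
exact: skew_red_rot.
Qed.

(** By skewness [X *m outer] is minus the transpose of [outer *m X], and the vanishing corner
    reduces the latter to [outer *m Y]. *)
Lemma nsq_skew_red X : skew_red X -> nsq X <=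
  (2 + 2 * nsq outer) * nsq (X *m (1%:M - outer)).
Proof.
move=> [[XT _] XQ]; set Y := X *m (1%:M - outer).
have XQY : X *m outer = - (outer *m Y)^T.
  rewrite /Y mulmxA mulmxBr mulmx1 XQ subr0 trmx_mul tr_cut XT mulNmx opprK//.
rewrite {1}(_ : X = Y + X *m outer); last by rewrite /Y mulmxBr mulmx1 subrK.
apply: (le_trans (nsqD_le _ _)); rewrite XQY nsqN nsq_tr.
by have := nsqM_le outer Y; lra.
Qed.

Definition reduce X := X - outer *m X *m outer.

Lemma reduce_skew_red X : skew00 X -> skew_red (reduce X).
Proof.
move=> /skew00P[XT XI]; split; last first.
  by rewrite /reduce mulmxBr mulmxBl !mulmxA cutK -!mulmxA cutK subrr.
rewrite /reduce addrC -scaleN1r; apply: skew00_lin; apply/skew00P; split => //.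
  by rewrite !trmx_mul tr_cut XT mulNmx mulmxN mulmxA.
have e : inner *m outer = outer *m inner by exact: cutC.
by rewrite !mulmxA e -[_ *m outer *m inner]mulmxA -[X in _ *m X]e -[in RHS]XI !mulmxA.
Qed.

Lemma reduce_mul X (e : 'cV[R]_d) : outer *m e = 0 -> reduce X *m e = X *m e.
Proof. by move=> e0; rewrite /reduce mulmxBl -!mulmxA e0 !mulmx0 subr0. Qed.

End Outer.

(** * The seminorm *)

Section SeminormBounds.
Context {R : realType} {d1 d2 : nat} {S : groupClosed (euclid R d2)}.
Local Notation d := (d1 + d2)%N.
Context {G : groupClosed (euclid R d)} {x0 : 'cV[R]_d} {daff : nat} {Rg : {fset elt G}}.
Hypothesis nf : normal_form S G.
Hypothesis nc : normalized_coordinates G x0 daff.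
Hypothesis adm : admissible_range G x0 Rg.
Implicit Types (g h k : elt G) (u : elt G -> 'cV[R]_d) (v p : Rg -> 'cV[R]_d).
Local Notation ub := (@ub R d1 d2 G x0).
Local Notation fdiff := (@fdiff R d1 d2 G x0).
Local Notation bar := (@bar R d1 d2 G x0 Rg).
Local Notation Uiso := (@Uiso00 R d1 d2 G x0 Rg).
Local Notation disp k := (act (val k) x0 - x0).

Lemma range1 : 1%g \in Rg.
Proof.
case: adm => _ [R' [R'' [sub [r1 r2] _ _]]]; apply: (sub 1%g).
by exists 1%g => //; exists 1%g => //; rewrite mulg1.
Qed.

Lemma range_stab k s : k \in Rg -> stab G x0 s -> (k * s)%g \in Rg.
Proof.
case: adm => e _ kR sx; have : mulset [set` Rg] (stab G x0) (k * s)%g.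
  by exists k => //; exists s.
by rewrite e.
Qed.

Lemma range_stab_finite : finite_set (stab G x0).
Proof.
apply: (sub_finite_set _ (finite_fset Rg)) => s sx.
by have := range_stab range1 sx; rewrite mul1g.
Qed.

Let stab_fin := range_stab_finite.

Definition window u g : Rg -> 'cV[R]_d := fun h : Rg => u (g * fsval h)%g.

Lemma ext_window u g k : k \in Rg -> ext (window u g) k = u (g * k)%g.
Proof. by move=> kR; rewrite /ext insubT. Qed.

Lemma barE v k : bar v k = stab_weight G x0 *:
  \sum_(s <- @stabs R d1 d2 G x0) lv s *m ext v (k * s)%g.
Proof. by rewrite /Defs.bar fsbig_finite. Qed.

Lemma bar_window u g k : k \in Rg -> bar (window u g) k = ub u (g * k)%g.
Proof.
move=> kR; rewrite barE; congr (_ *: _); apply: eq_big_seq => s.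
by rewrite (mem_stabs stab_fin) => /asboolP sx; rewrite ext_window ?range_stab// mulgA.
Qed.

Lemma ext_lin a v v' k : ext (a *: v + v') k = a *: ext v k + ext v' k.
Proof. by rewrite /ext; case: insubP => [h _ _|_] //=; rewrite scaler0 addr0. Qed.

Lemma bar_lin a v v' k : bar (a *: v + v') k = a *: bar v k + bar v' k.
Proof.
rewrite !barE scalerA mulrC -scalerA -scalerDr; congr (_ *: _).
rewrite scaler_sumr -big_split; apply: eq_bigr => s _ /=.
by rewrite ext_lin mulmxDr scalemxAr.
Qed.

Lemma dotr_ge0 v : 0 <= dotr v v.
Proof. by apply: sumr_ge0 => h _; apply: sumr_ge0 => i _; rewrite -expr2 sqr_ge0. Qed.

Lemma nsq_ext v k : nsq (ext v k) <= dotr v v.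
Proof.
rewrite /ext; case: insubP => [h _ _|_] /=; last by rewrite nsq0 dotr_ge0.
rewrite /dotr (bigD1 h)//= -[leLHS]addr0 lerD//.
  by rewrite /nsq ler_sum// => i _; rewrite big_ord1 expr2.
by apply: sumr_ge0 => h' _; apply: sumr_ge0 => i _; rewrite -expr2 sqr_ge0.
Qed.

Lemma nsq_bar : exists2 c, 0 <= c & forall v k, nsq (bar v k) <= c * dotr v v.
Proof.
set s := @stabs R d1 d2 G x0.
exists ((stab_weight G x0) ^+ 2 * ((2 ^ size s)%:R * (size s)%:R)).
  by rewrite mulr_ge0 ?sqr_ge0.
move=> v k; rewrite barE nsqZ -(mulrA (_ ^+ 2)) -(mulrA (2 ^ _)%:R) ler_wpM2l ?sqr_ge0//.
apply: (le_trans (nsq_sum_le _ _)); rewrite ler_wpM2l//; apply: sum_le_const => t _.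
by rewrite nsq_orthl ?nsq_ext//; exact: lv_orth.
Qed.

Lemma Uiso0 : Uiso 0.
Proof.
exists 0, 0; split; first exact: skew000.
move=> g; rewrite mul0mx addr0.
by have := bar_lin (-1) 0 0 (fsval g); rewrite scaler0 addr0 scaleN1r addNr => ->; rewrite mulmx0.
Qed.

Lemma Uiso_lin a v v' : Uiso v -> Uiso v' -> Uiso (a *: v + v').
Proof.
move=> [b [X [X0 H]]] [b' [X' [X'0 H']]]; exists (a *: b + b'), (a *: X + X').
split; first exact: skew00_lin.
move=> g; rewrite bar_lin mulmxDr -scalemxAr H H' scalerDr mulmxDl -scalemxAl.
by rewrite addrACA.
Qed.

Lemma proj_kerP v : Uiso (v - proj_ker Uiso v).
Proof.
pose c (hi : Rg * 'I_d) (v : Rg -> 'cV[R]_d) : R := v hi.1 hi.2 0.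
have clin hi a x y : c hi (a *: x + y) = a * c hi x + c hi y.
  by rewrite /c -[(a *: x + y) _]/(a *: x _ + y _) !mxE.
have [q Uq qP] := orthogonal_projection clin Uiso0 Uiso_lin v.
have : [set p | Uiso (v - p) /\ forall v', Uiso v' -> dotr p v' = 0] !=set0.
  exists (v - q); split; first by rewrite opprB addrC subrK.
  by move=> v' /qP; rewrite -(pair_bigA _ (fun (h : Rg) i => c (h, i) (v - q) * c (h, i) v')).
by move=> /(xgetPex (fun=> 0)) [].
Qed.

Definition gap u g : Rg -> 'cV[R]_d := proj_ker Uiso (window u g).
Definition gapsq u g : R := dotr (gap u g) (gap u g).

Lemma gapsq_ge0 u g : 0 <= gapsq u g. Proof. exact: dotr_ge0. Qed.

Definition skewset u g : set 'M[R]_d := [set X | skew_red (daff := daff) X /\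
  exists a, forall h, h \in Rg -> lv h *m bar (window u g - gap u g) h = a + X *m disp h].

(** The set chosen from depends on [g] only through the window, so the choice is periodic with [u];
    it is never empty, see [skewofP]. *)
Definition skewof u g : 'M[R]_d := xget 0 (skewset u g).

Lemma skewofP u g : skewset u g (skewof u g).
Proof.
have [a [X [X0 H]]] := proj_kerP (window u g).
apply: (@xgetPex _ 0 (skewset u g)); exists (reduce (daff := daff) X); split.
  exact: reduce_skew_red.
exists a => h hR; rewrite reduce_mul; last exact: (outer_diff nc).
exact: (H [` hR]%fset).
Qed.

Lemma skewof_red u g : skew_red (daff := daff) (skewof u g).
Proof. by case: (skewofP u g). Qed.

Local Notation ctl := (controlled gapsq).

(** Subtracting the fit at the identity from the fit at [h] cancels the translation [a]; only
    averaged values of the gap remain. *)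
Lemma controlled_residual h : h \in Rg ->
  ctl (fun u g => nsq (fdiff u g h - skewof u g *m disp h)).
Proof.
move=> hR; have [c c0 cP] := nsq_bar.
apply: (controlled_le (mulr_ge0 (ler0n R 4) c0) (controlled_nu gapsq)) => u g.
have [_ [a H]] := skewofP u g.
have E k : k \in Rg -> lv k *m ub u (g * k)%g = a + skewof u g *m disp k + lv k *m bar (gap u g) k.
  move=> kR; rewrite -H// -(bar_window _ _ kR) -mulmxDr -[X in X + _]scale1r.
  by rewrite -bar_lin scale1r subrK.
have disp1 : disp (1%g : elt G) = 0 by rewrite val_elt1 /act lin1 mul1mx addr0 subrr.
have E1 := E _ range1; rewrite disp1 mulmx0 addr0 lv1 !mul1mx mulg1 in E1.
rewrite (_ : _ - _ = lv h *m bar (gap u g) h - bar (gap u g) 1%g).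
  apply: (le_trans (nsqB_le _ _)); rewrite nsq_orthl; last exact: lv_orth.
  by have := cP (gap u g) h; have := cP (gap u g) 1%g; rewrite -/(gapsq u g); lra.
rewrite -[fdiff u g h]/(lv h *m ub u (g * h)%g - ub u g) E// E1;
  move: (skewof u g *m _) (lv h *m bar _ h) (bar _ 1%g) => x y z.
by apply/matrixP => i j; rewrite !mxE; ring.
Qed.

End SeminormBounds.

(** * Variation of the fitted matrices and passage to the lattice *)

Section Rounding.
Context {R : realType} {d1 d2 : nat} {S : groupClosed (euclid R d2)}.
Local Notation d := (d1 + d2)%N.
Context {G : groupClosed (euclid R d)} {T : set (elt G)} {C : nat -> {fset elt G}}.
Hypothesis nf : normal_form S G.
Hypothesis Tbij : set_bij T (translations S) (fun t => dsum_proj (val t)).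
Hypothesis Crep : forall N, M0 T N -> representatives (C N) (powers T N).
Context {N0 : nat} (MN0 : M0 T N0).
Context {x0 : 'cV[R]_d} {daff : nat} {Rg : {fset elt G}}.
Hypothesis nc : normalized_coordinates G x0 daff.
Hypothesis adm : admissible_range G x0 Rg.
Implicit Types (g h k : elt G) (u : elt G -> 'cV[R]_d).
Local Notation ub := (@ub R d1 d2 G x0).
Local Notation fdiff := (@fdiff R d1 d2 G x0).
Local Notation disp k := (act (val k) x0 - x0).
Local Notation gapsq := (@gapsq R d1 d2 G x0 Rg).
Local Notation skewof := (@skewof R d1 d2 G x0 daff Rg).
Local Notation skew_red := (@skew_red R d1 d2 daff).
Local Notation outer := (@outer R d1 d2 daff).
Local Notation ctl := (controlled gapsq).
Local Notation crep := (@crep R d1 d2 G T C N0).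
Local Notation lpart := (@lpart R d1 d2 G T C N0).

Let gap0 (u : elt G -> 'cV[R]_d) g : 0 <= gapsq u g. Proof. exact: gapsq_ge0. Qed.

(** Both [fdiff] and the displacement are cocycles. Comparing the residual at [g] over [k * h] with
    those at [g] over [k] and at [g * k] over [h] isolates the change of the matrix from [g] to
    [g * k]. *)
Lemma rdef_disp u (f : elt G -> 'M[R]_d) g k h :
  rdef f g k *m disp h = (lv k)^T *m
    ((fdiff u g (k * h)%g - f g *m disp (k * h)%g) -
     (fdiff u g k - f g *m disp k) -
     lv k *m (fdiff u (g * k)%g h - f (g * k)%g *m disp h)).
Proof.
have disp_mul : disp (k * h)%g = disp k + lv k *m disp h.
  rewrite valM actM; move: (act (val h) x0) => y; rewrite /act -/(lv k) mulmxBr.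
  move: (lv k *m y) (lv k *m x0) => a b.
  by apply/matrixP => i j; rewrite !mxE; ring.
rewrite fdiffM disp_mul.
move: (disp h) (disp k) (fdiff u g k) (fdiff u (g * k)%g h) => x y a b.
have -> : rdef f g k = (lv k)^T *m (lv k *m f (g * k)%g - f g *m lv k).
  by rewrite /rdef /rot mulmxBr !mulmxA lv_orth mul1mx.
rewrite -[LHS]mulmxA; apply: (congr1 (mulmx (lv k)^T)).
rewrite mulmxBl -!mulmxA [f g *m (_ + _)]mulmxDr [lv k *m (b - _)]mulmxBr.
move: (lv k *m (_ *m x)) (f g *m y) (f g *m (lv k *m x)) (lv k *m b) => c e l m.
by apply/matrixP => i j; rewrite !mxE; ring.
Qed.

(** The two factors of the admissible range have separate roles: [R'] moves the base point, and
    generation then reaches all [k]; [R''] supplies displacements spanning the affine hull, on which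
    the change of the matrix is measured. *)
Lemma controlled_rdef k : ctl (fun u g => nsq (rdef (skewof u) g k)).
Proof.
case: adm => _ [R' [R'' [sub [r1 r2] gen affE]]].
have inR a b : R' a -> R'' b -> (a * b)%g \in Rg.
  by move=> Ra Rb; apply: (sub (a * b)%g); exists a => //; exists b.
apply: (generates_subgroup gen (K := [set k | ctl (fun u g => nsq (rdef (skewof u) g k))])).
  apply: (controlled_subgroup gap0 (phi := fun u g k => nsq (rdef (skewof u) g k))) => {k}.
- by move=> u g; rewrite rdef1 nsq0.
- by move=> u g h k; exact: nsq_rdefM.
- by move=> u g k; exact: nsq_rdefV.
move=> {}k Rk /=.
have R''ctl h : R'' h -> ctl (fun u g => nsq (rdef (skewof u) g k *m disp h)).
  move=> Rh; have kR : k \in Rg by rewrite -(mulg1 k); exact: inR.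
  have hR : h \in Rg by rewrite -(mul1g h); exact: inR.
  rewrite (_ : (fun _ _ => _) = fun u g => nsq ((lv k)^T *m
    ((fdiff u g (k * h)%g - skewof u g *m disp (k * h)%g) +
     - (fdiff u g k - skewof u g *m disp k) +
     - (lv k *m (fdiff u (g * k)%g h - skewof u (g * k)%g *m disp h) *m 1%:M)) *m 1%:M));
         last first.
    by apply/funext => u; apply/funext => g; rewrite (rdef_disp u) !mulmx1.
  apply: controlled_nsqM; apply: controlled_nsqD => //.
    apply: controlled_nsqD => //; first by exact: (controlled_residual nc adm (inR _ _ Rk Rh)).

    by apply: controlled_nsqN; exact: (controlled_residual nc adm).
  apply: controlled_nsqN; apply: controlled_nsqM.
  exact: (controlled_shift k (controlled_residual nc adm hR)).
(* The point [e + x0] is an affine combination of orbit points from [R'']; the weights sum to one,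
   so [e] is the same combination of displacements. *)
have Ector (e : 'cV[R]_d) : outer *m e = 0 -> ctl (fun u g => nsq (rdef (skewof u) g k *m e)).
  move=> e0; have : aff [set act (val g) x0 | g in R''] (e + x0).
    by rewrite affE; apply/(outer_aff nc); rewrite mulmxDr e0 (outer_x0 nc) addr0.
  move=> [m [c [p [pR c1 ep]]]].
  have /choice[q qP] i : exists h, R'' h /\ act (val h) x0 = p i.
    by have [h Rh hp] := pR i; exists h.
  have -> : e = \sum_i disp (q i) *m (c i)%:M.
    under eq_bigr do rewrite mul_mx_scalar scalerBr (qP _).2.
    by rewrite sumrB -scaler_suml c1 scale1r -ep addrK.
  rewrite (_ : (fun _ _ => _) = fun u g => nsq
    (\sum_(i <- index_enum 'I_m) (1%:M *m (rdef (skewof u) g k *m disp (q i)) *m (c i)%:M))).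
    apply: controlled_nsq_sum => // i _; apply: controlled_nsqM; apply: R''ctl.
    by case: (qP i).
  apply/funext => u; apply/funext => g; congr nsq; rewrite mulmx_sumr.
  by apply: eq_bigr => i _; rewrite mul1mx mulmxA.
have k0 : 0 <= 2 + 2 * nsq outer by have := nsq_ge0 outer; lra.
have cE : ctl (fun u g => nsq (rdef (skewof u) g k *m (1%:M - outer))).
  rewrite (_ : (fun _ _ => _) = fun u g => nsq (\sum_(j <- index_enum 'I_d)
    (1%:M *m (rdef (skewof u) g k *m col j (1%:M - outer)) *m (delta_mx 0 j : 'rV_d)))).
    apply: controlled_nsq_sum => // j _; apply: controlled_nsqM; apply: Ector.
    by rewrite colE mulmxA mulmxBr mulmx1 cutK subrr mul0mx.
  apply/funext => u; apply/funext => g; congr nsq.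
  rewrite {1}(col_sum (1%:M - outer)) mulmx_sumr.
  by apply: eq_bigr => i _; rewrite mul1mx mulmxA.
apply: (controlled_le k0 cE) => u g; apply: nsq_skew_red.
by apply: (skew_red_rdef nf nc) => g'; exact: skewof_red.
Qed.

(** Keeps the fitted matrices at lattice points and carries them to the rest of the group by [rot].
    Since [crep] takes finitely many values, the change is bounded by a finite sum of controlled
    defects. *)
Definition round u g : 'M[R]_d := rot (crep g) (skewof u (lpart g)).

Lemma round_red u g : skew_red (round u g).
Proof. apply: (skew_red_rot nf nc); exact: skewof_red. Qed.

Lemma controlled_round : ctl (fun u g => nsq (skewof u g - round u g)).
Proof.
have H c : c \in (C N0 : seq _) -> ctl (fun u g => nsq (rdef (skewof u) (g * c^-1)%g c)).
  by move=> _; exact: (controlled_shift c^-1%g (controlled_rdef c)).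
apply: (controlled_le ler01 (controlled_sum_seq gap0 H)) => u g; rewrite mul1r.
have cC := crep_in Crep MN0 g; rewrite (bigD1_seq _ cC) ?fset_uniq//=.
rewrite /rdef mulgVK -/(lpart g) -/(round u g) lerDl sumr_ge0// => *; exact: nsq_ge0.
Qed.

Lemma controlled_rdef_lpart a : ctl (fun u g => nsq (rdef (skewof u) (lpart g) a)).
Proof.
have H c : c \in (C N0 : seq _) -> ctl (fun u g => nsq (rdef (skewof u) (g * c^-1)%g a)).
  by move=> _; exact: (controlled_shift c^-1%g (controlled_rdef a)).
apply: (controlled_le ler01 (controlled_sum_seq gap0 H)) => u g; rewrite mul1r.
have cC := crep_in Crep MN0 g; rewrite (bigD1_seq _ cC) ?fset_uniq//=.
by rewrite lerDl sumr_ge0// => *; exact: nsq_ge0.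
Qed.

Lemma controlled_rdef_round k : ctl (fun u g => nsq (rdef (round u) g k)).
Proof.
rewrite (_ : (fun _ _ => _) = fun u g => nsq (- (skewof u (g * k)%g - round u (g * k)%g)
   + rdef (skewof u) g k + (lv k)^T *m (skewof u g - round u g) *m lv k)).
  apply: controlled_nsqD => //; last by apply: controlled_nsqM; exact: controlled_round.
  apply: controlled_nsqD => //; last exact: controlled_rdef.
  by apply: controlled_nsqN; exact: (controlled_shift k controlled_round).
apply/funext => u; apply/funext => g; congr nsq; rewrite -/(rot k _) rotB /rdef.
by apply/matrixP => i j; rewrite !mxE; ring.
Qed.

(** Gradients are cocycles, so generators in [R'] suffice; these lie in the range, where the fit
    describes the gradient of [u]. *)
Lemma controlled_fdiff_round k :
  ctl (fun u g => nsq (fdiff (u - vfield (round u) (cst x0)) g k)).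
Proof.
case: adm => _ [R' [R'' [sub [r1 r2] gen affE]]].
apply: (generates_subgroup gen (K := [set k |
    ctl (fun u g => nsq (fdiff (u - vfield (round u) (cst x0)) g k))])).
  apply: (controlled_subgroup gap0 (phi := fun u g k =>
    nsq (fdiff (u - vfield (round u) (cst x0)) g k))) => {k}.
- by move=> u g; rewrite fdiff1 nsq0.
- by move=> u g h k; exact: nsq_fdiffM.
- by move=> u g k; exact: nsq_fdiffV.
move=> {}k Rk /=; have kR : k \in Rg.
  by apply: (sub k); exists k => //; exists 1%g => //; rewrite mulg1.
rewrite (_ : (fun _ _ => _) = fun u g => nsq (
    (fdiff u g k - skewof u g *m disp k) +
    1%:M *m (skewof u g - round u g) *m disp k +
    - (fdiff (vfield (round u) (cst x0)) g k - round u g *m disp k))).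
  apply: controlled_nsqD => //.
    apply: controlled_nsqD => //; first exact: (controlled_residual nc adm).
    by apply: controlled_nsqM; exact: controlled_round.
  apply: controlled_nsqN.
  apply: (controlled_fdiff_vfield nf (range_stab_finite adm) gap0 (f := round)) => //.
  - by move=> u g; case: (round_red u g).
  - by move=> s _; exact: controlled_rdef_round.
  - exact: controlled_rdef_round.
apply/funext => u; apply/funext => g; congr nsq; rewrite fdiffB mul1mx mulmxBl.
move: (fdiff (vfield _ _) g k) (fdiff u g k) (skewof u g *m _) (round u g *m _) => a b c e.
by apply/matrixP => i j; rewrite !mxE; ring.
Qed.

End Rounding.

(** * Row-vector encoding of skew-matrix fields *)

Section RowFields.
Context {R : realType} {d1 d2 : nat} {S : groupClosed (euclid R d2)}.
Local Notation d := (d1 + d2)%N.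
Context {G : groupClosed (euclid R d)} {x0 : 'cV[R]_d} {daff : nat}.
Hypothesis nf : normal_form S G.
Hypothesis nc : normalized_coordinates G x0 daff.
Implicit Types (g h k a : elt G) (X Y : 'M[R]_d) (x y z : 'rV[R]_(d * d)).
Local Notation outer := (@outer R d1 d2 daff).
Local Notation inner := (@inner R d1 d2).
Local Notation skew_red := (@skew_red R d1 d2 daff).

(** Conjugation of matrices, written as a matrix acting on row vectors to fit the abelian theory. *)
Definition rho a : 'M[R]_(d * d) := lin_mulmx (lv a)^T *m lin_mulmxr (lv a).

Lemma mul_rho X a : mxvec X *m rho a = mxvec (rot a X).
Proof. by rewrite /rho mulmxA !mul_vec_lin. Qed.

Lemma vec_mul_rho x a : vec_mx (x *m rho a) = rot a (vec_mx x).
Proof. by rewrite -{1}(vec_mxK x) mul_rho mxvecK. Qed.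

Lemma nsq_mxvec X : nsq (mxvec X) = nsq X.
Proof.
rewrite /nsq big_ord1 pair_bigA /=.
rewrite (reindex (uncurry (@mxvec_index d d))) /=; last exact: (subon_bij _ (curry_mxvec_bij _ _)).
by apply: eq_bigr => -[i j] _ /=; rewrite mxvecE.
Qed.

Lemma nsq_rho x a : nsq (x *m rho a) = nsq x.
Proof. by rewrite -{1}(vec_mxK x) mul_rho nsq_mxvec nsq_rot -nsq_mxvec vec_mxK. Qed.

Lemma rhoM a b : rho (a * b)%g = rho a *m rho b.
Proof.
apply/row_matrixP => i; rewrite !rowE mulmxA; move: (delta_mx _ _) => x.
by rewrite -(vec_mxK x) !mul_rho rotM.
Qed.

Lemma rho_orth a : rho a *m (rho a)^T = 1%:M.
Proof.
have B x z : bil 1%:M (x *m rho a) (z *m rho a) = bil 1%:M x z.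
  have := nsqB (x *m rho a) (z *m rho a); rewrite -mulmxBl !nsq_rho (nsqB x z); lra.
have E (Y : 'M[R]_(d * d)) i j : bil Y (delta_mx 0 i) (delta_mx 0 j) = Y i j.
  by rewrite /bil -rowE trmx_delta -colE !mxE.
by apply/matrixP => i j; rewrite -!E -[RHS]B bilM mulmx1.
Qed.

(** A linear retraction onto the normalized skew matrices, so that test fields may take arbitrary
    row vectors as values; it commutes with [rot]. *)
Definition projW X : 'M[R]_d :=
  reduce (daff := daff) (inner *m (2^-1 *: (X - X^T)) *m inner).

Lemma projW_red X : skew_red (projW X).
Proof.
apply: reduce_skew_red; apply/skew00P; split.
  rewrite !trmx_mul tr_cut linearZ linearB /= trmxK -opprB scalerN mulNmx mulmxN.
  by rewrite mulmxA.
by rewrite !mulmxA cutK -!mulmxA cutK.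
Qed.

Lemma projW_id X : skew_red X -> projW X = X.
Proof.
move=> [/skew00P[XT XI] XQ]; rewrite /projW XT opprK -scalemxAr -scalemxAl mulmxDr mulmxDl XI.
rewrite -mulr2n -[X in _ (_ *: X)]scaler_nat scalerA mulVf// scale1r.
by rewrite /reduce XQ subr0.
Qed.

Lemma projW_lin (c : R) X Y : projW (c *: X + Y) = c *: projW X + projW Y.
Proof.
have sandL (P X' Y' : 'M[R]_d) : P *m (c *: X' + Y') *m P = c *: (P *m X' *m P) + P *m Y' *m P.
  by rewrite mulmxDr mulmxDl -scalemxAr -scalemxAl.
rewrite /projW /reduce.
have -> : c *: X + Y - (c *: X + Y)^T = c *: (X - X^T) + (Y - Y^T).
  have -> : (c *: X + Y)^T = c *: X^T + Y^T by rewrite linearD linearZ.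
  by rewrite scalerBr opprD addrACA.
rewrite scalerDr [_ *: (c *: _)]scalerA mulrC -scalerA !sandL.
move: (inner *m (_ *: (Y - _)) *m _) (inner *m (_ *: (X - _)) *m _) => P Q.
by rewrite scalerBr opprD addrACA.
Qed.

Lemma projW_rot k X : projW (rot k X) = rot k (projW X).
Proof.
have cI : inner *m (lv k)^T = (lv k)^T *m inner.
  by have := congr1 trmx (lv_inner nf k); rewrite !trmx_mul tr_cut.
have cO : outer *m (lv k)^T = (lv k)^T *m outer.
  by have := congr1 trmx (lv_outer nc k); rewrite !trmx_mul tr_cut.
have rT : (rot k X)^T = rot k X^T by rewrite /rot !trmx_mul trmxK mulmxA.
have rotZ Y : rot k (2^-1 *: Y) = 2^-1 *: rot k Y.
  by rewrite /rot -scalemxAr -scalemxAl.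
have rI Y : inner *m rot k Y *m inner = rot k (inner *m Y *m inner).
  rewrite /rot !mulmxA cI -!mulmxA; congr (_ *m (_ *m (_ *m _))).
  exact: (lv_inner nf).
have rO Y : outer *m rot k Y *m outer = rot k (outer *m Y *m outer).
  rewrite /rot !mulmxA cO -!mulmxA; congr (_ *m (_ *m (_ *m _))).
  exact: (lv_outer nc).
by rewrite /projW /reduce rT -rotB -rotZ rI rO -rotB.
Qed.

Lemma nsq_projW : exists2 c, 0 <= c & forall X, nsq (projW X) <= c * nsq X.
Proof.
have sand (P : 'M[R]_d) X : nsq (P *m X *m P) <= nsq P ^+ 2 * nsq X.
  apply: (le_trans (nsqM_le _ _)); rewrite expr2 -mulrA [leRHS]mulrC ler_wpM2r ?nsq_ge0//.
  by rewrite mulrC; apply: le_trans (nsqM_le _ _) _; rewrite mulrC lexx.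
exists ((2 + 2 * nsq outer ^+ 2) * (nsq inner ^+ 2)).
  by rewrite mulr_ge0 ?sqr_ge0// addr_ge0// mulr_ge0// sqr_ge0.
move=> X; rewrite /projW; set Y := 2^-1 *: _; set Z := inner *m Y *m inner.
have Y1 : nsq Y <= nsq X.
  rewrite /Y nsqZ; have := nsqB_le X X^T; rewrite nsq_tr => h.
  have := nsq_ge0 (X - X^T); have := nsq_ge0 X; lra.
have Z1 : nsq Z <= nsq inner ^+ 2 * nsq X.
  by apply: (le_trans (sand _ _)); rewrite ler_wpM2l// sqr_ge0.
rewrite /reduce -mulrA; apply: (le_trans (nsqB_le _ _)).
have := sand outer Z; have := ler_wpM2l (sqr_ge0 (nsq outer)) Z1; lra.
Qed.

End RowFields.

(** * The mixed bound *)

(** The mean is invariant under right translation, so the sum over [F] becomes the factor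
    [size F]. *)
Lemma controlled_avg {R : realType} {gT : groupType} {U : Type} (nu phi : U -> gT -> R) :
  controlled nu phi -> exists2 c, 0 <= c & forall u (H : set gT) (C : {fset gT}),
    normal_subgroup H -> representatives C H -> (forall g h, H h -> nu u (g * h)%g = nu u g) ->
    avg C (phi u) <= c * avg C (nu u).
Proof.
move=> [c [F [c0 H]]]; exists (c * (size F)%:R); first by rewrite mulr_ge0.
move=> u K C Kn CK nuK; apply: (le_trans (avg_le _ (H u))).
rewrite avgZ avg_sum -mulrA ler_wpM2l//; apply: sum_le_const => a _.
by rewrite (avg_mulr Kn CK).
Qed.

Section KernelEstimate.
Context {R : realType} {d1 d2 : nat} {S : groupClosed (euclid R d2)}.
Local Notation d := (d1 + d2)%N.
Context {G : groupClosed (euclid R d)} {T : set (elt G)} {C : nat -> {fset elt G}}.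
Hypothesis nf : normal_form S G.
Hypothesis Tbij : set_bij T (translations S) (fun t => dsum_proj (val t)).
Hypothesis Crep : forall N, M0 T N -> representatives (C N) (powers T N).
Context {x0 : 'cV[R]_d} {V : (cosets_star G x0 -> 'cV[R]_d) -> R}.
Hypothesis HV : interaction_potential G x0 V.
Hypothesis stab_fin : finite_set (stab G x0).
Context {A : set (cosets_star G x0)} (Afin : finite_set A).
Hypothesis VA : forall y, V y = V (fun h => \1_A h *: y h).
Local Notation I := (cosets_star G x0).
Local Notation nI := (@supnorm R d I).
Local Notation LI := (@Linfty R d I).
Local Notation W := (UperG G T).
Local Notation stabs := (@stabs R d1 d2 G x0).
Local Notation ub := (@ub R d1 d2 G x0).
Local Notation fdiff := (@fdiff R d1 d2 G x0).
Local Notation Dq := (@Dq R d1 d2 G x0 A).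
Local Notation hess := (@hess R d1 d2 G x0 V A).
Local Notation ell := (@ell R d1 d2 G x0 V A).
Local Notation disp k := (act (val k) x0 - x0).

Lemma d2E_avg N u v : M0 T N -> periodic T N u -> periodic T N v ->
  d2E G x0 T C V (cst x0) u v = avg (C N) (fun g => hess (Dq u g) (Dq v g)).
Proof.
move=> MN uN vN; rewrite -(mperE nf Tbij Crep MN); last first.
  by move=> g t Pt; rewrite !(Dq_periodic MN _ _ Pt).
apply: (derivative2E (Uper_seminormed nf Tbij Crep)
  (energy_derivative2 nf Tbij Crep HV stab_fin Afin VA)); by exists N.
Qed.

Hypothesis dE0 : forall u, UperG G T u -> dE G x0 T C V (cst x0) u = 0.

Lemma avg_ell N z : M0 T N -> periodic T N z -> avg (C N) (fun g => ell (Dq z g)) = 0.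
Proof.
move=> MN zN; have Wz : W z by exists N.
have D0 g : Dq 0 g = 0.
  by have := Dq_lin (A := A) (-1) 0 0 g; rewrite scaler0 add0r scaleN1r addNr.
have := energy_derivative1E nf Tbij Crep HV stab_fin Afin VA (Uper0 nf Tbij) Wz.
rewrite addr0 -/(dE G x0 T C V (cst x0)) dE0// => /esym.
rewrite (mperE nf Tbij Crep MN); last first.
  by move=> g t Pt; rewrite !(Dq_periodic MN _ _ Pt) // !D0.
by move=> <-; congr (_ * _); apply: eq_bigr => g _; rewrite D0 addr0.
Qed.

Lemma hessC x y : LI x -> LI y -> hess x y = hess y x.
Proof.
have Lt : LI (ty0 (A := A)) by exact: trunc_Linfty.
move=> Lx Ly; apply: (derivative2_sym Linfty_seminormed Lt _ (V_derivative2 HV Lt)) => //.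
by move=> z Lz; eexists; exact: V_derivative1.
Qed.

Lemma hess_rotation X z : skew00 X -> LI z -> hess (mulmxf X (ty0 (A := A))) z = - ell (mulmxf X z).
Proof.
move=> [XT _] Lz; apply: derivative2_rotation => //.
- exact: potential_invariant.
- by move=> y Ly; eexists; exact: V_derivative1.
- by move=> y Ly; eexists; exact: V_derivative2.
- exact: trunc_Linfty.
Qed.

(** Up to a defect the gradient of the rotation field is [f g] applied to the reference
    configuration, where [hess_rotation] trades the Hessian for [ell] of [f g] times the gradient of
    [w]. That product is the gradient of a periodic field up to a defect times [w], and [ell] has
    zero mean on gradients. What remains is quadratic in the defect and [w]. *)
Lemma hess_vfield_le : exists c K, 0 <= c /\ forall N f w, M0 T N ->
  (forall g, skew00 (f g)) -> periodic T N f -> periodic T N w ->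
  `|avg (C N) (fun g => hess (Dq (vfield f (cst x0)) g) (Dq w g))| <=
    c * avg (C N) (fun g => \sum_(k <- K) nsq (rdef f g k) + nsq (w g)).
Proof.
have [ks ksP] := supnorm_trunc Afin.
pose K := stabs ++ [seq krep h | h <- ks].
(* Fields and displacements are packed into one index type to obtain constants independent of
   both. *)
pose U := ({f : elt G -> 'M[R]_d | forall g, skew00 (f g)} * (elt G -> 'cV[R]_d))%type.
pose f (u : U) := sval u.1; pose w (u : U) := u.2.
pose nu (u : U) g := \sum_(k <- K) nsq (rdef (f u) g k) + nsq (w u g).
have f00 u g : skew00 (f u g) by case: u => -[].
have sum0 u g : 0 <= \sum_(k <- K) nsq (rdef (f u) g k).
  by rewrite sumr_ge0// => *; exact: nsq_ge0.
have nu0 u g : 0 <= nu u g by rewrite addr_ge0 ?nsq_ge0.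
have nuK k : k \in K -> controlled nu (fun u g => nsq (rdef (f u) g k)).
  move=> kK; apply: (controlled_le ler01 (controlled_nu nu)) => u g; rewrite mul1r /nu.
  rewrite -[leLHS]addr0 lerD ?nsq_ge0//.
  elim: (K) kK => // k' K' IH; rewrite inE big_cons => /orP[/eqP ->|/IH h].
    by rewrite lerDl sumr_ge0// => *; exact: nsq_ge0.
  by rewrite (le_trans h)// lerDr nsq_ge0.
have nus s : stab G x0 s -> controlled nu (fun u g => nsq (rdef (f u) g s)).
  by move=> sx; apply: nuK; rewrite mem_cat (mem_stabs stab_fin) asboolT.
have nuh h : h \in ks -> controlled nu (fun u g => nsq (rdef (f u) g (krep h))).
  by move=> hks; apply: nuK; rewrite mem_cat (map_f krep hks) orbT.
have nuw : controlled nu (fun u g => nsq (w u g)).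
  by apply: (controlled_le ler01 (controlled_nu nu)) => u g; rewrite mul1r /nu lerDr.
pose E1 u g := trunc (A := A) (fun h =>
  fdiff (vfield (f u) (cst x0)) g (krep h) - f u g *m disp (krep h)).
pose E2 u g := trunc (A := A) (fun h =>
  fdiff (vfield (f u) (ub (w u))) g (krep h) - f u g *m fdiff (w u) g (krep h)).
have E1c : controlled nu (fun u g => nI (E1 u g) ^+ 2).
  have H h : h \in ks -> controlled nu (fun u g =>
      nsq (fdiff (vfield (f u) (cst x0)) g (krep h) - f u g *m disp (krep h))).
    by move=> hks; apply: (controlled_fdiff_vfield nf stab_fin nu0 f00 nus); exact: nuh.
  apply: (controlled_le ler01 (controlled_sum_seq nu0 H)) => u g; rewrite mul1r.
  by have [_] := ksP (fun h => fdiff (vfield (f u) (cst x0)) g (krep h) - f u g *m disp (krep h)).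
have Dc : controlled nu (fun u g => nI (Dq (w u) g) ^+ 2).
  have H h : h \in ks -> controlled nu (fun u g => nsq (fdiff (w u) g (krep h))).
    by move=> hks; exact: (controlled_fdiff nu0 nuw).
  apply: (controlled_le ler01 (controlled_sum_seq nu0 H)) => u g; rewrite mul1r.
  by have [_] := ksP (fun h => fdiff (w u) g (krep h)).
have E2c : controlled nu (fun u g => nI (E2 u g)).
  have H h : h \in ks -> controlled nu (fun u g =>
      fnorm (fdiff (vfield (f u) (ub (w u))) g (krep h) - f u g *m fdiff (w u) g (krep h))).
    by move=> hks; apply: (controlled_fdiff_vfield_ub stab_fin nu0 nus nuw); exact: nuh.
  apply: (controlled_le ler01 (controlled_sum_seq nu0 H)) => u g; rewrite mul1r.
  by have [] := ksP (fun h =>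
    fdiff (vfield (f u) (ub (w u))) g (krep h) - f u g *m fdiff (w u) g (krep h)).
have [lH lH' [cH cH0 bH]] := hess_props HV Afin.
have [lL [cL bL]] := ell_props HV Afin.
have k0 : 0 <= cH + `|cL| by rewrite addr_ge0// ltW.
have := controlled_le k0 (controlledD nu0 (controlledD nu0 E1c Dc) E2c) (fun _ _ => lexx _).
move=> /controlled_avg[c c0 cP]; exists c, K; split => // N f' w' MN f'00 f'N w'N.
pose u : U := (exist _ f' f'00, w').
have nuN g h : powers T N h -> nu u (g * h)%g = nu u g.
  move=> Ph; rewrite /nu /= w'N//; congr (_ + _); apply: eq_bigr => k _.
  by rewrite -[f u]/f' /rdef (periodic_shift k MN f'N _ Ph) (f'N _ _ Ph).
apply: le_trans (cP u _ _ (M0_normal MN) (Crep MN) nuN).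
(* [ub w'] is compatible with the stabilizer, see [ub_stab], so averaging this product over the
   stabilizer costs only defects. *)
pose z := vfield f' (ub w').
have zN : periodic T N z by move=> g t Pt; rewrite /z /vfield f'N// (ub_periodic MN w'N _ Pt).
have D1 g : Dq (vfield f' (cst x0)) g = E1 u g + mulmxf (f' g) (ty0 (A := A)).
  rewrite /E1 /ty0 -trunc_mulmxf -truncD; congr (trunc (A := A) _); apply/funext => h.
  by rewrite -[RHS]/(_ - _ + f' g *m disp (krep h)) subrK.
have D2 g : mulmxf (f' g) (Dq w' g) = (-1) *: E2 u g + Dq z g.
  rewrite /E2 -trunc_mulmxf -truncZ -truncD; congr (trunc (A := A) _); apply/funext => h.
  by rewrite -[RHS]/(-1 *: (_ - _) + _) scaleN1r opprB subrK.
have LD g : LI (Dq w' g) by exact: trunc_Linfty.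
(* The zero mean of [ell (Dq z g)] cancels the first-order part. *)
rewrite (_ : avg _ _ = avg (C N) (fun g => hess (E1 u g) (Dq w' g) + ell (E2 u g))); last first.
  rewrite -[RHS]subr0 -(avg_ell MN zN) -[X in _ - X]mul1r -mulNr addrC -avg_lin; congr (_ * _).
  apply: eq_bigr => g _; rewrite D1 -[E1 u g]scale1r lH'//; try exact: trunc_Linfty; last first.
    by rewrite -trunc_mulmxf; exact: trunc_Linfty.
  rewrite mul1r scale1r hess_rotation// D2 lL; try exact: trunc_Linfty.
  by ring.
apply: (le_trans (avg_norm _ _)); apply: avg_le => g.
apply: (le_trans (ler_normD _ _)); rewrite mulrDr lerD//.
  apply: (le_trans (bH _ _ (trunc_Linfty Afin _) (LD g))).
  rewrite -/(E1 u g) -mulrA; have h0 := supnorm_ge0 (E1 u g); have h1 := supnorm_ge0 (Dq w' g).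
  have := normr_ge0 cL; rewrite -[w u]/w'; set p := nI _ in h0 *; set q := nI _ in h1 *.
  move=> cL0; apply: (@le_trans _ _ (cH * (p ^+ 2 + q ^+ 2))).
    by rewrite ler_pM2l//; have := sqr_ge0 (p - q); nra.
  by rewrite ler_wpM2r ?lerDl// addr_ge0 ?sqr_ge0.
apply: (le_trans (bL _ (trunc_Linfty Afin _))).
rewrite ler_wpM2r ?supnorm_ge0//; have := ler_norm cL; lra.
Qed.

End KernelEstimate.

(** * The Hessian as a form on the lattice *)

Section LocalForms.
Context {R : realType} {X : eqType} {n : nat}.
Implicit Types (s f : X -> 'rV[R]_n).

Definition spike x i : X -> 'rV[R]_n := fun y => if y == x then delta_mx 0 i else 0.

Lemma local_linear (F : seq X) (l : (X -> 'rV[R]_n) -> R) : uniq F ->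
  (forall a s s', l (a *: s + s') = a * l s + l s') ->
  (forall s s', {in F, s =1 s'} -> l s = l s') ->
  forall s, l s = \sum_(x <- F) \sum_i s x 0 i * l (spike x i).
Proof.
move=> uF ll loc s; have l0 : l 0 = 0.
  by have := ll (-1) 0 0; rewrite scaler0 addr0 mulN1r addNr.
have lsum (J : Type) (r : seq J) (c : J -> R) (g : J -> X -> 'rV[R]_n) :
    l (\sum_(j <- r) c j *: g j) = \sum_(j <- r) c j * l (g j).
  by elim: r => [|j r IH]; rewrite ?big_nil// !big_cons ll IH.
have lsum1 (J : Type) (r : seq J) (g : J -> X -> 'rV[R]_n) :
    l (\sum_(j <- r) g j) = \sum_(j <- r) l (g j).
  have := lsum J r (fun=> 1) g.
  by rewrite (eq_bigr g) => [->|j _]; rewrite ?scale1r//; apply: eq_bigr => j _; rewrite mul1r.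
rewrite [LHS](loc _ (\sum_(x <- F) \sum_i s x 0 i *: spike x i)).
  by rewrite lsum1; apply: eq_bigr => x _; rewrite lsum.
move=> y yF; have fsum (J : Type) (r : seq J) (g : J -> X -> 'rV[R]_n) :
    (\sum_(j <- r) g j) y = \sum_(j <- r) g j y.
  by elim: r => [|j r IH]; rewrite ?big_nil// !big_cons -IH.
rewrite fsum (bigD1_seq y)//= [X in _ + X]big1 ?addr0 => [|x xy]; last first.
  rewrite fsum big1// => i _; rewrite -[LHS]/(_ *: spike x i y) /spike eq_sym (negPf xy).
  exact: scaler0.
rewrite fsum {1}[s y]row_sum_delta; apply: eq_bigr => i _.
by rewrite -[RHS]/(_ *: spike y i y) /spike eqxx.
Qed.

Lemma local_bilinear (F : seq X) (B : (X -> 'rV[R]_n) -> (X -> 'rV[R]_n) -> R) : uniq F ->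
  (forall a s s' f, B (a *: s + s') f = a * B s f + B s' f) ->
  (forall a s f f', B s (a *: f + f') = a * B s f + B s f') ->
  (forall s s' f f', {in F, s =1 s'} -> {in F, f =1 f'} -> B s f = B s' f') ->
  forall s f, B s f = \sum_(x <- F) \sum_(y <- F)
    bil (\matrix_(i, j) B (spike x i) (spike y j)) (s x) (f y).
Proof.
move=> uF Bl Br loc s f.
rewrite (local_linear (l := B^~ f) uF)//; last by move=> *; exact: loc.
apply: eq_bigr => x _.
under eq_bigr => i _.
  rewrite (local_linear (l := B (spike x i)) uF)//; last by move=> *; exact: loc.
  rewrite mulr_sumr; over.
rewrite exchange_big; apply: eq_bigr => y _.
rewrite /bil !mxE; under [RHS]eq_bigr do rewrite !mxE mulr_suml.
rewrite exchange_big; apply: eq_bigr => i _; rewrite mulr_sumr.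
by apply: eq_bigr => j _; rewrite !mxE [f y 0 j * _]mulrC mulrA.
Qed.

End LocalForms.

(** * Lattice fields extended to the group *)

Section LatticeForm.
Context {R : realType} {d1 d2 : nat} {S : groupClosed (euclid R d2)}.
Local Notation d := (d1 + d2)%N.
Context {G : groupClosed (euclid R d)} {T : set (elt G)} {C : nat -> {fset elt G}}.
Hypothesis nf : normal_form S G.
Hypothesis Tbij : set_bij T (translations S) (fun t => dsum_proj (val t)).
Hypothesis Crep : forall N, M0 T N -> representatives (C N) (powers T N).
Context {N0 : nat} (MN0 : M0 T N0).
Context {x0 : 'cV[R]_d} {daff : nat} {V : (cosets_star G x0 -> 'cV[R]_d) -> R}.
Hypothesis nc : normalized_coordinates G x0 daff.
Hypothesis HV : interaction_potential G x0 V.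
Hypothesis stab_fin : finite_set (stab G x0).
Context {A : set (cosets_star G x0)} (Afin : finite_set A).
Hypothesis VA : forall y, V y = V (fun h => \1_A h *: y h).
Hypothesis dE0 : forall u, UperG G T u -> dE G x0 T C V (cst x0) u = 0.
Local Notation I := (cosets_star G x0).
Local Notation LI := (@Linfty R d I).
Local Notation stabs := (@stabs R d1 d2 G x0).
Local Notation ub := (@ub R d1 d2 G x0).
Local Notation Dq := (@Dq R d1 d2 G x0 A).
Local Notation hess := (@hess R d1 d2 G x0 V A).
Local Notation crep := (@crep R d1 d2 G T C N0).
Local Notation lpart := (@lpart R d1 d2 G T C N0).
Local Notation skew_red := (@skew_red R d1 d2 daff).
Local Notation projW := (@projW R d1 d2 daff).
Local Notation L := (powers T N0).
Local Notation m := (fun (K : nat) (F : elt G -> R) => avg (C K) (F \o lpart)).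
Local Notation pfield := (@pfield R (elt G) L (powers T) (d * d)).
Implicit Types (g h k t c : elt G) (s f : elt G -> 'rV[R]_(d * d)).

Let ms := lattice_mean_system nf Tbij Crep MN0.

(** The same extension from the lattice as in [round], with [projW] allowing arbitrary values of
    [s]. *)
Definition fld s g : 'M[R]_d := rot (crep g) (projW (vec_mx (s (lpart g)))).

Lemma fld_red s g : skew_red (fld s g).
Proof. by apply: (skew_red_rot nf nc); exact: projW_red. Qed.

Lemma fld_lin a s f g : fld (a *: s + f) g = a *: fld s g + fld f g.
Proof. by rewrite /fld -[(a *: s + f) _]/(a *: s _ + f _) linearP projW_lin rot_lin. Qed.

Lemma fld_mull s t g : L t -> fld s (t * g)%g = fld (fun t' => s (t * t')%g) g.
Proof. by move=> Lt; rewrite /fld (crep_mull Crep MN0 g Lt) (lpart_mull Crep MN0 g Lt). Qed.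

Lemma fld_periodic K s : @scales N0 K -> pfield K s -> periodic T K (fld s).
Proof.
move=> sK sP g k Pk; have MK := scales_M0 nf Tbij MN0 sK.
have [k' Pk' e] := lpart_periodic Crep MN0 g (scales_sub MN0 sK) MK Pk.
rewrite /fld e sP//; last exact: (lpart_in Crep MN0).
congr rot; apply: (rep_periodic (M0_normal MN0) (Crep MN0)).
exact: (scales_sub MN0 sK).
Qed.

(** The defect on the group is a rotated and projected lattice defect along [a]. Since [crep] has
    finite range, finitely many [a] occur for each [k]; [disps] lists them. *)
Lemma rdef_fld s g k (a := lpart (crep g * k)%g) :
  rdef (fld s) g k = rot (crep (g * k)%g)
    (projW (vec_mx (s (lpart g * a)%g - s (lpart g) *m rho a))).
Proof.
have Lt := lpart_in Crep MN0 g.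
have gk : (g * k = lpart g * (crep g * k))%g by rewrite mulgA lpartK.
rewrite linearB /= vec_mul_rho -scaleN1r addrC projW_lin (projW_rot nf nc) rot_lin scaleN1r addrC.
rewrite /rdef {1}/fld gk (crep_mull Crep MN0)// (lpart_mull Crep MN0)//; congr (_ - _).
by rewrite -rotM -/a lpartK rotM.
Qed.

Definition disps (K : seq (elt G)) : seq (elt G) := [seq lpart (c * k)%g | c <- C N0, k <- K].

Lemma disps_in K a : a \in disps K -> L a.
Proof. by move=> /allpairsP[[c k] [_ _ ->]]; exact: (lpart_in Crep MN0). Qed.

Lemma sum_rdef_fld K : exists2 c, 0 <= c & forall s g,
  \sum_(k <- K) nsq (rdef (fld s) g k) <= c * defect (@rho R d1 d2 G) (disps K) s (lpart g).
Proof.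
have [c c0 cP] := @nsq_projW R d1 d2 daff; exists c => // s g.
rewrite /defect /disps big_allpairs_dep (bigD1_seq _ (crep_in Crep MN0 g)) ?fset_uniq//=.
rewrite mulrDr -[leLHS]addr0 lerD//; last first.
  by rewrite mulr_ge0// sumr_ge0// => *; rewrite sumr_ge0// => *; exact: nsq_ge0.
rewrite mulr_sumr ler_sum// => k _; rewrite rdef_fld nsq_rot.
by apply: le_trans (cP _) _; rewrite -[nsq (vec_mx _)]nsq_mxvec vec_mxK.
Qed.

Lemma nsq_fld : exists2 c, 0 <= c & forall s g,
  nsq (vfield (fld s) (cst x0) g) <= c * nsq (s (lpart g)).
Proof.
have [c c0 cP] := @nsq_projW R d1 d2 daff; exists (nsq x0 * c).
  by rewrite mulr_ge0 ?nsq_ge0.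
move=> s g; apply: (le_trans (nsqM_le _ _)); rewrite mulrC -mulrA ler_wpM2l ?nsq_ge0//.
by rewrite nsq_rot; apply: le_trans (cP _) _; rewrite -[nsq (vec_mx _)]nsq_mxvec vec_mxK.
Qed.

Definition lform K s f : R :=
  avg (C K) (fun g => hess (Dq (vfield (fld s) (cst x0)) g) (Dq (vfield (fld f) (cst x0)) g)).

Lemma lform_sym K s f : lform K s f = lform K f s.
Proof.
apply: (congr1 (avg (C K))); apply/funext => g.
exact: (hessC HV Afin (trunc_Linfty Afin _) (trunc_Linfty Afin _)).
Qed.

Lemma vfield_fld_periodic K s : @scales N0 K -> pfield K s ->
  periodic T K (vfield (fld s) (cst x0)).
Proof. by move=> sK sP g t Pt; rewrite /vfield (fld_periodic sK sP g Pt). Qed.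

(** Two rotation fields are inserted into the mixed bound, the second in the role of the
    displacement, measured by its plain size. *)
Lemma lform_kernel : exists (c : R) B, [/\ 0 <= c, forall a, a \in B -> L a &
  forall K s f, @scales N0 K -> pfield K s -> pfield K f ->
    `|lform K s f| <= c * (Dl (m := m) (@rho R d1 d2 G) K B s + N2 (m := m) K f)].
Proof.
have [c [K [c0 cP]]] := hess_vfield_le nf Tbij Crep HV stab_fin Afin VA dE0.
have [c1 c10 c1P] := sum_rdef_fld K; have [c2 c20 c2P] := nsq_fld.
exists (c * (c1 + c2)), (disps K); split; first by rewrite mulr_ge0 ?addr_ge0.
  exact: disps_in.
move=> N s f sN sP fP; have MN := scales_M0 nf Tbij MN0 sN.
apply: (le_trans (cP N _ _ MN _ (fld_periodic sN sP) (vfield_fld_periodic sN fP))).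
  by move=> g; case: (fld_red s g).
rewrite -mulrA ler_wpM2l//; set D := Dl _ _ _ _; set Q := N2 _ _.
have D0 : 0 <= D by apply: (Dl_ge0 ms).
have Q0 : 0 <= Q by apply: (N2_ge0 ms).
apply: (@le_trans _ _ (c1 * D + c2 * Q)); last first.
  by have := mulr_ge0 c10 Q0; have := mulr_ge0 c20 D0; nra.
rewrite avgD lerD//; rewrite -avgZ; apply: avg_le => g; [exact: c1P | exact: c2P].
Qed.

End LatticeForm.

(** * The Hessian as a lattice form with constant coefficients *)

Section LatticeBound.
Context {R : realType} {d1 d2 : nat} {S : groupClosed (euclid R d2)}.
Local Notation d := (d1 + d2)%N.
Context {G : groupClosed (euclid R d)} {T : set (elt G)} {C : nat -> {fset elt G}}.
Hypothesis nf : normal_form S G.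
Hypothesis Tbij : set_bij T (translations S) (fun t => dsum_proj (val t)).
Hypothesis Crep : forall N, M0 T N -> representatives (C N) (powers T N).
Context {N0 : nat} (MN0 : M0 T N0).
Context {x0 : 'cV[R]_d} {daff : nat} {V : (cosets_star G x0 -> 'cV[R]_d) -> R}.
Hypothesis nc : normalized_coordinates G x0 daff.
Hypothesis HV : interaction_potential G x0 V.
Hypothesis stab_fin : finite_set (stab G x0).
Context {A : set (cosets_star G x0)} (Afin : finite_set A).
Hypothesis VA : forall y, V y = V (fun h => \1_A h *: y h).
Hypothesis dE0 : forall u, UperG G T u -> dE G x0 T C V (cst x0) u = 0.
Local Notation I := (cosets_star G x0).
Local Notation LI := (@Linfty R d I).
Local Notation stabs := (@stabs R d1 d2 G x0).
Local Notation ub := (@ub R d1 d2 G x0).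
Local Notation Dq := (@Dq R d1 d2 G x0 A).
Local Notation hess := (@hess R d1 d2 G x0 V A).
Local Notation crep := (@crep R d1 d2 G T C N0).
Local Notation lpart := (@lpart R d1 d2 G T C N0).
Local Notation skew_red := (@skew_red R d1 d2 daff).
Local Notation projW := (@projW R d1 d2 daff).
Local Notation L := (powers T N0).
Local Notation m := (fun (K : nat) (F : elt G -> R) => avg (C K) (F \o lpart)).
Local Notation pfield := (@pfield R (elt G) L (powers T) (d * d)).
Implicit Types (g h k t c : elt G) (s f : elt G -> 'rV[R]_(d * d)).

Local Notation fld := (@fld R d1 d2 G T C N0 daff).
Local Notation vs s := (vfield (fld s) (cst x0)).
Local Notation lform := (@lform R d1 d2 G T C N0 x0 daff V A).
Local Notation shift t s := (fun t' => s (t * t')%g).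
Local Notation rho := (@rho R d1 d2 G).

Let ms := lattice_mean_system nf Tbij Crep MN0.

Lemma Dq_mull (u : elt G -> 'cV[R]_d) t g : Dq u (t * g)%g = Dq (fun g' => u (t * g')%g) g.
Proof.
have ubE k : ub u (t * k)%g = ub (fun g' => u (t * g')%g) k.
  by congr (_ *: _); apply: eq_bigr => s _; rewrite mulgA.
congr (trunc (A := A) _); apply/funext => h.
by rewrite /dq -mulgA !ubE.
Qed.

Lemma Dq_vs_mull s t g : L t -> Dq (vs s) (t * g)%g = Dq (vs (shift t s)) g.
Proof.
move=> Lt; have e : (fun g' => vs s (t * g')%g) = vs (shift t s).
  by apply/funext => g'; apply: (congr1 (mulmx^~ x0)); exact: (fld_mull Crep MN0 _ _ Lt).
exact: (etrans (Dq_mull (vs s) t g) (congr1 (fun u => Dq u g) e)).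
Qed.

Lemma vs_lin a s f : vs (a *: s + f) = a *: vs s + vs f.
Proof.
apply/funext => g; rewrite -[RHS]/(a *: vs s g + vs f g) /vfield fld_lin mulmxDl.
by rewrite -scalemxAl.
Qed.

(** Right multiplication by [c'^-1 * c] carries the points with representative [c'] to those with
    representative [c] and keeps their lattice part, so all classes weigh the same. *)
Lemma avg_crep K (F : elt G -> R) c : @scales N0 K -> c \in C N0 ->
  (forall t k, L t -> powers T K k -> F (t * k)%g = F t) ->
  avg (C K) (fun g => (crep g == c)%:R * F (lpart g)) =
    (size (C N0))%:R^-1 * avg (C K) (F \o lpart).
Proof.
move=> sK cC FK; have MK := scales_M0 nf Tbij MN0 sK.
pose H c g := (crep g == c)%:R * F (lpart g) : R.
have HK c' g k : powers T K k -> H c' (g * k)%g = H c' g.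
  move=> Pk; have [k' Pk' e] := lpart_periodic Crep MN0 g (scales_sub MN0 sK) MK Pk.
  have ec : crep (g * k)%g = crep g.
    by apply: (rep_periodic (M0_normal MN0) (Crep MN0)); exact: (scales_sub MN0 sK).
  by rewrite /H e ec (FK _ _ (lpart_in Crep MN0 g) Pk').
have key c' : c' \in C N0 -> avg (C K) (H c') = avg (C K) (H c).
  move=> c'C; apply: (etrans _ (avg_mulr (M0_normal MK) (Crep MK) (c'^-1 * c)%g (HK c))).
  apply: (congr1 (avg (C K))); apply/funext => g; rewrite /H.
  have move_rep b b' x : b \in C N0 -> b' \in C N0 -> crep x = b ->
      crep (x * (b^-1 * b'))%g = b' /\ lpart (x * (b^-1 * b'))%g = lpart x.
    move=> bC b'C xb; have e : (x * (b^-1 * b') = lpart x * b')%g.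
      by rewrite -{1}(lpartK (C := C) (N0 := N0) (T := T) x) xb !mulgA mulgK.
    have Lx := lpart_in Crep MN0 x; split.
      by rewrite e (crep_mull Crep MN0 _ Lx) (crep_C Crep MN0 b'C).
    have -> : lpart (x * (b^-1 * b'))%g = (lpart x * b' * (crep (x * (b^-1 * b'))%g)^-1)%g.
      by rewrite -e.
    by rewrite e (crep_mull Crep MN0 _ Lx) (crep_C Crep MN0 b'C) mulgK.
  have [gc'|gc'] := eqVneq (crep g) c'.
    by have [-> ->] := move_rep _ _ _ c'C cC gc'; rewrite eqxx.
  have [gc|gc] := eqVneq (crep (g * (c'^-1 * c))%g) c; last by rewrite !mul0r.
  have [e _] := move_rep _ _ _ cC c'C gc.
  have eg : (g * (c'^-1 * c) * (c^-1 * c') = g)%g.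
    by rewrite -!mulgA (mulgA c) mulgV mul1g mulVg mulg1.
  by rewrite eg in e; rewrite e eqxx in gc'.
have C0 : (size (C N0))%:R != 0 :> R.
  by rewrite pnatr_eq0 -lt0n -has_predT; apply/hasP; exists c.
apply: (mulfI C0); rewrite [RHS]mulrA divff// mul1r.
transitivity (\sum_(c' <- C N0) avg (C K) (H c')).
  rewrite (eq_big_seq (fun=> avg (C K) (H c)))// big_const_seq count_predT iter_addr_0.
  by rewrite -[RHS]mulr_natl.
rewrite -avg_sum; apply: (congr1 (avg (C K))); apply/funext => g /=.
rewrite (bigD1_seq _ (crep_in Crep MN0 g)) ?fset_uniq//= big1 ?addr0.
  by rewrite /H eqxx mul1r.
by move=> c' c'g; rewrite /H eq_sym (negPf c'g) mul0r.
Qed.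

(** The contribution of one cell at the origin of the lattice; [lform] is the mean of its
    translates, which makes the coefficients independent of the lattice point. *)
Definition cell_form s f : R :=
  (size (C N0))%:R^-1 * \sum_(c <- C N0) hess (Dq (vs s) c) (Dq (vs f) c).

Lemma fld_shift_periodic K s t k : @scales N0 K -> pfield K s -> L t -> powers T K k ->
  fld (shift (t * k)%g s) = fld (shift t s).
Proof.
move=> sK sP Lt Pk; apply/funext => g.
have Lg := lpart_in Crep MN0 g.
have Lk : L k by exact: (scales_sub MN0 sK).
have [[_ LM _] _] := M0_normal MN0.
have e : (t * k * lpart g = t * lpart g * k)%g.
  by rewrite -[LHS]mulgA -[RHS]mulgA (powers_abelian nf Tbij MN0 Lk Lg).
by rewrite -[fld _ g]/(rot (crep g) (projW (vec_mx (s (t * k * lpart g)%g)))) e sP//; exact: LM.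
Qed.

Lemma lform_cell K s f : @scales N0 K -> pfield K s -> pfield K f ->
  lform K s f = avg (C K) ((fun t => cell_form (shift t s) (shift t f)) \o lpart).
Proof.
move=> sK sP fP.
pose h c t := hess (Dq (vs (shift t s)) c) (Dq (vs (shift t f)) c).
transitivity (avg (C K) (fun g => \sum_(c <- C N0) (crep g == c)%:R * h c (lpart g))).
  apply: (congr1 (avg (C K))); apply/funext => g.
  rewrite (bigD1_seq _ (crep_in Crep MN0 g)) ?fset_uniq//= big1 ?addr0; last first.
    by move=> c' c'g; rewrite eq_sym (negPf c'g) mul0r.
  have E s' : Dq (vs s') g = Dq (vs (shift (lpart g) s')) (crep g).
    exact: (etrans (congr1 (Dq (vs s')) (esym (lpartK g)))
      (Dq_vs_mull s' (crep g) (lpart_in Crep MN0 g))).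
  rewrite eqxx mul1r; exact: (congr2 hess (E s) (E f)).
rewrite avg_sum (eq_big_seq (fun c => (size (C N0))%:R^-1 * avg (C K) (h c \o lpart))).
  by rewrite -mulr_sumr -avg_sum -avgZ.
move=> c cC; apply: (avg_crep (F := h c) sK cC) => t k Lt Pk.
exact: (congr2 (fun X Y => hess (Dq (vfield X (cst x0)) c) (Dq (vfield Y (cst x0)) c))
  (fld_shift_periodic sK sP Lt Pk) (fld_shift_periodic sK fP Lt Pk)).
Qed.

Lemma cell_form_local : exists F : seq (elt G), [/\ uniq F, forall x, x \in F -> L x &
  forall s s' f f', {in F, s =1 s'} -> {in F, f =1 f'} -> cell_form s f = cell_form s' f'].
Proof.
have [ks Aks] := (finite_seqP A).1 Afin.
(* The identity accounts for the subtracted term [ub u g] of the gradient. *)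
pose ks' := 1%g :: [seq krep i | i <- ks].
pose F := undup [seq lpart (ck * b)%g | ck <- [seq (c * k)%g | c <- C N0, k <- ks'], b <- stabs].
exists F; split; first exact: undup_uniq.
  by move=> x; rewrite mem_undup => /allpairsP[[ck s] [_ _ ->]]; exact: (lpart_in Crep MN0).
have inF c k b : c \in C N0 -> k \in ks' -> b \in stabs -> lpart (c * k * b)%g \in F.
  move=> cC kk bs; rewrite mem_undup; apply/allpairsP; exists (c * k, b)%g; split => //.
  exact: allpairs_f.
have D s s' c : c \in C N0 -> {in F, s =1 s'} -> Dq (vs s) c = Dq (vs s') c.
  move=> cC ss'.
  have ubE k : k \in ks' -> ub (vs s) (c * k)%g = ub (vs s') (c * k)%g.
    move=> kk; apply: (congr1 (fun x => stab_weight G x0 *: x)).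
    apply: eq_big_seq => b bs; apply: (congr1 (mulmx (lv b))); apply: (congr1 (mulmx^~ x0)).
    exact: (congr1 (fun x =>
      rot (crep (c * k * b)%g) (projW (vec_mx x))) (ss' _ (inF _ _ _ cC kk bs))).
  apply/funext => h; have [Ah|nAh] := pselect (A h); last first.
    exact: (etrans (trunc_out _ nAh) (esym (trunc_out _ nAh))).
  have hks : krep h \in ks' by rewrite inE map_f ?orbT//; move: Ah; rewrite Aks.
  apply: (etrans (trunc_in _ Ah)); apply: (etrans _ (esym (trunc_in _ Ah))).
  have e1 := ubE 1%g (mem_head _ _); rewrite !mulg1 in e1.
  exact: (congr2 (fun x y => lv (krep h) *m x - y) (ubE _ hks) e1).
move=> s s' f f' ss' ff'; apply: (congr1 (fun x => (size (C N0))%:R^-1 * x)).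
apply: eq_big_seq => c cC.
exact: (congr2 hess (D _ _ _ cC ss') (D _ _ _ cC ff')).
Qed.

Lemma Dq_vs_lin a s f g : Dq (vs (a *: s + f)) g = a *: Dq (vs s) g + Dq (vs f) g.
Proof. exact: (etrans (congr1 (Dq^~ g) (vs_lin a s f)) (Dq_lin a (vs s) (vs f) g)). Qed.

Let LD s g : LI (Dq (vs s) g). Proof. exact: trunc_Linfty. Qed.

Lemma cell_forml a s s' f : cell_form (a *: s + s') f = a * cell_form s f + cell_form s' f.
Proof.
have [_ lH' _] := hess_props HV Afin.
rewrite /cell_form mulrCA -mulrDr; congr (_ * _).
rewrite mulr_sumr -big_split; apply: eq_bigr => c _ /=.
exact: (etrans (congr1 (hess^~ _) (Dq_vs_lin a s s' c)) (lH' _ (LD f c) a _ _ (LD s c) (LD s' c))).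
Qed.

Lemma cell_formr a s f f' : cell_form s (a *: f + f') = a * cell_form s f + cell_form s f'.
Proof.
have [lH _ _] := hess_props HV Afin.
rewrite /cell_form mulrCA -mulrDr; congr (_ * _).
rewrite mulr_sumr -big_split; apply: eq_bigr => c _ /=.
exact: (etrans (congr1 (hess _) (Dq_vs_lin a f f' c)) (lH _ (LD s c) a _ _ (LD f c) (LD f' c))).
Qed.

(** The mean is invariant under translation, so a pair of points [x], [y] of the finite set enters
    only through its displacement [y^-1 * x]. *)
Lemma lform_form : exists p (a_ : 'I_p -> elt G) (Y : 'I_p -> 'M[R]_(d * d)),
  (forall i, L (a_ i)) /\ forall K s f, @scales N0 K -> pfield K s -> pfield K f ->
    lform K s f = form (m := m) rho a_ K Y s f.
Proof.
have [F [uF FL loc]] := cell_form_local.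
have B := local_bilinear uF cell_forml cell_formr loc.
pose Y0 x y := \matrix_(i, j) cell_form (spike x i) (spike y j).
pose P := [seq (x, y) | x <- F, y <- F].
pose a_ (i : 'I_(size P)) := let: (x, y) := tnth (in_tuple P) i in (y^-1 * x)%g.
have PL z : z \in P -> L z.1 /\ L z.2.
  by move=> /allpairsP[[x y] [xF yF ->]]; split; exact: FL.
have [[_ LM LV] _] := M0_normal MN0.
(* The factor [rho (a_ i)] cancels the transport built into [form]. *)
exists (size P), a_, (fun i => rho (a_ i) *m Y0 (tnth (in_tuple P) i).1 (tnth (in_tuple P) i).2).
split=> [i|K s f sK sP fP].
  rewrite /a_; have := PL _ (mem_tnth i (in_tuple P)); case: (tnth _ i) => x y [/= Lx Ly].
  by apply: LM => //; exact: LV.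
rewrite (lform_cell sK sP fP).
have key z : z \in P -> avg (C K) ((fun t =>
  bil (Y0 z.1 z.2) (s (t * z.1)%g) (f (t * z.2)%g)) \o lpart)
   = avg (C K) ((fun t => bil (Y0 z.1 z.2) (s (t * (z.2^-1 * z.1))%g) (f t)) \o lpart).
  case: z => x y /PL[/= Lx Ly].
  have La : L (y^-1 * x)%g by apply: LM => //; exact: LV.
  pose H t := bil (Y0 x y) (s (t * (y^-1 * x))%g) (f t).
  have HK t k : L t -> powers T K k -> H (t * k)%g = H t.
    move=> Lt Pk; have Lk : L k by exact: (scales_sub MN0 sK).
    have e : (t * k * (y^-1 * x) = t * (y^-1 * x) * k)%g.
      by rewrite -[LHS]mulgA -[RHS]mulgA (powers_abelian nf Tbij MN0 Lk La).
    rewrite /H e (sP _ _ (LM _ _ Lt La) Pk) (fP _ _ Lt Pk); exact: erefl.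
  have := mean_shift ms sK Ly HK; rewrite -/H => <-.
  apply: (congr1 (avg (C K))); apply/funext => g; rewrite /= /H.
  by rewrite -[(_ * y * (y^-1 * x))%g]mulgA mulVKg.
pose Phi z t := bil (Y0 z.1 z.2) (s (t * (z.2^-1 * z.1))%g) (f t).
transitivity (\sum_(z <- P) avg (C K) (Phi z \o lpart)).
  rewrite -(eq_big_seq _ key) -avg_sum; apply: (congr1 (avg (C K))); apply/funext => g /=.
  by rewrite B big_allpairs_dep.
have bil_rho a (Y : 'M_(d * d)) x z : bil (rho a *m Y) (x *m (rho a)^T) z = bil Y x z.
  by rewrite /bil (mulmxA _ (rho a)) -(mulmxA x _ (rho a)) (mulmx1C (rho_orth a)) mulmx1.
rewrite (form_sum ms) big_tnth; apply: eq_bigr => i _.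
apply: (congr1 (avg (C K))); apply/funext => g /=; rewrite bil_rho /Phi /a_.
by case: (tnth _ i).
Qed.

Lemma lform_le_defect :
  (forall u, UperG G T u -> 0 <= d2E G x0 T C V (cst x0) u u) ->
  exists (c : R) B, [/\ 0 <= c, forall a, a \in B -> L a &
    forall K s, @scales N0 K -> pfield K s -> lform K s s <= c * Dl (m := m) rho K B s].
Proof.
move=> pos; have [p [a_ [Y [aL formE]]]] := lform_form.
have [c [B [c0 BL cP]]] := lform_kernel nf Tbij Crep MN0 nc HV stab_fin Afin VA dE0.
have rM a b : L a -> L b -> rho (a * b)%g = rho a *m rho b by move=> _ _; exact: rhoM.
have rO a : L a -> rho a *m (rho a)^T = 1%:M by move=> _; exact: rho_orth.
have [||c' [B' [c'0 B'L c'P]]] := nonneg_form_le_defect ms rM rO aL (Y := Y).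
- exists c, B; split => // K s f sK sP fP; rewrite -!formE//; split; first exact: cP.
  by rewrite (lform_sym HV Afin); exact: cP.
- move=> K s sK sP; rewrite -formE//.
  have MK := scales_M0 nf Tbij MN0 sK; have vP := vfield_fld_periodic nf Tbij Crep MN0 sK sP.
  rewrite /lform -(d2E_avg nf Tbij Crep HV stab_fin Afin VA MK (vP _ _) (vP _ _)).
  by apply: pos; exists K.
by exists c', B'; split => // K s sK sP; rewrite (formE _ _ _ sK sP sP); exact: c'P.
Qed.

End LatticeBound.

(** * Nontriviality of the seminorm *)

Section Assembly.
Context {R : realType} {d1 d2 : nat} {S : groupClosed (euclid R d2)}.
Local Notation d := (d1 + d2)%N.
Context {G : groupClosed (euclid R d)} {T : set (elt G)} {C : nat -> {fset elt G}}.
Hypothesis nf : normal_form S G.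
Hypothesis Tbij : set_bij T (translations S) (fun t => dsum_proj (val t)).
Hypothesis Crep : forall N, M0 T N -> representatives (C N) (powers T N).
Context {x0 : 'cV[R]_d} {daff : nat} {V : (cosets_star G x0 -> 'cV[R]_d) -> R} {Rg : {fset elt G}}.
Hypothesis nc : normalized_coordinates G x0 daff.
Hypothesis adm : admissible_range G x0 Rg.
Local Notation stabs := (@stabs R d1 d2 G x0).
Local Notation ub := (@ub R d1 d2 G x0).
Local Notation fdiff := (@fdiff R d1 d2 G x0).
Local Notation gapsq := (@gapsq R d1 d2 G x0 Rg).
Local Notation gap := (@gap R d1 d2 G x0 Rg).
Local Notation skewof := (@skewof R d1 d2 G x0 daff Rg).
Local Notation snorm := (seminorm00 G x0 T C Rg).
Implicit Types (g h k t : elt G) (u v w : elt G -> 'cV[R]_d).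

Let stab_fin := range_stab_finite adm.

Lemma window_periodic N u : M0 T N -> periodic T N u -> periodic T N (window (Rg := Rg) u).
Proof.
move=> MN uN g t Pt; apply/funext => h; exact: (periodic_shift (fsval h) MN uN _ Pt).
Qed.

Lemma gapsq_periodic N u : M0 T N -> periodic T N u -> periodic T N (gapsq u).
Proof.
by move=> MN uN g t Pt; rewrite /gapsq /gap (window_periodic MN uN g Pt).
Qed.

Lemma skewof_periodic N u : M0 T N -> periodic T N u -> periodic T N (skewof u).
Proof.
move=> MN uN g t Pt; have e := window_periodic MN uN g Pt.
by apply: (congr1 (xget 0)); rewrite /skewset /gap e.
Qed.

Lemma seminorm_sqr N u : M0 T N -> periodic T N u -> snorm u ^+ 2 = avg (C N) (gapsq u).
Proof.
move=> MN uN; have : [set K | M0 T K /\ periodic T K u] !=set0 by exists N.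
move=> /(xgetPex 1%N)[MP uP].
rewrite -(avg_indep nf Tbij Crep MP MN (gapsq_periodic MP uP) (gapsq_periodic MN uN)).
by rewrite sqr_sqrtr//; apply: avg_ge0 => g; exact: gapsq_ge0.
Qed.

Lemma dotr_eq0 (v : Rg -> 'cV[R]_d) : dotr v v = 0 -> v = 0.
Proof.
move=> v0; apply/funext => h; apply/matrixP => i j; rewrite ord1.
have p0 (h' : Rg) : true -> 0 <= \sum_i v h' i 0 * v h' i 0.
  by move=> _; apply: sumr_ge0 => k _; rewrite -expr2 sqr_ge0.
have q0 (k : 'I_d) : true -> 0 <= v h k 0 * v h k 0 by rewrite -expr2 sqr_ge0.
have /eqP := v0; rewrite /dotr psumr_eq0// => /allP/(_ h (mem_index_enum _))/=.
rewrite psumr_eq0// => /allP/(_ i (mem_index_enum _))/=.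
by rewrite mulf_eq0 orbb => /eqP ->; rewrite mxE.
Qed.

Lemma skew_dot (X : 'M[R]_d) (e : 'cV[R]_d) : X^T = - X -> X *m e = e -> e = 0.
Proof.
move=> XT Xe; apply: nsq_eq0.
have E : e^T *m e = - (e^T *m e).
  by rewrite -{2}Xe mulmxA -[e^T *m X]trmxK trmx_mul trmxK XT mulNmx Xe linearN mulNmx.
rewrite nsqE; have := congr1 mxtrace E; rewrite linearN /= => /eqP.
by rewrite -addr_eq0 -mulr2n mulrn_eq0 /= => /eqP.
Qed.

(** The displacement is concentrated on the coset of some [g1] moving [x0], up to periods, where its
    stabilizer mean is [e] rotated back. A perfect fit at the identity would give [X *m e = e] for a
    skew [X], which [skew_dot] excludes. *)
Lemma seminorm_nontrivial : gorbit G x0 <> [set x0] ->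
  exists2 u, UperG G T u & 0 < snorm u ^+ 2.
Proof.
(* If no element of the range moved [x0], the stabilizer would contain the generating set [R'] and
   the orbit would be trivial. *)
move=> orb; have [g1 [g1R g1x]] : exists g1, g1 \in Rg /\ act (val g1) x0 != x0.
  apply: contrapT => H; apply: orb; apply/seteqP; split => [_ [g _ <-]|_ ->]; last first.
    by exists 1%g => //; rewrite val_elt1 /act mul1mx addr0.
  case: adm => _ [R' [R'' [sub [r1 r2] gen _]]].
  apply: (generates_subgroup gen (stab_sub (x0 := x0))) => k Rk.
  apply: contrapT => kx; apply: H; exists k; split; last exact/eqP.
  by apply: (sub k); exists k => //; exists 1%g => //; rewrite mulg1.
pose e := act (val g1) x0 - x0; have e0 : e != 0 by rewrite subr_eq0.
have [M MM] := M0_nonempty nf Tbij.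
have [s1 sM sV] := @stab_sub R d1 d2 G x0.
(* The first list keeps period copies of distinct points of the coset apart; the second keeps them
   away from the stabilizer. *)
have [k [k0 sep]] := powers_separated nf Tbij
  ([seq (s^-1 * s')%g | s <- stabs, s' <- stabs] ++
   [seq (s^-1 * g1^-1 * s')%g | s <- stabs, s' <- stabs]) MM.
have MN := M0_mul nf Tbij MM k0; set N := (M * k)%N in sep MN.
have [[P1 PM PV] _] := M0_normal MN.
pose ind g s : R := (`[< powers T N ((g1 * s)^-1 * g)%g >])%:R.
pose u g : 'cV[R]_d := \sum_(s <- stabs) ind g s *: ((lv (g1 * s)%g)^T *m e).
have uN : periodic T N u.
  move=> g t Pt; apply: eq_bigr => s _; congr (_ *: _); rewrite /ind; congr (_%:R).
  congr (nat_of_bool _); apply/asboolP/asboolP => h.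
    by rewrite -(mulgK t g) mulgA; apply: PM => //; exact: PV.
  by rewrite mulgA; exact: PM.
exists u; first by exists N.
rewrite (seminorm_sqr MN uN) lt_def; apply/andP; split; last first.
  by apply: avg_ge0 => g; exact: gapsq_ge0.
apply/negP => /eqP avg0.
have gap0 : gapsq u 1%g = 0.
  have [r1 r2] := repP (Crep MN) 1%g; set r := rep _ _ _ in r1 r2.
  have -> : gapsq u 1%g = gapsq u r.
    by rewrite -(gapsq_periodic MN uN r r2) mulg1 mulgV.
  move/eqP: avg0; rewrite mulf_eq0 invr_eq0 pnatr_eq0 => /orP[/eqP s0|].
    by move: r1; rewrite (cardfs0_eq s0).
  rewrite psumr_eq0 => [/allP/(_ r r1)/eqP //|*]; exact: gapsq_ge0.
have ug1 : ub u g1 = (lv g1)^T *m e.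
  have us s : stab G x0 s -> u (g1 * s)%g = (lv (g1 * s)%g)^T *m e.
    move=> sx; have ss : s \in stabs by rewrite (mem_stabs stab_fin) asboolT.
    rewrite /u (bigD1_seq s)//= ?fset_uniq//.
    rewrite {1}/ind mulVg asboolT// scale1r big_seq_cond big1 ?addr0// => s' /andP[s's s'ns].
    rewrite /ind asboolF ?scale0r// invgM -mulgA mulKg => Ps.
    case/eqP: s'ns; have e1 := sep (s'^-1 * s)%g _ Ps.
    apply: (mulgI s'^-1%g); rewrite e1 ?mulVg//.
    by rewrite mem_cat; apply/orP; left; exact: allpairs_f.
  rewrite /ub (eq_big_seq (fun=> (lv g1)^T *m e)).
    by rewrite big_const_seq count_predT iter_addr_0 -scaler_nat scalerA (stab_weightE stab_fin)
      scale1r.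
  move=> s; rewrite (mem_stabs stab_fin) => /asboolP sx.
  by rewrite us// lvM trmx_mul !mulmxA -/(lv s) lv_orth' mul1mx.
have u1 : ub u 1%g = 0.
  rewrite /ub big_seq big1 ?scaler0// => s' s's.
  rewrite mul1g /u big_seq big1 ?mulmx0// => s ss.
  rewrite /ind asboolF ?scale0r// => Ps.
  have inl : ((g1 * s)^-1 * s')%g \in [seq (s^-1 * s')%g | s <- stabs, s' <- stabs] ++
      [seq (s^-1 * g1^-1 * s')%g | s <- stabs, s' <- stabs].
    by rewrite mem_cat invgM; apply/orP; right; exact: allpairs_f.
  have e1 := sep _ inl Ps; have g1E : g1 = (s' * s^-1)%g.
    by apply: (mulIg s); rewrite mulgVK; apply: (mulgI (g1 * s)^-1%g); rewrite mulVg e1.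
  move: g1x; rewrite g1E; apply/negP; rewrite negbK; apply/eqP.
  move: ss s's; rewrite !(mem_stabs stab_fin) => /asboolP ss /asboolP s's.
  by apply: sM => //; exact: sV.
have [a [X [[XT _] H]]] := proj_kerP adm (window u 1%g).
have g0 : gap u 1%g = 0 by exact: dotr_eq0 gap0.
have HE h : h \in Rg -> lv h *m ub u h = a + X *m (act (val h) x0 - x0).
  move=> hR; rewrite -(H [` hR]%fset) -/(gap u 1%g) g0 subr0.
  by rewrite (bar_window adm)// mul1g.
have := HE _ (range1 adm); rewrite u1 mulmx0 val_elt1 /act mul1mx addr0 subrr mulmx0 addr0.
move=> a0; have := HE _ g1R; rewrite ug1 mulmxA lv_orth' mul1mx -a0 add0r -/e => Xe.
by move/eqP: e0; apply; apply: (skew_dot XT).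
Qed.

End Assembly.

(** * Conclusion *)

Lemma psd_parallelogram (R : realType) (X : lmodType R) (W : set X) (B : X -> X -> R) v w :
  (forall a x y, W x -> W y -> W (a *: x + y)) ->
  (forall x, W x -> linear_on W (B x)) -> (forall y, W y -> linear_on W (B^~ y)) ->
  (forall x, W x -> 0 <= B x x) -> W v -> W w -> B (v + w) (v + w) <= 2 * B v v + 2 * B w w.
Proof.
move=> Wlin lB lB' pos Wv Ww.
have lin a x y z : W x -> W y -> W z -> B (a *: x + y) z = a * B x z + B y z.
  by move=> Wx Wy Wz; exact: (lB' _ Wz).
have lin' a x y z : W x -> W y -> W z -> B z (a *: x + y) = a * B z x + B z y.
  by move=> Wx Wy Wz; exact: (lB _ Wz).
have := pos _ (Wlin (-1) v w Wv Ww).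
have -> : v + w = 1 *: v + w by rewrite scale1r.
have W1 := Wlin 1 v w Wv Ww; have W2 := Wlin (-1) v w Wv Ww.
rewrite !lin// !lin'//; lra.
Qed.

Lemma psd_cauchy (R : realType) (X : lmodType R) (W : set X) (B : X -> X -> R) v w :
  (forall a x y, W x -> W y -> W (a *: x + y)) ->
  (forall x, W x -> linear_on W (B x)) -> (forall y, W y -> linear_on W (B^~ y)) ->
  (forall x, W x -> 0 <= B x x) -> (forall x y, W x -> W y -> B x y = B y x) ->
  W v -> W w -> B v w ^+ 2 <= B v v * B w w.
Proof.
move=> Wlin lB lB' pos sym Wv Ww.
have quad a b : 0 <= a ^+ 2 * B v v + 2 * a * b * B v w + b ^+ 2 * B w w.
  have W0 : W 0 by have := Wlin (-1) v v Wv Wv; rewrite scaleN1r addNr.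
  have Wb : W (b *: w) by rewrite -[b *: w]addr0; exact: Wlin.
  have Wab := Wlin a v (b *: w) Wv Wb.
  have Zr z : W z -> B z (b *: w) = b * B z w.
    move=> Wz; have B0 : B z 0 = 0.
      by have := lB _ Wz (-1) _ _ W0 W0; rewrite scaler0 addr0 mulN1r addNr.
    by have := lB _ Wz b _ _ Ww W0; rewrite addr0 B0 addr0.
  have E z : W z -> B z (a *: v + b *: w) = a * B z v + b * B z w.
    by move=> Wz; rewrite (lB _ Wz a _ _ Wv Wb) Zr.
  have := pos _ Wab; rewrite (E _ Wab) (sym _ v Wab Wv) (sym _ w Wab Ww) (E _ Wv) (E _ Ww).
  rewrite (sym w v Ww Wv); lra.
(* The first two tests are [r] and [p] times the determinant [p * r - q ^+ 2], which settles the
   cases where one of them is positive; the third settles [p = r = 0]. *)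
have Pv := pos _ Wv; have Pw := pos _ Ww.
have := quad (B w w) (- B v w); have := quad (- B v w) (B v v).
have := quad 1 (- B v w); move: (B v v) (B v w) (B w w) Pv Pw => p q r p0 r0 h1 h2 h3.
have [r00|] := eqVneq r 0.
  have [p00|pn0] := eqVneq p 0; first by move: h1; rewrite p00 r00; nra.
  have p1 : 0 < p by rewrite lt_def pn0.
  rewrite -subr_ge0 -(pmulr_rge0 _ p1); nra.
move=> rn0; have r1 : 0 < r by rewrite lt_def rn0.
rewrite -subr_ge0 -(pmulr_rge0 _ r1); nra.
Qed.

(** * Assembling the bound *)

Section EnergyBound.
Context {R : realType} {d1 d2 : nat} {S : groupClosed (euclid R d2)}.
Local Notation d := (d1 + d2)%N.
Context {G : groupClosed (euclid R d)} {T : set (elt G)} {C : nat -> {fset elt G}}.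
Hypothesis nf : normal_form S G.
Hypothesis Tbij : set_bij T (translations S) (fun t => dsum_proj (val t)).
Hypothesis Crep : forall N, M0 T N -> representatives (C N) (powers T N).
Context {x0 : 'cV[R]_d} {daff : nat} {V : (cosets_star G x0 -> 'cV[R]_d) -> R} {Rg : {fset elt G}}.
Hypothesis nc : normalized_coordinates G x0 daff.
Hypothesis adm : admissible_range G x0 Rg.
Local Notation stabs := (@stabs R d1 d2 G x0).
Local Notation ub := (@ub R d1 d2 G x0).
Local Notation fdiff := (@fdiff R d1 d2 G x0).
Local Notation gapsq := (@gapsq R d1 d2 G x0 Rg).
Local Notation gap := (@gap R d1 d2 G x0 Rg).
Local Notation skewof := (@skewof R d1 d2 G x0 daff Rg).
Local Notation snorm := (seminorm00 G x0 T C Rg).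
Implicit Types (g h k t : elt G) (u v w : elt G -> 'cV[R]_d).

Hypothesis HV : interaction_potential G x0 V.
Context {A : set (cosets_star G x0)} (Afin : finite_set A).
Hypothesis VA : forall y, V y = V (fun i => \1_A i *: y i).
Hypothesis dE0 : forall u, UperG G T u -> dE G x0 T C V (cst x0) u = 0.
Hypothesis pos : forall u, UperG G T u -> 0 <= d2E G x0 T C V (cst x0) u u.
Local Notation W := (UperG G T).
Local Notation D2 := (d2E G x0 T C V (cst x0)).
Local Notation nI := (@supnorm R d (cosets_star G x0)).
Local Notation Dq := (@Dq R d1 d2 G x0 A).
Local Notation hess := (@hess R d1 d2 G x0 V A).

Let stab_fin := range_stab_finite adm.

Lemma D2_bilinear : (forall u, W u -> linear_on W (D2 u)) /\ (forall v,
  W v -> linear_on W (D2^~ v)).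
Proof.
have := energy_derivative2 nf Tbij Crep HV stab_fin Afin VA.
move=> /(ex_intro (fun B => is_derivative2 _ _ _ _ B) _)/derivative2P[[l1 l2 _] _].
by split.
Qed.

Lemma D2_sym u v : W u -> W v -> D2 u v = D2 v u.
Proof.
move=> Wu Wv; have [N [MN uN vN]] := Uper_common nf Tbij Wu Wv.
rewrite !(d2E_avg nf Tbij Crep HV stab_fin Afin VA MN)//.
apply: (congr1 (avg (C N))); apply/funext => g.
exact: (hessC HV Afin (trunc_Linfty Afin _) (trunc_Linfty Afin _)).
Qed.

(** The parallelogram bound splits [u] into its rotation field [vr u], handled by the lattice
    estimate, and a remainder whose gradients are controlled by translates of [gapsq]. The final
    [+ 1] only makes the constant positive. *)
Lemma D2_le_seminorm : exists2 c, 0 < c & forall u, W u -> D2 u u <= c * snorm u ^+ 2.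
Proof.
have [N0 MN0] := M0_nonempty nf Tbij; have N00 : (0 < N0)%N by case: MN0.
have [ks ksP] := supnorm_trunc Afin.
have gap0 (u : elt G -> 'cV[R]_d) g : 0 <= gapsq u g by exact: gapsq_ge0.
pose rd u := @round R d1 d2 G T C N0 x0 daff Rg u.
pose vr u := vfield (rd u) (cst x0).
have [c1 [B [c10 BL c1P]]] := lform_le_defect nf Tbij Crep MN0 nc HV stab_fin Afin VA dE0 pos.
have [c2 c20 c2P] : exists2 c, 0 <= c & forall N u, M0 T N -> periodic T N u ->
    avg (C N) (fun g => \sum_(a <- B) nsq (rdef (skewof u) (@lpart R d1 d2 G T C N0 g) a)) <=
    c * avg (C N) (gapsq u).
  have H a : a \in B -> controlled gapsq (fun u g =>
      nsq (rdef (skewof u) (@lpart R d1 d2 G T C N0 g) a)).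
    by move=> _; exact: (controlled_rdef_lpart nf Crep MN0 nc adm).
  have [c c0 cP] := controlled_avg (controlled_sum_seq gap0 H).
  exists c => // N u MN uN; apply: (cP u _ _ (M0_normal MN) (Crep MN)).
  by move=> g t Pt; exact: (gapsq_periodic MN uN).
have [lH lH' [cH cH0 bH]] := hess_props HV Afin.
have [c3 c30 c3P] : exists2 c, 0 <= c & forall N u, M0 T N -> periodic T N u ->
    avg (C N) (fun g => \sum_(i <- ks) nsq (fdiff (u - vr u) g (krep i))) <=
    c * avg (C N) (gapsq u).
  have H i : i \in ks -> controlled gapsq (fun u g => nsq (fdiff (u - vr u) g (krep i))).
    by move=> _; exact: (controlled_fdiff_round nf Crep MN0 nc adm).
  have [c c0 cP] := controlled_avg (controlled_sum_seq gap0 H).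
  exists c => // N u MN uN; apply: (cP u _ _ (M0_normal MN) (Crep MN)).
  by move=> g t Pt; exact: (gapsq_periodic MN uN).
exists (2 * (c1 * c2) + 2 * (cH * c3) + 1).
  by have := mulr_ge0 c10 c20; have := mulr_ge0 (ltW cH0) c30; lra.
move=> u [N MN uN]; have Nn : (0 < N)%N by case: MN.
have sK : @scales N0 (N0 * N)%N by exists N.
have MK := scales_M0 nf Tbij MN0 sK; set K := (N0 * N)%N in sK MK.
have uK : periodic T K u by rewrite /K mulnC; exact: (periodic_mul MN uN).
pose s t : 'rV[R]_(d * d) := mxvec (skewof u t).
have sP t k : powers T N0 t -> powers T K k -> s (t * k)%g = s t.
  by move=> _ Pk; apply: (congr1 mxvec); exact: (skewof_periodic MK uK t Pk).
(* Rounding makes the rotation field exactly the one generated by the lattice field [s], so no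
   further error arises here. *)
have fldE : @fld R d1 d2 G T C N0 daff s = rd u.
  apply/funext => g; apply: (congr1 (rot _)); rewrite mxvecK; apply: projW_id.
  exact: skewof_red.
have vK : periodic T K (vr u).
  by rewrite /vr -fldE; exact: (vfield_fld_periodic nf Tbij Crep MN0 sK sP).
have Wu : W u by exists K.
have Wv : W (vr u) by exists K.
have Wuv : W (u - vr u) by rewrite -scaleN1r addrC; exact: (Uper_lin nf Tbij).
have uvK : periodic T K (u - vr u) by rewrite -scaleN1r addrC; exact: periodic_lin.
have [lD lD'] := D2_bilinear.
have := psd_parallelogram (Uper_lin nf Tbij) lD lD' pos Wuv Wv.
rewrite subrK => par; apply: (le_trans par) => {par}.
have Q1 : D2 (vr u) (vr u) <= c1 * c2 * avg (C K) (gapsq u).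
  rewrite (d2E_avg nf Tbij Crep HV stab_fin Afin VA MK vK vK).
  have := c1P K s sK sP; rewrite /lform fldE -/(vr u) => h; apply: (le_trans h) => {h}.
  rewrite -mulrA ler_wpM2l//; apply: le_trans (c2P K u MK uK); apply: avg_le => g /=.
  rewrite /defect ler_sum// => a _; rewrite /s mul_rho -linearB nsq_mxvec.
  exact: lexx.
have Q2 : D2 (u - vr u) (u - vr u) <= cH * c3 * avg (C K) (gapsq u).
  rewrite (d2E_avg nf Tbij Crep HV stab_fin Afin VA MK uvK uvK).
  rewrite -mulrA; apply: le_trans (ler_wpM2l (ltW cH0) (c3P K u MK uK)).
  rewrite -avgZ; apply: avg_le => g.
  have LD : @Linfty R d (cosets_star G x0) (Dq (u - vr u) g) by exact: trunc_Linfty.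
  apply: (le_trans (ler_norm _)); apply: (le_trans (bH _ _ LD LD)).
  rewrite -mulrA -expr2 ler_wpM2l ?(ltW cH0)//.
  by have [_] := ksP (fun i => fdiff (u - vr u) g (krep i)).
rewrite (seminorm_sqr nf Tbij Crep MK uK).
have a0 : 0 <= avg (C K) (gapsq u) by apply: avg_ge0 => g; exact: gap0.
lra.
Qed.

Lemma D2_bounded : bounded_wrt snorm W D2.
Proof.
have [c c0 cP] := D2_le_seminorm; have [lD lD'] := D2_bilinear; exists c => // u v Wu Wv.
have s0 w : 0 <= snorm w by exact: sqrtr_ge0.
have h := psd_cauchy (Uper_lin nf Tbij) lD lD' pos D2_sym Wu Wv.
rewrite -(ler_pXn2r (_ : 0 < 2)%N) ?nnegrE ?mulr_ge0 ?normr_ge0 ?(ltW c0)//.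
rewrite real_normK ?num_real//; apply: (le_trans h).
have sqrE (a b e : R) : (a * b * e) ^+ 2 = a * b ^+ 2 * (a * e ^+ 2) by ring.
rewrite sqrE.
by apply: ler_pM; [exact: pos | exact: pos | exact: cP | exact: cP].
Qed.

(** Semidefiniteness puts [0] among the admissible constants; one displacement of positive seminorm
    bounds them from above. *)
Lemma lambda_fin : gorbit G x0 <> [set x0] -> lambda_a00 G x0 T C Rg V \is a fin_num.
Proof.
move=> orb; have [u Wu u0] := seminorm_nontrivial nf Tbij Crep adm orb.
set E := [set c : R | forall u, W u -> c * snorm u ^+ 2 <= D2 u u].
have E0 : E 0 by move=> v Wv; rewrite mul0r; exact: pos.
have Eub : (lambda_a00 G x0 T C Rg V <= (D2 u u / snorm u ^+ 2)%:E)%E.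
  apply: ge_ereal_sup => _ [c Ec <-]; rewrite lee_fin ler_pdivlMr//; exact: Ec.
apply: fin_real; apply/andP; split; last exact: (le_lt_trans Eub (ltry _)).
apply: (lt_le_trans (ltNyr 0)); apply: ereal_sup_ubound; exists 0 => //.
Qed.

End EnergyBound.

Theorem theorem3p20 (R : realType) (d1 d2 : nat)
    (S : groupClosed (euclid R d2)) (G : groupClosed (euclid R (d1 + d2)))
    (x0 : 'cV[R]_(d1 + d2)) (daff : nat)
    (T : set (elt G)) (C : nat -> {fset elt G})
    (V : (cosets_star G x0 -> 'cV[R]_(d1 + d2)) -> R) (Rg : {fset elt G}) :
  normal_form S G ->
  normalized_coordinates G x0 daff ->
  set_bij T (translations S) (fun t => dsum_proj (val t)) ->
  (forall N, M0 T N -> representatives (C N) (powers T N)) ->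
  gorbit G x0 <> [set x0] ->
  interaction_potential G x0 V ->
  finite_range G x0 V ->
  admissible_range G x0 Rg ->
  (forall u, UperG G T u -> dE G x0 T C V (cst x0) u = 0) ->
  (forall u, UperG G T u -> 0 <= d2E G x0 T C V (cst x0) u u) ->
  bounded_wrt (seminorm00 G x0 T C Rg) (UperG G T) (d2E G x0 T C V (cst x0)) /\
  lambda_a00 G x0 T C Rg V \is a fin_num.
Proof.
move=> nf nc Tbij Crep orb HV [A Afin VA] adm dE0 pos; split.
  exact: (D2_bounded nf Tbij Crep nc adm HV Afin VA dE0 pos).
exact: (lambda_fin nf Tbij Crep adm pos orb).
Qed.
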